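(* Let $\alpha>0$, let $Q=I\times B$ be an $\alpha$-parabolic cylinder of radius $r$, let $\rho\in L^1(Q)$ with $\rho\ge0$ and $\|\rho\|_\infty\le c_0|Q|^{-1}\|\rho\|_1$, and let $a\in L^1(I;W^{1,1}(B))$. Then $$\frac1{|Q|}\int_Q\Big|\frac{a-\langle a\rangle_\rho}{r}\Big|\,dz\le c\,\frac1{|Q|}\int_Q|\nabla a|\,dz+c\,\alpha\,\mathcal{N}_Q(\partial_t a),$$ with $c$ depending only on $m$ and $c_0$.
   Context: An $\alpha$-parabolic cylinder of radius $r$ is $Q=(t_0-\alpha r^2,t_0+\alpha r^2)\times B_r(x_0)$; $\nabla$ is the spatial gradient. $\langle a\rangle_\rho:=\frac1{\|\rho\|_1}\int_Q a\rho\,dz$. $\mathcal{F}_Q:=\{\xi\in C^\infty_0(Q):\|\xi\|_\infty+r\|\nabla\xi\|_\infty+\alpha r^2\|\partial_t\xi\|_\infty\le1\}$ and for a distribution $b\in\mathcal{D}'(Q)$, $\mathcal{N}_Q(b):=\sup_{\xi\in\mathcal{F}_Q}r|Q|^{-1}|\langle b,\xi\rangle|$ (possibly $+\infty$); here $\langle\partial_t a,\xi\rangle=-\int_Q a\,\partial_t\xi$. *)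

(* Defs.v *)
From HB Require Import structures.
From mathcomp Require Import all_boot all_order all_algebra.
From mathcomp Require Import all_classical all_reals all_analysis.
Set Implicit Arguments. Unset Strict Implicit. Unset Printing Implicit Defensive.
Import Order.TTheory GRing.Theory Num.Theory.
Import numFieldNormedType.Exports.
Local Open Scope classical_set_scope.
Local Open Scope ring_scope.

(* Euclidean space R^(k+1), realized as nested pairs R * (R * ( ... * R)),
   equipped with the product sigma-algebra of Borel sets. *)
Fixpoint Rmeas (R : realType) (k : nat) : {d : measure_display & measurableType d} :=
  match k with
  | 0 => existT (fun d => measurableType d) _ (measurableTypeR R)
  | k'.+1 => existT (fun d => measurableType d) _ ((measurableTypeR R * projT2 (Rmeas R k'))%type : measurableType _)
  end.

Definition car (R : realType) (k : nat) : measurableType (projT1 (Rmeas R k)) :=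
  projT2 (Rmeas R k).

Fixpoint leb (R : realType) (k : nat) : {measure set (car R k) -> \bar R} :=
  match k return {measure set (car R k) -> \bar R} with
  | 0 => @lebesgue_measure R
  | k'.+1 => ((@lebesgue_measure R) \x^ (leb R k'))%E
  end.

Fixpoint zerov (R : realType) (k : nat) : car R k :=
  match k return car R k with
  | 0 => (0 : R)
  | k'.+1 => ((0 : R), zerov R k')
  end.

Fixpoint addv (R : realType) (k : nat) : car R k -> car R k -> car R k :=
  match k return car R k -> car R k -> car R k with
  | 0 => fun x y : R => x + y
  | k'.+1 => fun x y => ((x.1 + y.1 : R), addv x.2 y.2)
  end.

Fixpoint scalev (R : realType) (k : nat) (s : R) : car R k -> car R k :=
  match k return car R k -> car R k with
  | 0 => fun x : R => s * x
  | k'.+1 => fun x => ((s * x.1 : R), scalev s x.2)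
  end.

Definition subv (R : realType) (k : nat) (x y : car R k) : car R k :=
  addv x (scalev (-1) y).

Fixpoint dotv (R : realType) (k : nat) : car R k -> car R k -> R :=
  match k return car R k -> car R k -> R with
  | 0 => fun x y : R => x * y
  | k'.+1 => fun x y => (x.1 : R) * y.1 + dotv x.2 y.2
  end.

Definition enorm (R : realType) (k : nat) (x : car R k) : R := Num.sqrt (dotv x x).

Definition dirder (R : realType) (k : nat) (f : car R k -> R) (z v : car R k) : R :=
  derive1 (fun s : R => f (addv z (scalev s v))) 0.
Definition dirderivable (R : realType) (k : nat) (f : car R k -> R) (z v : car R k) : Prop :=
  derivable (fun s : R => f (addv z (scalev s v))) 0 1.

Fixpoint iterD (R : realType) (k : nat) (vs : seq (car R k)) (f : car R k -> R) : car R k -> R :=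
  match vs with
  | [::] => f
  | v :: vs' => fun z => dirder (iterD vs' f) z v
  end.

Definition econt (R : realType) (k : nat) (g : car R k -> R) : Prop :=
  forall z (eps : R), 0 < eps -> exists2 del : R, 0 < del &
    forall w, enorm (subv w z) < del -> `|g w - g z| < eps.

Definition smooth (R : realType) (k : nat) (f : car R k -> R) : Prop :=
  forall vs : seq (car R k),
    econt (iterD vs f) /\ forall z v, dirderivable (iterD vs f) z v.

Definition eclosed (R : realType) (k : nat) (K : set (car R k)) : Prop :=
  forall z, (forall eps : R, 0 < eps -> exists2 w, K w & enorm (subv w z) < eps) -> K z.
Definition ebounded (R : realType) (k : nat) (K : set (car R k)) : Prop :=
  exists M : R, forall z, K z -> enorm z <= M.

Definition compact_support_in (R : realType) (k : nat) (D : set (car R k)) (f : car R k -> R) : Prop :=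
  exists K : set (car R k), [/\ eclosed K, ebounded K, K `<=` D & forall z, ~ K z -> f z = 0].

Definition Cc_infty (R : realType) (k : nat) (D : set (car R k)) (f : car R k -> R) : Prop :=
  smooth f /\ compact_support_in D f.

(* Space-time R x R^(k+1) = car R k.+1, points z = (t, x) with z.1 = t, z.2 = x.
   Spatial dimension m = k+1. *)

Definition pcyl (R : realType) (k : nat) (alpha r t0 : R) (x0 : car R k) : set (car R k.+1) :=
  [set z | t0 - alpha * r ^+ 2 < (z.1 : R) < t0 + alpha * r ^+ 2 /\ enorm (subv z.2 x0) < r].

Definition dt (R : realType) (k : nat) (f : car R k.+1 -> R) (z : car R k.+1) : R :=
  dirder f z ((1 : R), zerov R k).

Fixpoint gradof (R : realType) (k : nat) : (car R k -> R) -> car R k :=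
  match k return (car R k -> R) -> car R k with
  | 0 => fun D => D (1 : R)
  | k'.+1 => fun D => (D ((1 : R), zerov R k'), gradof (fun v => D ((0 : R), v)))
  end.

Definition gradx (R : realType) (k : nat) (f : car R k.+1 -> R) (z : car R k.+1) : car R k :=
  gradof (fun v : car R k => dirder f z ((0 : R), v)).

Definition supn (R : realType) (k : nat) (g : car R k -> R) : \bar R :=
  ereal_sup [set (`|g z|)%:E | z in [set: car R k]].

Definition FQ (R : realType) (k : nat) (alpha r t0 : R) (x0 : car R k) (xi : car R k.+1 -> R) : Prop :=
  Cc_infty (pcyl alpha r t0 x0) xi /\
  (supn xi + (r%:E * supn (fun z => enorm (gradx xi z)))
     + ((alpha * r ^+ 2)%:E * supn (dt xi)) <= 1)%E.

(* |Q| (as a real number; Q is bounded open nonempty so its measure is finite) *)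
Definition volQ (R : realType) (k : nat) (alpha r t0 : R) (x0 : car R k) : R :=
  fine (leb R k.+1 (pcyl alpha r t0 x0)).

(* N_Q(partial_t a) = sup_{xi in F_Q} r |Q|^-1 |<partial_t a, xi>|,
   where <partial_t a, xi> = - int_Q a partial_t xi *)
Definition NQ_dt (R : realType) (k : nat) (alpha r t0 : R) (x0 : car R k) (a : car R k.+1 -> R) : \bar R :=
  ereal_sup [set ((r / volQ alpha r t0 x0)%:E *
                  `| - (\int[leb R k.+1]_(z in pcyl alpha r t0 x0) (a z * dt xi z)%:E) |)%E
            | xi in FQ alpha r t0 x0].

Definition weak_gradx (R : realType) (k : nat) (D : set (car R k.+1))
    (a : car R k.+1 -> R) (g : car R k.+1 -> car R k) : Prop :=
  (forall v : car R k, measurable_fun D (fun z => dotv (g z) v)) /\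
  (leb R k.+1).-integrable D (fun z => (enorm (g z))%:E) /\
  forall (phi : car R k.+1 -> R) (v : car R k), Cc_infty D phi ->
    (\int[leb R k.+1]_(z in D) (a z * dirder phi z ((0 : R), v))%:E
     = - \int[leb R k.+1]_(z in D) (dotv (g z) v * phi z)%:E)%E.

Definition wmean (R : realType) (k : nat) (D : set (car R k.+1)) (rho a : car R k.+1 -> R) : R :=
  fine (\int[leb R k.+1]_(z in D) (a z * rho z)%:E) / fine (\int[leb R k.+1]_(z in D) (rho z)%:E).

(* Main.v *)
Require Import Defs.
From HB Require Import structures.
From mathcomp Require Import all_boot all_order all_algebra.
From mathcomp Require Import all_classical all_reals all_analysis.
From mathcomp Require Import measurable_realfun ring lra.
Import Defs.
Import Order.TTheory GRing.Theory Num.Theory.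
Import numFieldNormedType.Exports.
Local Open Scope classical_set_scope.
Local Open Scope ring_scope.
Set Implicit Arguments. Unset Strict Implicit. Unset Printing Implicit Defensive.

(* Write [m = k.+1] for the spatial dimension, [Q = I x B] and [M = r * int_Q |g|].

   Space.  Fix [w] in [B] and a test function [h].  For [1 <= s <= 2] the rescaled
   functions [s^m h(t, w + s (x - w))] are still test functions in [Q] because [B]
   is convex, and the [s]-derivative of such a function is the spatial divergence
   of [s^(m-1) h(t, w + s (x - w)) (x - w)].  Pairing with [a] and using the weak
   gradient, the mean value theorem between [s = 1] and [s = 2] gives by duality
     int_Q |a(t,x) - a(t,(x+w)/2)| <= 2^m M.
   The midpoint is symmetric in [x] and [w], so integrating over [w] bounds
   int_I int_B int_B |a(t,x) - a(t,w)|, hence the distance in [L^1(Q)] of [a] to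
   its weighted spatial mean [A(t) = int_B a(t,w) eta(w) dw].

   Time.  Let [theta] be a bump of integral one in [I] and [C = int_I A theta].
   For a test function [h] on [I], [psi = h - (int h) theta] has integral zero, so its
   primitive [phi] is a test function and [phi(t) eta(x)] is a multiple of an element
   of [F_Q]; thus [int_I (A - C) h = int_I A psi] is controlled by [N_Q], and
   duality bounds [int_I |A - C|].

   Weight.  For every constant [C], [int_Q |a - <a>_rho| <= (1 + |c0|) int_Q |a - C|].

   All test functions are taken in the class [tame], the algebra generated by
   linear forms and stable under composition with smooth functions of one variable;
   it is closed under directional derivatives, so that smoothness is automatic. *)

(** * Vector algebra *)

(** The gradient of [a] is only weak, so [a] cannot be integrated along segments; comparisons are
    made on the test function side and turned back into [L^1] bounds by duality. Contracting all the
    way to [w] would need [s] to tend to infinity; stopping at the midpoint keeps [s] in [[1, 2]],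
    and symmetry in [x] and [w] recovers the full oscillation by the triangle inequality. The factor
    [s^m] does double duty: it is the Jacobian of the dilation, and it makes the [s]-derivative an
    exact divergence. Duality rests on density: the sets whose indicator is approximated in
    [L^1(|Phi|)] by tame functions form a sigma-algebra containing the half-spaces. No volume of a
    spatial ball is computed: halving the radius divides it by [2^m], which is enough to bound the
    normalised bump by a constant over the volume. The remaining constants come from the fixed
    profile [exp(-1/x)], hence the dependence on [m] and [c0] only. *)

Section vector_algebra.
Context {R : realType}.
Implicit Types k : nat.

Lemma dotvC k (x y : car R k) : dotv x y = dotv y x.
Proof.
elim: k x y => [|k IH] x y /=; first exact: mulrC.
by rewrite mulrC IH.
Qed.

Lemma dotvDl k (x y z : car R k) : dotv (addv x y) z = dotv x z + dotv y z.
Proof.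
elim: k x y z => [|k IH] x y z /=; first exact: mulrDl.
by rewrite IH mulrDl addrACA.
Qed.

Lemma dotvZl k s (x z : car R k) : dotv (scalev s x) z = s * dotv x z.
Proof.
elim: k x z => [|k IH] x z /=; first by rewrite mulrA.
by rewrite IH mulrDr mulrA.
Qed.

Lemma dotvDr k (x y z : car R k) : dotv z (addv x y) = dotv z x + dotv z y.
Proof. by rewrite dotvC dotvDl !(dotvC z). Qed.

Lemma dotvZr k s (x z : car R k) : dotv z (scalev s x) = s * dotv z x.
Proof. by rewrite dotvC dotvZl dotvC. Qed.

Lemma dotvBl k (x y z : car R k) : dotv (subv x y) z = dotv x z - dotv y z.
Proof. by rewrite /subv dotvDl dotvZl mulN1r. Qed.

Lemma dotvBr k (x y z : car R k) : dotv z (subv x y) = dotv z x - dotv z y.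
Proof. by rewrite !(dotvC z) dotvBl. Qed.

Lemma dotv0l k (x : car R k) : dotv (zerov R k) x = 0.
Proof.
by elim: k x => [|k IH] x /=; rewrite mul0r// IH addr0.
Qed.

Lemma dotv0r k (x : car R k) : dotv x (zerov R k) = 0.
Proof. by rewrite dotvC dotv0l. Qed.

Lemma dotv_ge0 k (x : car R k) : 0 <= dotv x x.
Proof.
elim: k x => [|k IH] x /=; first by rewrite -expr2 sqr_ge0.
by rewrite addr_ge0// -expr2 sqr_ge0.
Qed.

(** Points are nested pairs; testing against vectors turns an identity between vectors into one
    between real numbers, which [dotvE] and [ring] settle. *)
Lemma dotv_ext k (x y : car R k) : (forall v, dotv x v = dotv y v) -> x = y.
Proof.
elim: k x y => [|k IH] x y /= h; first by have := h 1; rewrite !mulr1.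
case: x y h => [x1 x2] [y1 y2] /= h; congr pair.
  by have := h (1, zerov R k); rewrite /= !mulr1 !dotv0r !addr0.
by apply: IH => v; have := h (0, v); rewrite /= !mulr0 !add0r.
Qed.

Definition dotvE := (dotvDl, dotvDr, dotvZl, dotvZr, dotvBl, dotvBr, dotv0l, dotv0r).

Lemma enorm_ge0 k (x : car R k) : 0 <= enorm x.
Proof. exact: sqrtr_ge0. Qed.

Lemma sqr_enorm k (x : car R k) : enorm x ^+ 2 = dotv x x.
Proof. by rewrite sqr_sqrtr// dotv_ge0. Qed.

Lemma enorm_lt k (x : car R k) (r : R) : 0 < r -> (enorm x < r) = (dotv x x < r ^+ 2).
Proof. by move=> r0; rewrite -sqr_enorm ltr_sqr ?nnegrE ?enorm_ge0 ?ltW. Qed.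

Lemma dotv_sqr_le k (x y : car R k) : dotv x y ^+ 2 <= dotv x x * dotv y y.
Proof.
have key s t : 0 <= s ^+ 2 * dotv x x + 2 * s * t * dotv x y + t ^+ 2 * dotv y y.
  have := dotv_ge0 (addv (scalev s x) (scalev t y)).
  by rewrite !dotvE (dotvC y x); lra.
have [y0|y0] := eqVneq (dotv y y) 0; last first.
  have yp : 0 < dotv y y by rewrite lt0r y0 dotv_ge0.
  have h := key (dotv y y) (- dotv x y).
  by rewrite -subr_ge0 -(pmulr_rge0 _ yp); lra.
rewrite y0 mulr0.
(* With [dotv y y = 0] the form is linear in [t]; this choice gives it the value [- dotv x y ^+ 2],
   so nonnegativity forces the product to vanish. *)
have h := key (- dotv x y) ((dotv x x + 1) / 2).
rewrite y0 in h.
have /eqP : dotv x y ^+ 2 = 0; last by move=> /eqP ->.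
apply/eqP; rewrite eq_le sqr_ge0 andbT.
have E : (- dotv x y) ^+ 2 * dotv x x + 2 * - dotv x y * ((dotv x x + 1) / 2) * dotv x y
  + ((dotv x x + 1) / 2) ^+ 2 * 0 = - dotv x y ^+ 2 by field.
by rewrite E oppr_ge0 in h.
Qed.

Lemma normr_dotv_le k (x y : car R k) : `|dotv x y| <= enorm x * enorm y.
Proof.
rewrite -ler_sqr ?nnegrE ?mulr_ge0 ?enorm_ge0//.
by rewrite exprMn !sqr_enorm real_normK ?num_real// dotv_sqr_le.
Qed.

Lemma enormZ k s (x : car R k) : enorm (scalev s x) = `|s| * enorm x.
Proof. by rewrite /enorm !dotvE mulrA -expr2 sqrtrM ?sqr_ge0// sqrtr_sqr. Qed.

Lemma ler_enormD k (x y : car R k) : enorm (addv x y) <= enorm x + enorm y.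
Proof.
rewrite -ler_sqr ?nnegrE ?addr_ge0 ?enorm_ge0//.
rewrite sqr_enorm !dotvE (dotvC y x) sqrrD !sqr_enorm.
have := le_trans (ler_norm _) (normr_dotv_le x y).
lra.
Qed.

Lemma ler_enorm_proj2 k (x : car R k.+1) : enorm (x.2 : car R k) <= enorm x.
Proof. by rewrite ler_wsqrtr//= lerDr -expr2 sqr_ge0. Qed.

Lemma ler_enorm_proj1 k (x : car R k.+1) : `|(x.1 : R)| <= enorm x.
Proof. by rewrite -sqrtr_sqr ler_wsqrtr//= expr2 lerDl dotv_ge0. Qed.

Lemma enorm0E (x : car R 0) : enorm x = `|(x : R)|.
Proof. by rewrite /enorm/= -expr2 sqrtr_sqr. Qed.

Lemma addv0 k (x : car R k) : addv x (zerov R k) = x.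
Proof. by apply: dotv_ext => v; rewrite !dotvE addr0. Qed.

Lemma scalev0 k (x : car R k) : scalev 0 x = zerov R k.
Proof. by apply: dotv_ext => v; rewrite !dotvE mul0r. Qed.

Lemma scalev_zero k s : scalev s (zerov R k) = zerov R k.
Proof. by apply: dotv_ext => v; rewrite !dotvE mulr0. Qed.

Lemma gradof_dotv k (p : car R k) : gradof (dotv p) = p.
Proof.
elim: k p => [|k IH] p /=; first by rewrite mulr1.
case: p => p1 p2 /=; congr pair; first by rewrite mulr1 dotv0r addr0.
rewrite -[RHS]IH; congr gradof; apply/funext => v.
by rewrite mulr0 add0r.
Qed.

(* [bv k i] is the [i]-th vector of the standard basis, for [i <= k]. *)
Fixpoint bv k (i : nat) : car R k :=
  match k return car R k with
  | 0 => (1 : R)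
  | k'.+1 => if i is i'.+1 then ((0 : R), bv k' i') else ((1 : R), zerov R k')
  end.

Lemma sum_dotv_bv k (x y : car R k) :
  \sum_(i < k.+1) dotv x (bv k i) * dotv y (bv k i) = dotv x y.
Proof.
elim: k x y => [|k IH] x y; first by rewrite big_ord1 /= !mulr1.
rewrite big_ord_recl /= !mulr1 !dotv0r !addr0 -IH; congr +%R.
by apply: eq_bigr => i _; rewrite !mulr0 !add0r.
Qed.

Lemma dotv_bv k (i : 'I_k.+1) : dotv (bv k i) (bv k i) = 1.
Proof.
elim: k i => [|k IH] i; first by rewrite /= mulr1.
case: i => -[|i] Hi /=; first by rewrite mulr1 dotv0l addr0.
by rewrite mulr0 add0r -[RHS](IH (Ordinal (Hi : (i < k.+1)%N))).
Qed.

End vector_algebra.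

(** * Tame functions *)

Section tame_functions.
Context {R : realType}.
Implicit Types k : nat.

(** Gradients are stated along lines at parameter 0; the translation returns to ordinary derivatives
    at [t]. *)
Lemma is_derive_shift (f : R -> R) (t l : R) :
  is_derive (0 : R) (1 : R) (fun s => f (t + s)) l -> is_derive t (1 : R) f l.
Proof.
move=> d0; have d1 : is_derive t (1 : R) (fun u => u - t) 1.
  have := is_deriveB (is_derive_id t (1 : R)) (is_derive_cst t t (1 : R)).
  by rewrite subr0.
have d0' : is_derive (t - t) (1 : R) (fun s => f (t + s)) l by rewrite subrr.
have := @is_derive1_comp R (fun s => f (t + s)) (fun u => u - t) t _ _ d0' d1.
by rewrite mulr1; congr is_derive; apply/funext => u /=; rewrite addrC subrK.
Qed.

(** A smooth function of one variable is handed over with all its derivatives: [F 0] is the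
    function, and dropping the first term gives its derivative as another such sequence. *)
Definition deriv_seq (F : nat -> R -> R) : Prop :=
  forall n x, is_derive x (1 : R) (F n) (F n.+1 x).

Inductive tame k : (car R k -> R) -> Prop :=
| tame_cst (c : R) : tame (fun=> c)
| tame_dotv v : tame (fun z => dotv z v)
| tameD f g : tame f -> tame g -> tame (fun z => f z + g z)
| tameM f g : tame f -> tame g -> tame (fun z => f z * g z)
| tame_comp F f : deriv_seq F -> tame f -> tame (fun z => F 0%N (f z)).

Lemma deriv_seqS F : deriv_seq F -> deriv_seq (fun n => F n.+1).
Proof. by move=> dF n x; exact: dF. Qed.

Lemma deriv_seq_continuous F n : deriv_seq F -> continuous (F n).
Proof.
move=> dF x; apply: differentiable_continuous; apply/derivable1_diffP.
by have [] := dF n x.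
Qed.

Lemma tameZ k c (f : car R k -> R) : tame f -> tame (fun z => c * f z).
Proof. by apply: tameM; exact: tame_cst. Qed.

Lemma tame_sum k (n : nat) (f : 'I_n -> car R k -> R) :
  (forall i, tame (f i)) -> tame (fun z => \sum_(i < n) f i z).
Proof.
elim: n f => [|n IH] f tf.
  rewrite (_ : (fun z => _) = fun=> 0); first exact: tame_cst.
  by apply/funext => z; rewrite big_ord0.
rewrite (_ : (fun z => _) = fun z => f ord0 z + \sum_(i < n) f (lift ord0 i) z).
  by apply: tameD => //; exact: IH.
by apply/funext => z; rewrite big_ord_recl.
Qed.

Lemma tame_precomp k k' (L : car R k -> car R k') (f : car R k' -> R) :
  (forall v, tame (fun z => dotv (L z) v)) -> tame f -> tame (fun z => f (L z)).
Proof.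
move=> tL; elim=> [c|v|{}f g _ tf _ tg|{}f g _ tf _ tg|F {}f dF _ tf].
- exact: tame_cst.
- exact: tL.
- exact: tameD.
- exact: tameM.
- exact: (tame_comp dF tf).
Qed.

(** Only derivatives along lines are recorded, the notion behind [dirder]; the content is their
    linear dependence on [v]. *)
Definition is_gradient k (f : car R k -> R) (p : car R k -> car R k) :=
  forall z v, is_derive (0 : R) (1 : R) (fun s => f (addv z (scalev s v))) (dotv (p z) v).

Lemma is_gradientM k (f g : car R k -> R) p q : is_gradient f p -> is_gradient g q ->
  is_gradient (fun z => f z * g z) (fun z => addv (scalev (f z) (q z)) (scalev (g z) (p z))).
Proof.
move=> fp gq z v; have df := fp z v; have dg := gq z v.
apply: (is_derive_eq (is_deriveM df dg)).
by rewrite /= scalev0 addv0 !dotvE.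
Qed.

Lemma is_gradient_comp k (F : nat -> R -> R) (f : car R k -> R) p :
  deriv_seq F -> is_gradient f p ->
  is_gradient (fun z => F 0%N (f z)) (fun z => scalev (F 1%N (f z)) (p z)).
Proof.
move=> dF fp z v; have df := fp z v.
have dFz : is_derive (f (addv z (scalev 0 v))) (1 : R) (F 0%N) (F 1%N (f z)).
  by rewrite scalev0 addv0; exact: dF.
by have := is_derive1_comp dFz df; rewrite dotvZl.
Qed.

Lemma is_gradient_dotv k (u : car R k) :
  is_gradient (fun z => dotv z u) (fun=> u).
Proof.
move=> z v; rewrite (_ : (fun s => _) = fun s => dotv z u + s * dotv v u); last first.
  by apply/funext => s; rewrite !dotvE.
have h := is_deriveD (is_derive_cst (dotv z u) (0 : R) (1 : R))
  (is_deriveM (is_derive_id (0 : R) (1 : R)) (is_derive_cst (dotv v u) (0 : R) (1 : R))).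
apply: (is_derive_eq h).
by rewrite /= add0r scale0r add0r dotvC -[RHS]mulr1.
Qed.

(** By induction the gradient has tame components; for a composition the outer derivative is the
    shifted sequence. This is why the class is stable under [dirder], hence made of smooth
    functions. *)
Lemma tame_gradient k (f : car R k -> R) : tame f ->
  exists2 p, (forall v, tame (fun z => dotv (p z) v)) & is_gradient f p.
Proof.
elim=> [c|v|{}f g tf [p tp fp] tg [q tq gq]|{}f g tf [p tp fp] tg [q tq gq]|F {}f dF tf [p tp fp]].
- exists (fun=> zerov R k); first by move=> v; exact: tame_cst.
  by move=> z v; rewrite dotv0l; exact: is_derive_cst.
- exists (fun=> v); first by move=> u; exact: tame_cst.
  exact: is_gradient_dotv.
- exists (fun z => addv (p z) (q z)).
    move=> v; under eq_fun do rewrite dotvDl; exact: tameD.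
  by move=> z v; rewrite dotvDl; apply: is_deriveD; [exact: fp|exact: gq].
- exists (fun z => addv (scalev (f z) (q z)) (scalev (g z) (p z))).
    move=> v; under eq_fun do rewrite !dotvE.
    by apply: tameD; exact: tameM.
  exact: is_gradientM.
- exists (fun z => scalev (F 1%N (f z)) (p z)).
    move=> v; under eq_fun do rewrite !dotvE.
    apply: tameM => //; exact: (tame_comp (deriv_seqS dF) tf).
  exact: is_gradient_comp.
Qed.

Lemma is_gradient_dirder k (f : car R k -> R) p : is_gradient f p ->
  forall z v, dirder f z v = dotv (p z) v.
Proof. by move=> fp z v; rewrite /dirder derive1E; have [] := fp z v. Qed.

Lemma tame_dirder k (f : car R k -> R) v : tame f -> tame (fun z => dirder f z v).
Proof.
move=> /tame_gradient[p tp fp].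
by under eq_fun do rewrite (is_gradient_dirder fp).
Qed.

Lemma tame_econt k (f : car R k -> R) : tame f -> econt f.
Proof.
elim=> [c|v|{}f g _ cf _ cg|{}f g _ cf _ cg|F {}f dF _ cf] z eps eps0.
- by exists 1 => // w _; rewrite subrr normr0.
- exists (eps / (enorm v + 1)); first by rewrite divr_gt0// ltr_wpDl// enorm_ge0.
  move=> w; rewrite ltr_pdivlMr ?ltr_wpDl ?enorm_ge0// => h.
  rewrite -dotvBl; apply: le_lt_trans h.
  by rewrite (le_trans (normr_dotv_le _ _))// ler_wpM2l ?enorm_ge0// lerDl.
- have [d1 d10 h1] := cf z _ (divr_gt0 eps0 (ltr0Sn R 1)).
  have [d2 d20 h2] := cg z _ (divr_gt0 eps0 (ltr0Sn R 1)).
  exists (Num.min d1 d2); first by rewrite lt_min d10.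
  move=> w; rewrite lt_min => /andP[/h1 H1 /h2 H2].
  rewrite opprD addrACA (le_lt_trans (ler_normD _ _))//; lra.
(* When both increments are below [e <= 1], the three terms of the expanded difference add up to
   less than [e (1 + |f z| + |g z|)], which [M] dominates. *)
- pose M := `|f z| + `|g z| + 2.
  have M0 : 0 < M by rewrite /M ltr_wpDl// addr_ge0.
  pose e := Num.min 1 (eps / M).
  have e0 : 0 < e by rewrite lt_min ltr01 divr_gt0.
  have [d1 d10 h1] := cf z _ e0.
  have [d2 d20 h2] := cg z _ e0.
  exists (Num.min d1 d2); first by rewrite lt_min d10.
  move=> w; rewrite lt_min => /andP[/h1 H1 /h2 H2].
  have -> : f w * g w - f z * g z =
    (f w - f z) * (g w - g z) + (f w - f z) * g z + f z * (g w - g z) by ring.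
  have [e1 e2] : e <= 1 /\ e * M <= eps.
    by rewrite -ler_pdivlMr// !ge_min !lexx orbT.
  apply: le_lt_trans (_ : `|f w - f z| * `|g w - g z| + `|f w - f z| * `|g z|
    + `|f z| * `|g w - g z| < _).
    by rewrite (le_trans (ler_normD _ _))// normrM lerD// (le_trans (ler_normD _ _))// !normrM.
  move: H1 H2 (normr_ge0 (f w - f z)) (normr_ge0 (g w - g z)).
  move: `|f w - f z| `|g w - g z| => A B HA HB A0 B0.
  have := normr_ge0 (f z); have := normr_ge0 (g z).
  have : A * B <= A by rewrite ler_piMr// (le_trans (ltW HB)).
  have : A * `|g z| <= e * `|g z| by rewrite ler_wpM2r// ltW.
  have : `|f z| * B <= e * `|f z| by rewrite mulrC ler_wpM2r// ltW.
  rewrite /M in e2; lra.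
- have /cvgrPdist_lt /(_ _ eps0) /nbhs_ballP[d1 /= d10 h1] := deriv_seq_continuous (n:=0%N) dF (x := f z).
  have [d2 d20 h2] := cf z _ d10.
  exists d2 => // w /h2 H; rewrite distrC; apply: h1.
  by rewrite /ball/= distrC.
Qed.

Lemma tame_smooth k (f : car R k -> R) : tame f -> smooth f.
Proof.
move=> tf vs.
have t : tame (iterD vs f) by elim: vs => [//|v vs IH] /=; exact: tame_dirder.
split; first exact: tame_econt.
move=> z v; have [p _ fp] := tame_gradient t.
by have [] := fp z v.
Qed.

(** For a composition, the inner values stay in a segment [[- C, C]], on which the extreme value
    theorem bounds the outer function. *)
Lemma tame_bounded k (f : car R k -> R) (M : R) : tame f ->
  exists2 C, 0 <= C & forall z, enorm z <= M -> `|f z| <= C.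
Proof.
elim=> [c|v|{}f g _ [C C0 hf] _ [D D0 hg]|{}f g _ [C C0 hf] _ [D D0 hg]|F {}f dF _ [C C0 hf]].
- by exists `|c|.
- exists (`|M| * enorm v); first by rewrite mulr_ge0// enorm_ge0.
  move=> z zM; rewrite (le_trans (normr_dotv_le _ _))// ler_wpM2r ?enorm_ge0//.
  by rewrite (le_trans zM)// ler_norm.
- exists (C + D); first exact: addr_ge0.
  by move=> z zM; rewrite (le_trans (ler_normD _ _))// lerD// ?hf ?hg.
- exists (C * D); first exact: mulr_ge0.
  by move=> z zM; rewrite normrM ler_pM// ?hf ?hg.
- have cF : {within `[- C, C], continuous (fun x => `|F 0%N x|)}.
    apply: continuous_subspaceT => x; apply: (@continuous_comp _ _ _ (F 0%N) (fun y : R => `|y|)).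
      exact: deriv_seq_continuous.
    exact: norm_continuous.
  have CC : - C <= C by rewrite (le_trans _ C0)// oppr_le0.
  have [c cC hc] := EVT_max CC cF.
  exists `|F 0%N c| => // z /hf; rewrite ler_norml => zC.
  by apply: hc; rewrite in_itv.
Qed.

Lemma measurable_dotv k (v : car R k) : measurable_fun setT (fun z : car R k => dotv z v).
Proof.
elim: k v => [|k IH] v.
  exact: (measurable_funM (@measurable_id _ (measurableTypeR R) setT) (measurable_cst _)).
apply: measurable_funD.
  by apply: measurable_funM; [exact: measurable_fst|exact: measurable_cst].
exact: (measurableT_comp (IH v.2) measurable_snd).
Qed.

Lemma tame_measurable k (f : car R k -> R) : tame f -> measurable_fun setT f.
Proof.
elim=> [c|v|{}f g _ mf _ mg|{}f g _ mf _ mg|F {}f dF _ mf].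
- exact: measurable_cst.
- exact: measurable_dotv.
- exact: measurable_funD.
- exact: measurable_funM.
- apply: (measurableT_comp _ mf).
  by apply: continuous_measurable_fun; exact: deriv_seq_continuous.
Qed.

End tame_functions.

(** * A flat bump function *)

Section flat_exponential.
Context {R : realType}.
Implicit Types (P : {poly R}) (x : R).

(** The functions [P(1/x) exp(-1/x)], extended by zero: a family that contains the usual flat
    function and is closed under differentiation. *)
Definition flat_exp P x : R := if 0 < x then P.[x^-1] * expR (- x^-1) else 0.

(** With [y = 1/x] one has [dy/dx = - y^2], so the derivative of [P(y) exp(-y)] is
    [y^2 (P(y) - P'(y)) exp(-y)]. *)
Definition next_poly P : {poly R} := 'X^2 * (P - P^`()).

Lemma flat_exp_le0 P x : x <= 0 -> flat_exp P x = 0.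
Proof. by rewrite /flat_exp leNgt => /negbTE ->. Qed.

Lemma horner_le_pow P : exists2 C : R, 0 <= C &
  forall y, 1 <= y -> `|P.[y]| <= C * y ^+ size P.
Proof.
exists (\sum_(i < size P) `|P`_i|); first exact: sumr_ge0.
move=> y y1; rewrite horner_coef mulr_suml.
apply: le_trans (ler_norm_sum _ _ _) _; apply: ler_sum => i _.
rewrite normrM ler_wpM2l// normrX ger0_norm ?(le_trans _ y1)//.
by rewrite ler_weXn2l// ltnW.
Qed.

(** The exponential beats the polynomial: [exp y >= y^(n+2) / (n+2)!] with [n = size P] leaves a
    factor [y^(-2) = x^2]. A quadratic bound makes the derivative at 0 vanish. *)
Lemma flat_exp_quadratic P : exists2 C : R, 0 <= C &
  forall x, x <= 1 -> `|flat_exp P x| <= C * x ^+ 2.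
Proof.
have [C C0 hC] := horner_le_pow P; pose n := size P.
exists (C * n.+2`!%:R); first by rewrite mulr_ge0// ler0n.
move=> x x1; have [x0|x0] := leP x 0.
  by rewrite flat_exp_le0// normr0 mulr_ge0 ?sqr_ge0// mulr_ge0// ler0n.
rewrite /flat_exp x0; pose y := x^-1.
have y1 : 1 <= y by rewrite /y invf_ge1.
have y0 : 0 < y by rewrite (lt_le_trans _ y1).
have -> : x = y^-1 by rewrite /y invrK.
rewrite invrK expRN normrM [X in _ * X]ger0_norm ?invr_ge0 ?expR_ge0//.
have hexp : y ^+ n.+2 / n.+2`!%:R <= expR y.
  by apply: le_trans (expR_ge1Dxn n.+1 (ltW y0)); rewrite lerDr.
rewrite ler_pdivrMr ?expR_gt0//.
apply: le_trans (hC _ y1) _; rewrite -mulrA -mulrA ler_wpM2l//.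
have f0 : 0 < n.+2`!%:R :> R by rewrite ltr0n fact_gt0.
rewrite ler_pdivrMr// in hexp.
by rewrite mulrAC [y^-1 ^+ 2]exprVn ler_pdivlMr ?exprn_gt0// -exprD addn2 mulrC.
Qed.

Lemma is_derive_quadratic (f : R -> R) (C : R) : f 0 = 0 ->
  (forall x, x <= 1 -> `|f x| <= C * x ^+ 2) -> is_derive (0 : R) (1 : R) f 0.
Proof.
move=> f0 hf.
suff h : h^-1 *: (f (h *: 1 + 0) - f 0) @[h --> (0 : R)^'] --> (0 : R).
  apply: DeriveDef; first by apply/cvg_ex; exists 0.
  exact: cvg_lim h.
apply/cvgrPdist_le => /= e e0; near=> h.
rewrite sub0r normrN f0 subr0 addr0 /GRing.scale/= mulr1 normrM normfV.
have hn0 : h != 0 by near: h; exact: nbhs_dnbhs_neq.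
have hpos : 0 < `|h| by rewrite normr_gt0.
rewrite mulrC ler_pdivrMr//.
have h1 : `|h| <= 1 by near: h; apply: dnbhs0_le.
apply: le_trans (hf _ (le_trans (ler_norm _) h1)) _.
rewrite -real_normK ?num_real// expr2 mulrA ler_wpM2r//.
apply: le_trans (_ : (`|C| + 1) * `|h| <= _).
  by rewrite ler_wpM2r// ler_wpDr// ler_norm.
rewrite mulrC -ler_pdivlMr ?ltr_wpDl//.
by near: h; apply: dnbhs0_le; rewrite divr_gt0// ltr_wpDl.
Unshelve. all: by end_near. Qed.

Lemma is_derive_flat_exp P x :
  is_derive x (1 : R) (flat_exp P) (flat_exp (next_poly P) x).
Proof.
have [x0|x0|->] := ltgtP x 0.
- rewrite [X in is_derive _ _ _ X]flat_exp_le0 ?ltW//.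
  apply: (near_eq_is_derive _ (is_derive_cst (0 : R) x (1 : R))).
  near=> y; rewrite flat_exp_le0//; apply: ltW.
  by near: y; exact: lt_nbhsl.
- rewrite /flat_exp x0.
  have xn0 : x != 0 by rewrite gt_eqF.
  have dV := @is_deriveV R id x 1 1 xn0 (is_derive_id x 1).
  have dP := is_derive1_comp (is_derive_poly P (x^-1)) dV.
  have dE := @is_derive1_comp R expR (fun y => - y^-1) x _ _
    (is_derive_expR (- x^-1)) (is_deriveN dV).
  apply: (near_eq_is_derive _ (is_derive_eq (is_deriveM dP dE) _)).
    near=> y; rewrite ifT//; near: y; exact: lt_nbhsr.
  rewrite /= /next_poly /GRing.scale/= !hornerE exprVn /=.
  ring.
- rewrite [X in is_derive _ _ _ X]flat_exp_le0//.
  have [C _ hC] := flat_exp_quadratic P.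
  by apply: is_derive_quadratic hC; rewrite flat_exp_le0.
Unshelve. all: by end_near. Qed.

Lemma deriv_seq_flat_exp : deriv_seq (fun n => flat_exp (iter n next_poly 1)).
Proof. by move=> n x; exact: is_derive_flat_exp. Qed.

Definition bump : R -> R := flat_exp 1.

Lemma bump_gt0E x : 0 < x -> bump x = expR (- x^-1).
Proof. by move=> x0; rewrite /bump/flat_exp x0 hornerC mul1r. Qed.

Lemma bump_eq0 x : x <= 0 -> bump x = 0.
Proof. exact: flat_exp_le0. Qed.

Lemma bump_ge0 x : 0 <= bump x.
Proof.
have [/bump_eq0->//|x0] := leP x 0.
by rewrite bump_gt0E// expR_ge0.
Qed.

Lemma bump_le1 x : bump x <= 1.
Proof.
have [/bump_eq0->//|x0] := leP x 0.
by rewrite bump_gt0E// -expR0 ler_expR oppr_le0 invr_ge0 ltW.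
Qed.

(** The value of [exp(-1/x)] at [x = 1/2], by monotonicity; this number enters [wconst]. *)
Lemma bump_ge_half x : 2^-1 <= x -> expR (- 2) <= bump x.
Proof.
move=> x2; have x0 : 0 < x by apply: lt_le_trans x2; rewrite invr_gt0.
by rewrite bump_gt0E// ler_expR lerN2 -[leRHS]invrK lef_pV2 ?posrE ?invr_gt0.
Qed.

(** Subtracting 1 makes the function vanish for [n x <= 1], so it is a cutoff supported away from 0
    that still tends to 1 at every positive [x]. *)
Lemma bump_cvg1 x : 0 < x -> bump (n%:R * x - 1) @[n --> \oo] --> (1 : R).
Proof.
move=> x0; apply/cvgrPdist_le => e e0; near=> n.
have h : e^-1 <= n%:R * x - 1.
  rewrite lerBrDr -ler_pdivrMr//.
  by near: n; exact: nbhs_infty_ger.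
have ei : 0 < e^-1 by rewrite invr_gt0.
have y0 := lt_le_trans ei h.
rewrite ger0_norm ?subr_ge0 ?bump_le1// bump_gt0E//.
rewrite lerBlDr -lerBlDl; apply: le_trans (expR_ge1Dx _).
by rewrite lerD2l lerN2 -[leRHS]invrK lef_pV2 ?posrE.
Unshelve. all: by end_near. Qed.

Definition dbump : R -> R := flat_exp (next_poly 1).

(** The quadratic bound covers [x <= 1], the range where [bball] evaluates the bump: its argument is
    [1 - 2 / r ^+ 2 * sqdist x0 x]. *)
Lemma dbump_bounded : exists2 C : R, 0 <= C & forall x, x <= 1 -> `|dbump x| <= C.
Proof.
have [C C0 h] := flat_exp_quadratic (next_poly 1).
exists C => // x x1; have [x0|x0] := leP x 0.
  by rewrite /dbump flat_exp_le0 ?normr0.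
apply: le_trans (h _ x1) _; rewrite ler_piMr//.
by rewrite expr_le1// ltW.
Qed.

End flat_exponential.

(** * Smooth cutoffs and bumps on balls *)

Section cutoffs.
Context {R : realType}.
Implicit Types k : nat.

Definition sqdist k (x0 x : car R k) : R := dotv (subv x x0) (subv x x0).

Lemma tame_dotvB k (x0 v : car R k) : tame (fun x : car R k => dotv (subv x x0) v).
Proof.
under eq_fun do rewrite dotvBl.
apply: tameD; [exact: tame_dotv|exact: tame_cst].
Qed.

Lemma tame_sqdist k (x0 : car R k) : tame (sqdist x0).
Proof.
rewrite (_ : sqdist x0 = fun x : car R k => \sum_(i < k.+1)
  dotv (subv x x0) (bv k i) * dotv (subv x x0) (bv k i)).
  by apply: tame_sum => i; apply: tameM; exact: tame_dotvB.
by apply/funext => x; rewrite sum_dotv_bv.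
Qed.

Lemma is_gradient_sqdist k (x0 : car R k) :
  is_gradient (sqdist x0) (fun x => scalev 2 (subv x x0)).
Proof.
move=> z v; rewrite (_ : (fun s => _) = horner ((dotv v v)%:P * 'X * 'X +
   (2 * dotv (subv z x0) v)%:P * 'X + (sqdist x0 z)%:P)); last first.
  apply/funext => s; rewrite !hornerE /sqdist !dotvE (dotvC v z) (dotvC x0 z) (dotvC v x0).
  rewrite /=; ring.
apply: (is_derive_eq (is_derive_poly _ _)).
rewrite !(derivD, derivM, derivX, derivC) !hornerE /= !dotvE; ring.
Qed.

Lemma tame_affine_sqdist k (x0 : car R k) (a b : R) : tame (fun x => a + b * sqdist x0 x).
Proof. by apply: tameD; [exact: tame_cst|apply: tameZ; exact: tame_sqdist]. Qed.

Lemma sqdist_ge0 k (x0 x : car R k) : 0 <= sqdist x0 x.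
Proof. exact: dotv_ge0. Qed.

(** For [n > 0] it vanishes as soon as [|x - x0|^2 >= r^2 - 1/n], and it tends to 1 at each point of
    the open ball: an exhausting sequence of compactly supported cutoffs. *)
Definition bcut k (x0 : car R k) (r : R) (n : nat) (x : car R k) : R :=
  bump (n%:R * (r ^+ 2 - sqdist x0 x) - 1).

Lemma tame_bcut k (x0 : car R k) r n : tame (bcut x0 r n).
Proof.
have := tame_comp deriv_seq_flat_exp (tame_affine_sqdist x0 (n%:R * r ^+ 2 - 1) (- n%:R)).
congr tame; apply/funext => x /=; rewrite /bcut/bump; congr flat_exp; ring.
Qed.

(** A single bump at scale [r]: positive only where [|x - x0|^2 < r^2 / 2], and at least [exp(-2)]
    on the ball of radius [r / 2]. *)
Definition bball k (x0 : car R k) (r : R) (x : car R k) : R :=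
  bump (1 - 2 / r ^+ 2 * sqdist x0 x).

Lemma tame_bball k (x0 : car R k) r : tame (bball x0 r).
Proof.
have := tame_comp deriv_seq_flat_exp (tame_affine_sqdist x0 1 (- (2 / r ^+ 2))).
congr tame; apply/funext => x /=; rewrite /bball/bump; congr flat_exp; ring.
Qed.

Lemma is_gradient_bball k (x0 : car R k) r : is_gradient (bball x0 r)
  (fun x => scalev (dbump (1 - 2 / r ^+ 2 * sqdist x0 x) * - (4 / r ^+ 2)) (subv x x0)).
Proof.
have h : is_gradient (fun x => 1 + - (2 / r ^+ 2) * sqdist x0 x)
    (fun x => scalev (- (4 / r ^+ 2)) (subv x x0)).
  move=> z v; have dS := is_gradient_sqdist x0 z v.
  have := is_deriveD (is_derive_cst (1 : R) (0 : R) (1 : R)) (is_deriveZ (- (2 / r ^+ 2)) dS).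
  move=> dA; apply: (is_derive_eq dA); rewrite add0r /GRing.scale/= !dotvZl; ring.
move=> z v; have := is_gradient_comp deriv_seq_flat_exp h z v.
rewrite (_ : (fun s => _) = (fun s => bball x0 r (addv z (scalev s v)))); last first.
  by apply/funext => s; rewrite /bball/bump mulNr.
by move=> dA; apply: (is_derive_eq dA); rewrite /= !dotvZl mulNr mulrA.
Qed.

End cutoffs.

(** * Lebesgue measure on products and balls *)

Section lebesgue_product.
Context {R : realType}.
Implicit Types k : nat.
Local Open Scope ereal_scope.

Lemma leb_sigma_finite k : sigma_finite setT (leb R k).
Proof.
elim: k => [|k IH]; first exact: (sigma_finiteT (@lebesgue_measure R)).
have /sigma_finiteP[F [TF ndF Foo]] := sigma_finiteT (@lebesgue_measure R).
have /sigma_finiteP[G [TG ndG Goo]] := IH.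
exists (fun n => F n `*` G n).
  rewrite -setXTT TF TG predeqE => -[x y]; split.
    move=> [/= [n _ Fnx] [j _ Gky]]; exists (maxn n j) => //; split.
    - by move: x Fnx; exact/subsetPset/ndF/leq_maxl.
    - by move: y Gky; exact/subsetPset/ndG/leq_maxr.
  by move=> [n _ []/= ? ?]; split; exists n.
move=> j; have [? ?] := Foo j; have [? ?] := Goo j.
split; first exact: measurableX.
rewrite /= product_measure2E// lte_mul_pinfty//.
by rewrite ge0_fin_numE.
Qed.

(** The same measure under a name that carries the sigma-finite structure required by Tonelli and
    Fubini. *)
Definition lebs k : set (car R k) -> \bar R := leb R k.
Arguments lebs : clear implicits.
HB.instance Definition _ k := Measure.copy (lebs k) (leb R k).
HB.instance Definition _ k :=
  Measure_isSigmaFinite.Build _ _ _ (lebs k) (leb_sigma_finite k).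

(** [leb] is built from one of the two iterated product constructions, the Fubini lemmas from the
    other; both give a rectangle the product of its sides, and such a measure is unique. *)
Lemma leb_prodE k (A : set (car R k.+1)) : measurable A ->
  (@lebesgue_measure R \x lebs k) A = leb R k.+1 A.
Proof.
move=> mA; apply: (@product_measure_unique _ _ _ _ R (@lebesgue_measure R) (lebs k) (leb R k.+1)) => // B C mB mC.
exact: product_measure2E.
Qed.

Lemma leb_setX k (A : set R) (B : set (car R k)) :
  measurable (A : set (measurableTypeR R)) -> measurable B ->
  leb R k.+1 (A `*` B) = lebesgue_measure A * leb R k B.
Proof. by move=> mA mB; exact: product_measure2E. Qed.

Lemma integral_leb_prodE k (f : car R k.+1 -> \bar R) :
  \int[leb R k.+1]_z f z = \int[@lebesgue_measure R \x lebs k]_z f z.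
Proof. by apply: eq_measure_integral => A mA _; rewrite /= leb_prodE. Qed.

Section tonelli.
Variables (k : nat) (f : car R k.+1 -> \bar R).
Hypotheses (mf : measurable_fun setT f) (f0 : forall z, 0 <= f z).

Lemma leb_tonelli1 :
  \int[leb R k.+1]_z f z = \int[lebesgue_measure]_t \int[leb R k]_x f (t, x).
Proof.
by rewrite integral_leb_prodE (@fubini_tonelli1 _ _ _ _ _ _ (lebs k)).
Qed.

Lemma leb_tonelli2 :
  \int[leb R k.+1]_z f z = \int[leb R k]_x \int[lebesgue_measure]_t f (t, x).
Proof.
by rewrite integral_leb_prodE (@fubini_tonelli2 _ _ _ _ _ _ (lebs k)).
Qed.

Lemma measurable_leb_tonelli1 :
  measurable_fun setT (fun t : measurableTypeR R => \int[leb R k]_x f (t, x)).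
Proof. exact: (@measurable_fun_fubini_tonelli_F _ _ _ _ _ (lebs k) f mf f0). Qed.

End tonelli.

Section fubini.
Variables (k : nat) (f : car R k.+1 -> \bar R).
Hypothesis intf : (leb R k.+1).-integrable setT f.

Let intf' : (@lebesgue_measure R \x lebs k).-integrable setT f.
Proof.
have /integrableP[mf foo] := intf; apply/integrableP; split => //.
by rewrite -integral_leb_prodE.
Qed.

Lemma leb_fubini :
  \int[leb R k.+1]_z f z = \int[lebesgue_measure]_t \int[leb R k]_x f (t, x).
Proof. by rewrite integral_leb_prodE -integral12_prod_meas1. Qed.

Lemma leb_fubini_integrable :
  lebesgue_measure.-integrable setT (fun t : measurableTypeR R => \int[leb R k]_x f (t, x)).
Proof. exact: (integrable_fubini_F intf'). Qed.

Lemma leb_fubini_ae :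
  {ae lebesgue_measure, forall t : measurableTypeR R, (leb R k).-integrable setT (fun x => f (t, x))}.
Proof. exact: (ae_integrable1 intf'). Qed.

End fubini.

Definition dil2 k (w x : car R k) : car R k := addv w (scalev 2 (subv x w)).

Lemma dil2E k (w x v : car R k) : dotv (dil2 w x) v = (2 * dotv x v - dotv w v)%R.
Proof. by rewrite /dil2 !dotvE; ring. Qed.

Lemma measurable_dil2 k (w : car R k) : measurable_fun setT (dil2 w).
Proof.
elim: k w => [|k IH] w.
  apply: (@measurable_funD _ _ R); first exact: measurable_cst.
  apply: (@measurable_funM _ _ R); first exact: measurable_cst.
  apply: (@measurable_funD _ _ R); first exact: measurable_id.
  exact: measurable_cst.
apply/measurable_fun_pairP; split => /=.
  rewrite (_ : _ \o _ = fun x : car R k.+1 => (w.1 + 2 * (x.1 + -1 * w.1))%R) //.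
  apply: (@measurable_funD _ _ R); first exact: measurable_cst.
  apply: (@measurable_funM _ _ R); first exact: measurable_cst.
  apply: (@measurable_funD _ _ R); first exact: measurable_fst.
  exact: measurable_cst.
exact: (measurableT_comp (IH w.2) measurable_snd).
Qed.

(** Lebesgue measure and twice its image under the dilation agree on half-open intervals, hence
    everywhere; the formula is then integration against an image measure. *)
Lemma lebesgue_integral_dil2 (w : R) (f : R -> \bar R) :
  measurable_fun (setT : set (measurableTypeR R)) f -> (forall x, 0 <= f x) ->
  \int[lebesgue_measure]_x f (w + 2 * (x - w))%R = (2^-1)%:E * \int[lebesgue_measure]_x f x.
Proof.
move=> mf f0; pose phi (x : measurableTypeR R) : measurableTypeR R := (w + 2 * (x - w))%R.
have mphi : measurable_fun setT phi.
  apply: (@measurable_funD _ _ R); first exact: measurable_cst.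
  apply: (@measurable_funM _ _ R); first exact: measurable_cst.
  apply: (@measurable_funD _ _ R); first exact: measurable_id.
  exact: measurable_cst.
have E : forall A, measurable A ->
    lebesgue_measure A = mscale (2%R : R)%:nng%R (pushforward lebesgue_measure phi) A.
  move=> mm; apply: lebesgue_measure_unique => _ [[a b] _ <-] /=.
  rewrite /mscale/= /pushforward.
  rewrite (_ : phi @^-1` `]a, b] = `]((a + w) / 2)%R, ((b + w) / 2)%R]%classic); last first.
    apply/seteqP; split => x /=; rewrite /phi !in_itv/= => /andP[? ?]; apply/andP; split; lra.
  rewrite !lebesgue_measure_itv/= !lte_fin.
  have -> : ((a + w) / 2 < (b + w) / 2)%R = (a < b)%R.
    by apply/idP/idP => ?; lra.
  case: ifP => _; last by rewrite mule0.
  by rewrite -!EFinB -EFinM; congr EFin; field.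
rewrite [in RHS](eq_measure_integral (mscale (2%R : R)%:nng%R (pushforward lebesgue_measure phi))); last first.
  by move=> A mA _; exact: (E mphi).
rewrite ge0_integral_mscale//.
rewrite ge0_integral_pushforward//=.
rewrite muleA -EFinM mulVf ?pnatr_eq0// mul1e.
by rewrite preimage_setT.
Qed.

Lemma leb_integral_dil2 k (w : car R k) (f : car R k -> \bar R) :
  measurable_fun setT f -> (forall x, 0 <= f x) ->
  \int[leb R k]_x f (dil2 w x) = ((2^-1) ^+ k.+1)%:E * \int[leb R k]_x f x.
Proof.
elim: k w f => [|k IH] w f mf f0.
  rewrite expr1 -(lebesgue_integral_dil2 (w : R) mf f0).
  by apply: eq_integral => x _; rewrite /dil2 /subv /= mulN1r.
have mfd : measurable_fun setT (fun z => f (dil2 w z)).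
  exact: (measurableT_comp mf (measurable_dil2 w)).
rewrite leb_tonelli1// leb_tonelli1//.
under eq_integral => t _.
  rewrite (_ : (fun x => f (dil2 w (t, x))) =
     fun x => f ((w.1 + 2 * (t - w.1))%R, dil2 w.2 x)); last first.
    by apply/funext => x; rewrite /dil2/subv/= mulN1r.
  rewrite (IH w.2 (fun x => f ((w.1 + 2 * (t - w.1))%R, x)))//; last first.
    exact: (measurableT_comp mf (measurable_pair1 _)).
  over.
have mG := measurable_leb_tonelli1 mf f0.
rewrite ge0_integralZl//; last first.
- by move=> t _; apply: integral_ge0.
- apply: (measurableT_comp mG).
  apply: (@measurable_funD _ _ R); first exact: measurable_cst.
  apply: (@measurable_funM _ _ R); first exact: measurable_cst.
  apply: (@measurable_funD _ _ R); first exact: measurable_id.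
  exact: measurable_cst.
rewrite (lebesgue_integral_dil2 w.1 mG); last by move=> t; apply: integral_ge0.
by rewrite muleA -EFinM -exprSr.
Qed.

(** Time is left alone, so the Jacobian involves the spatial dimension [k.+1] and not [k.+2]. *)
Definition xdil2 k (w : car R k) (z : car R k.+1) : car R k.+1 := ((z.1 : R), dil2 w z.2).

Lemma measurable_xdil2 k (w : car R k) : measurable_fun setT (xdil2 w).
Proof.
apply/measurable_fun_pairP; split => /=; first exact: measurable_fst.
exact: (measurableT_comp (measurable_dil2 w) measurable_snd).
Qed.

Lemma ge0_integral_xdil2 k (w : car R k) (f : car R k.+1 -> \bar R) :
  measurable_fun setT f -> (forall x, 0 <= f x) ->
  \int[leb R k.+1]_z f (xdil2 w z) = ((2^-1) ^+ k.+1)%:E * \int[leb R k.+1]_z f z.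
Proof.
move=> mf f0.
have mfd : measurable_fun setT (fun z => f (xdil2 w z)).
  exact: (measurableT_comp mf (measurable_xdil2 w)).
rewrite leb_tonelli1// leb_tonelli1//.
under eq_integral => t _.
  rewrite (leb_integral_dil2 w (f := fun x => f (t, x)))//; last first.
    exact: (measurableT_comp mf (measurable_pair1 _)).
  over.
rewrite ge0_integralZl//; last by move=> t _; apply: integral_ge0.
exact: measurable_leb_tonelli1.
Qed.

Lemma integral_xdil2 k (w : car R k) (f : car R k.+1 -> \bar R) :
  (leb R k.+1).-integrable setT f ->
  \int[leb R k.+1]_z f (xdil2 w z) = ((2^-1) ^+ k.+1)%:E * \int[leb R k.+1]_z f z.
Proof.
move=> intf; have mf := measurable_int _ intf.
rewrite integralE [in RHS]integralE.
have -> : (fun z => f (xdil2 w z))^\+ = fun z => f^\+ (xdil2 w z).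
  by apply/funext => z; rewrite !funeposE.
have -> : (fun z => f (xdil2 w z))^\- = fun z => f^\- (xdil2 w z).
  by apply/funext => z; rewrite !funenegE.
rewrite !ge0_integral_xdil2//; [|exact: measurable_funeneg|exact: measurable_funepos].
by rewrite [RHS]muleBr//; apply: fin_num_adde_defr; exact: integrable_pos_fin_num.
Qed.

End lebesgue_product.
Arguments lebs : clear implicits.

Section balls.
Context {R : realType}.
Implicit Types k : nat.

Definition eball k (x0 : car R k) (r : R) : set (car R k) := [set x | enorm (subv x x0) < r].

Lemma eballE k (x0 : car R k) (r : R) : 0 < r -> eball x0 r = [set x | sqdist x0 x < r ^+ 2].
Proof. by move=> r0; apply/seteqP; split => x /=; rewrite /eball/= enorm_lt. Qed.

Lemma measurable_eball k (x0 : car R k) (r : R) : 0 < r -> measurable (eball x0 r).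
Proof.
move=> r0; rewrite eballE//.
have := tame_measurable (tame_sqdist x0) measurableT (measurable_itv `]-oo, (r ^+ 2)[).
by rewrite setTI; congr measurable; apply/seteqP; split => x /=; rewrite in_itv.
Qed.

Lemma eball_fin k (x0 : car R k) (r : R) : 0 < r -> (leb R k (eball x0 r) < +oo)%E.
Proof.
move=> r0; have mI (t : R) : (lebesgue_measure (`](t - r)%R, (t + r)%R[ : set R) < +oo)%E.
  by rewrite lebesgue_measure_itv/=; case: ifP => // _; rewrite -EFinB ltry.
elim: k x0 => [|k IH] x0.
  rewrite (_ : eball x0 r = `]((x0 : R) - r), ((x0 : R) + r)[%classic) ?mI//.
  apply/seteqP; split => x; rewrite /eball/= enorm0E /subv/= mulN1r in_itv/= ltr_norml;
    move=> /andP[? ?]; apply/andP; split; lra.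
apply: le_lt_trans (_ : leb R k.+1 (`]((x0.1 : R) - r)%R, ((x0.1 : R) + r)%R[%classic `*` eball x0.2 r) < _)%E.
  apply: le_measure; rewrite ?inE; first exact: measurable_eball.
    by apply: measurableX; [exact: measurable_itv|exact: measurable_eball].
  move=> [t x] /= h; split => /=.
    have := le_lt_trans (ler_enorm_proj1 _) h; rewrite /subv/= mulN1r in_itv/= ltr_norml.
    by move=> /andP[? ?]; apply/andP; split; lra.
  exact: (le_lt_trans (ler_enorm_proj2 _) h).
rewrite leb_setX//; last exact: measurable_eball.
rewrite lte_mul_pinfty//; first by rewrite ge0_fin_numE ?mI.
Qed.

(** Writing the time interval as a one-dimensional ball lets the ball lemmas, cutoffs and bumps
    serve for both factors. *)
Lemma pcylE k (alpha r t0 : R) (x0 : car R k) : pcyl alpha r t0 x0 =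
  eball (t0 : car R 0) (alpha * r ^+ 2) `*` eball x0 r.
Proof.
apply/seteqP; split => -[t x]; rewrite /pcyl/eball/= enorm0E /subv/= mulN1r => -[h1 h2]; split => //.
  by move: h1; rewrite ltr_norml => /andP[? ?]; apply/andP; split; lra.
by move: h1; rewrite ltr_norml => /andP[? ?]; apply/andP; split; lra.
Qed.

(** The small ball is the preimage of the large one under the dilation of ratio 2 about [x0]. This
    ratio takes the place of a volume formula. *)
Lemma eball_half k (x0 : car R k) (r : R) : 0 < r ->
  leb R k (eball x0 (r / 2)) = (((2^-1) ^+ k.+1)%:E * leb R k (eball x0 r))%E.
Proof.
move=> r0; have mB := measurable_eball x0 r0.
have r2 : 0 < r / 2 by rewrite divr_gt0.
have mB2 := measurable_eball x0 r2.
rewrite -(setIT (eball x0 r)) -(setIT (eball x0 (r / 2))) -!integral_indic//.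
rewrite -(leb_integral_dil2 x0); last by move=> x; rewrite lee_fin.
  apply: eq_integral => x _; congr EFin; rewrite !indicE; congr (_%:R).
  congr nat_of_bool; apply/idP/idP; rewrite !inE /eball/=.
    move=> h; rewrite (_ : subv _ _ = scalev 2 (subv x x0)); last first.
      by apply: dotv_ext => v; rewrite dotvBl dil2E !dotvE; ring.
    by rewrite enormZ ger0_norm// mulrC -ltr_pdivlMr.
  rewrite (_ : subv _ _ = scalev 2 (subv x x0)); last first.
    by apply: dotv_ext => v; rewrite dotvBl dil2E !dotvE; ring.
  by rewrite enormZ ger0_norm// mulrC -ltr_pdivlMr.
by apply/measurable_EFinP; exact: measurable_indic.
Qed.

End balls.

(** * Duality in L^1 *)

Section generated.
Context {R : realType}.

Lemma sigma_algebra_setI T (G : set (set T)) : sigma_algebra setT G ->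
  forall A B, G A -> G B -> G (A `&` B).
Proof.
move=> sG A B GA GB; have [G0 GC GU] := sG.
have nG X : G X -> G (~` X) by move=> /GC; rewrite setTD.
rewrite -(setCK (A `&` B)) setCI; apply: (nG _).
rewrite -bigcup2E; apply: GU => -[|[|n]] /=; [exact: nG|exact: nG|exact: G0].
Qed.

(** Half-spaces along the axes give the half-lines in each coordinate, hence the generators of the
    product sigma-algebra; the induction runs on the sets whose preimage under a projection lies in
    [G]. *)
Lemma halfspaces_generate k (G : set (set (car R k))) : sigma_algebra setT G ->
  (forall v (c : R), G [set z | c < dotv z v]) ->
  forall E, measurable E -> G E.
Proof.
elim: k G => [|k IH] G sG Gh.
  apply: smallest_sub => // _ [[a b] _ <-] /=.
  have [_ GC _] := sG.
  have := sigma_algebra_setI sG (Gh (1 : R) a) (GC _ (Gh (1 : R) b)).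
  congr G; rewrite setTD; apply/seteqP; split => x /=; rewrite !mulr1 in_itv/=.
    by move=> [-> /negP]; rewrite -leNgt => ->.
  by move=> /andP[-> xb]; split => //; apply/negP; rewrite -leNgt.
have [G0 GC GU] := sG.
apply: smallest_sub => // A [] [B mB <-]; rewrite setTI.
  pose H : set (set (car R 0)) := [set C | G ((fst : car R k.+1 -> R) @^-1` C)].
  have sH : sigma_algebra setT H.
    split; first by rewrite /H/= preimage_set0.
    - by move=> C; rewrite /H/= => /GC; rewrite !setTD -preimage_setC.
    - by move=> C HC; rewrite /H/= preimage_bigcup; exact: GU.
  have : forall E : set (car R 0), measurable E -> H E; last exact.
  apply: smallest_sub => // _ [[a b] _ <-] /=.
  have Hh (v c : R) : H [set z : car R 0 | c < dotv z (v : car R 0)].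
    rewrite /H/=; have := Gh (v, zerov R k) c.
    congr G; apply/seteqP; split => -[x y] /=; by rewrite dotv0r addr0.
  have [_ HC _] := sH.
  have := sigma_algebra_setI sH (Hh (1 : R) a) (HC _ (Hh (1 : R) b)).
  congr H; rewrite setTD; apply/seteqP; split => x /=; rewrite !mulr1 in_itv/=.
    by move=> [-> /negP]; rewrite -leNgt => ->.
  by move=> /andP[-> xb]; split => //; apply/negP; rewrite -leNgt.
pose H : set (set (car R k)) := [set C | G ((snd : car R k.+1 -> car R k) @^-1` C)].
have sH : sigma_algebra setT H.
  split; first by rewrite /H/= preimage_set0.
  - by move=> C; rewrite /H/= => /GC; rewrite !setTD -preimage_setC.
  - by move=> C HC; rewrite /H/= preimage_bigcup; exact: GU.
apply: (IH H sH) mB => v c; rewrite /H/=; have := Gh ((0 : R), v) c.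
congr G; apply/seteqP; split => -[x y] /=; by rewrite mulr0 add0r.
Qed.

End generated.

Section duality.
Context {R : realType} (k : nat).
Variables (D : set (car R k)) (mD : measurable D) (Phi : car R k -> R).
Hypothesis intPhi : (leb R k).-integrable D (EFin \o Phi).
Implicit Types (f g h : car R k -> R).

Let mPhi : measurable_fun D Phi.
Proof. by apply/measurable_EFinP; exact: (measurable_int _ intPhi). Qed.

(** A distance weighted by [|Phi|]: functions with values in [[0, 1]] are at finite distance, and
    dominated convergence holds with [|Phi|] as majorant. *)
Let dist f g : \bar R := \int[leb R k]_(z in D) (`|Phi z| * `|f z - g z|)%:E.

Let mdist f g : measurable_fun setT f -> measurable_fun setT g ->
  measurable_fun D (fun z => (`|Phi z| * `|f z - g z|)%:E).
Proof.
move=> mf mg; apply/measurable_EFinP/measurable_funM; first exact: measurableT_comp.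
by apply: measurable_funTS; apply: measurableT_comp => //; exact: measurable_funB.
Qed.

Let dist_le f g f1 g1 f2 g2 :
  measurable_fun setT f -> measurable_fun setT g ->
  measurable_fun setT f1 -> measurable_fun setT g1 ->
  measurable_fun setT f2 -> measurable_fun setT g2 ->
  (forall z, `|f z - g z| <= `|f1 z - g1 z| + `|f2 z - g2 z|) ->
  (dist f g <= dist f1 g1 + dist f2 g2)%E.
Proof.
move=> mf mg mf1 mg1 mf2 mg2 h; rewrite /dist -ge0_integralD//; last 2 first.
- exact: mdist.
- exact: mdist.
apply: ge0_le_integral => //.
- exact: mdist.
- by apply: emeasurable_funD; exact: mdist.
- by move=> z Dz; rewrite -EFinD lee_fin -mulrDr ler_wpM2l.
Qed.

Let dist_cvg (f : car R k -> R) (f_ : nat -> car R k -> R) (e : R) :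
  measurable_fun setT f -> (forall n, measurable_fun setT (f_ n)) ->
  (forall z, 0 <= f z <= 1) -> (forall n z, 0 <= f_ n z <= 1) ->
  (forall z, D z -> f_ n z @[n --> \oo] --> f z) -> 0 < e ->
  exists n, (dist f (f_ n) < e%:E)%E.
Proof.
move=> mf mf_ f01 f_01 cf e0.
have : dist f (f_ n) @[n --> \oo] --> (\int[leb R k]_(z in D) (0 : \bar R))%E.
  apply: (@dominated_cvg _ _ _ _ _ mD (fun n z => (`|Phi z| * `|f z - f_ n z|)%:E) (cst 0%E)
     (fun z => (`|Phi z|)%:E)) => //.
  - by move=> n; exact: mdist.
  - move=> z Dz; apply: cvg_EFin; first exact: nearW.
    rewrite -[X in _ --> X](mulr0 `|Phi z|); apply: cvgMr.
    rewrite -[X in _ --> X](@normr0 _ R); apply: cvg_norm.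
    by rewrite -[X in _ --> X](subrr (f z)); apply: cvgB; [exact: cvg_cst|exact: cf].
  - exact: integrable_abse intPhi.
  - move=> n z Dz; rewrite lee_fin normrM !normr_id ler_piMr// ler_norml.
    by have := f01 z; have := f_01 n z; move=> /andP[? ?] /andP[? ?]; apply/andP; split; lra.
rewrite integral0 => /fine_cvgP[finD /cvgrPdist_lt /(_ _ e0) hd].
have [n [h1 h2]] : exists n, dist f (f_ n) \is a fin_num /\ `|0 - fine (dist f (f_ n))| < e.
  near \oo => n; exists n; split; first by near: n.
  by near: n; exact: hd.
exists n; rewrite -(fineK h1) lte_fin; apply: le_lt_trans h2.
by rewrite sub0r normrN ler_norm.
Unshelve. all: by end_near. Qed.

(** The property carried through the sigma-algebra. The bounds 0 and 1 serve for unions and keep the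
    multiplier used in the duality below 1 in absolute value. *)
Let appr (E : set (car R k)) := measurable E /\ forall e : R, 0 < e ->
  exists f, [/\ tame f, forall z, 0 <= f z <= 1 & (dist \1_E f < e%:E)%E].

(** The polynomial form of a disjunction is [u + v - u v = 1 - (1 - u)(1 - v)], which is 1-Lipschitz
    in each variable on the unit square. *)
Let norm_orb_le (x y : bool) (u v : R) : 0 <= u <= 1 -> 0 <= v <= 1 ->
  `|(x || y)%:R - (u + v + (-1) * (u * v))| <= `|x%:R - u| + `|y%:R - v|.
Proof.
move=> /andP[u0 u1] /andP[v0 v1].
have h1 := ler_norm (x%:R - u); have h2 := ler_norm (- (x%:R - u)).
have h3 := ler_norm (y%:R - v); have h4 := ler_norm (- (y%:R - v)).
rewrite !normrN in h2 h4.
have p1 : 0 <= u * v by exact: mulr_ge0.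
have p2 : 0 <= (1 - u) * (1 - v) by rewrite mulr_ge0 ?subr_ge0.
have p3 : 0 <= u * (1 - v) by rewrite mulr_ge0 ?subr_ge0.
have p4 : 0 <= (1 - u) * v by rewrite mulr_ge0 ?subr_ge0.
rewrite ler_norml; move: h1 h2 h3 h4.
by case: x; case: y => /= h1 h2 h3 h4; apply/andP; split; lra.
Qed.

Let appr_setU E F : appr E -> appr F -> appr (E `|` F).
Proof.
move=> [mE hE] [mF hF]; split; first exact: measurableU.
move=> e e0; have e2 : 0 < e / 2 by rewrite divr_gt0.
have [f [tf f01 fe]] := hE _ e2; have [g [tg g01 ge]] := hF _ e2.
exists (fun z => f z + g z + (-1) * (f z * g z)); split.
- by apply: tameD; [exact: tameD|apply: tameZ; exact: tameM].
- move=> z; have /andP[? ?] := f01 z; have /andP[? ?] := g01 z.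
  by apply/andP; split; nra.
- rewrite (splitr e) EFinD; apply: le_lt_trans (lteD fe ge).
  apply: dist_le; rewrite ?measurable_indic//; try exact: tame_measurable.
  + exact/measurable_indic/measurableU.
  + by apply/tame_measurable/tameD; [exact: tameD|apply: tameZ; exact: tameM].
  by move=> z; rewrite !indicE in_setU; exact: norm_orb_le.
Qed.

(** Complements correspond to [1 - f] and finite unions to [u + v - u v]; a countable union is the
    pointwise limit of finite ones, which dominated convergence handles. *)
Let appr_sigma : sigma_algebra setT appr.
Proof.
split.
- split => // e e0; exists (fun=> 0); split; first exact: tame_cst.
    by move=> _; rewrite lexx ler01.
  rewrite /dist (_ : (\int[_]_(_ in _) _)%E = 0%E) ?lte_fin//.
  by apply: integral0_eq => z _; rewrite indic0 subrr normr0 mulr0.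
- move=> E [mE hE]; split; first by rewrite setTD; exact: measurableC.
  move=> e e0; have [f [tf f01 fe]] := hE _ e0.
  exists (fun z => 1 + (-1) * f z); split.
  + by apply: tameD; [exact: tame_cst|exact: tameZ].
  + by move=> z; have /andP[? ?] := f01 z; apply/andP; split; lra.
  + apply: le_lt_trans fe; apply: ge0_le_integral => //.
    * apply: mdist; first by apply: measurable_indic; rewrite setTD; exact: measurableC.
      by apply/tame_measurable/tameD; [exact: tame_cst|exact: tameZ].
    * by apply: mdist; [exact: measurable_indic|exact: tame_measurable].
    * move=> z _; rewrite lee_fin ler_wpM2l// setTD !indicE in_setC.
      by case: (z \in E) => /=; rewrite distrC le_eqVlt; apply/orP; left; apply/eqP; congr `|_|; ring.
- move=> F hF; pose U n := \big[setU/set0]_(i < n) F i.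
  have aU n : appr (U n).
    rewrite /U; elim: n => [|n IH]; last by rewrite big_ord_recr; exact: appr_setU.
    rewrite big_ord0; split => // e e0; exists (fun=> 0); split; first exact: tame_cst.
      by move=> _; rewrite lexx ler01.
    rewrite /dist (_ : (\int[_]_(_ in _) _)%E = 0%E) ?lte_fin//.
    by apply: integral0_eq => z _; rewrite indic0 subrr normr0 mulr0.
  have mU : measurable (\bigcup_i F i) by apply: bigcup_measurable => i _; case: (hF i).
  split => // e e0; have e2 : 0 < e / 2 by rewrite divr_gt0.
  have [|||||n hn] := @dist_cvg \1_(\bigcup_i F i) (fun n => \1_(U n)) (e / 2) _ _ _ _ _ e2.
  + exact: measurable_indic.
  + by move=> n; apply: measurable_indic; case: (aU n).
  + by move=> z; rewrite indicE; case: (_ \in _); rewrite ?lexx ?ler01.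
  + by move=> n z; rewrite indicE; case: (_ \in _); rewrite ?lexx ?ler01.
  + move=> z _; have [zF|zF] := pselect ((\bigcup_i F i) z).
      have [i _ zi] := zF; rewrite indicE mem_set//.
      apply: cvg_near_cst; near=> n; rewrite indicE mem_set//.
      rewrite /U -bigcup_mkord; exists i => //=; near: n; exact: nbhs_infty_gt.
    rewrite indicE memNset//; apply: cvg_near_cst; apply: nearW => n.
    rewrite indicE memNset// /U -bigcup_mkord => -[i _ zi]; apply: zF; by exists i.
  have [mUn /(_ _ e2)[f [tf f01 fe]]] := aU n.
  exists f; split => //; rewrite (splitr e) EFinD; apply: le_lt_trans (lteD hn fe).
  apply: dist_le; try exact: measurable_indic; try exact: tame_measurable.
  by move=> z; rewrite -[X in `|X|](subrKA (\1_(U n) z)) ler_normD.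
Unshelve. all: by end_near. Qed.

Let appr_halfspace v (c : R) : appr [set z | c < dotv z v].
Proof.
have mE : measurable [set z : car R k | c < dotv z v].
  have := measurable_dotv v measurableT (measurable_itv `]c, +oo[).
  by rewrite setTI; congr measurable; apply/seteqP; split => x /=; rewrite in_itv/= andbT.
split => // e e0.
pose f n (z : car R k) := bump (n%:R * (dotv z v - c) - 1).
have tf n : tame (f n).
  have t : tame (fun z : car R k => n%:R * dotv z v + (- (n%:R * c) - 1)).
    by apply: tameD; [apply: tameZ; exact: tame_dotv|exact: tame_cst].
  have := tame_comp deriv_seq_flat_exp t; congr tame; apply/funext => z /=.
  by rewrite /f/bump; congr flat_exp; ring.
have [|||||n hn] := @dist_cvg \1_[set z : car R k | c < dotv z v] f e _ _ _ _ _ e0.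
- exact: measurable_indic.
- by move=> n; exact: tame_measurable.
- by move=> z; rewrite indicE; case: (_ \in _); rewrite ?lexx ?ler01.
- by move=> n z; rewrite bump_ge0 bump_le1.
- move=> z _; have [cz|cz] := ltP c (dotv z v).
    by rewrite indicE mem_set//; apply: bump_cvg1; rewrite subr_gt0.
  rewrite indicE memNset/=; last by apply/negP; rewrite -leNgt.
  apply: cvg_near_cst; apply: nearW => n; rewrite /f bump_eq0//.
  have n0 : 0 <= n%:R :> R by rewrite ler0n.
  nra.
by exists (f n); split => // z; rewrite bump_ge0 bump_le1.
Qed.

Let apprP E : measurable E -> appr E.
Proof. by apply: (@halfspaces_generate _ _ appr appr_sigma) => v c; exact: appr_halfspace. Qed.

Variables (b : nat -> car R k -> R) (M : R).
Hypotheses (tb : forall n, tame (b n)) (b01 : forall n z, 0 <= b n z <= 1)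
  (cb : forall z, D z -> b n z @[n --> \oo] --> (1 : R)).
Hypothesis bnd : forall n h, tame h -> (forall z, `|h z| <= 1) ->
  (`|\int[leb R k]_(z in D) (Phi z * (b n z * h z))%:E| <= M%:E)%E.

(** On [D] the sign of [Phi] is [2 \1_P - 1], where [P] is the part on which [Phi >= 0]; it is
    replaced by [2 f - 1] with [f] tame and close to [\1_P], then cut off by [b n]. *)
Lemma L1_duality : (\int[leb R k]_(z in D) (`|Phi z|)%:E <= M%:E)%E.
Proof.
apply/lee_addgt0Pr => e e0; have e3 : 0 < e / 3 by rewrite divr_gt0.
pose P := D `&` [set z | 0 <= Phi z].
have mP : measurable P.
  have := mPhi mD (measurable_itv `[0, +oo[).
  congr measurable; rewrite /P; congr (_ `&` _).
  by apply/seteqP; split => x /=; rewrite in_itv/= andbT.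
have [_ /(_ _ e3)[f [tf f01 fe]]] := apprP mP.
have [||||n hn] := @dist_cvg (fun=> 1) b (e / 3) _ _ _ _ cb e3.
- exact: measurable_cst.
- by move=> n; exact: tame_measurable.
- by move=> z; rewrite ler01 lexx.
- exact: b01.
pose h z := 2 * f z + (-1).
have th : tame h by apply: tameD; [exact: tameZ|exact: tame_cst].
have h1 z : `|h z| <= 1.
  by have /andP[? ?] := f01 z; rewrite ler_norml /h; apply/andP; split; lra.
have iabs : (leb R k).-integrable D (fun z => (`|Phi z|)%:E) by exact: integrable_abse intPhi.
have bh1 z : `|b n z * h z| <= 1.
  by rewrite normrM -[leRHS]mulr1 ler_pM//; have /andP[? ?] := b01 n z; rewrite ger0_norm.
have mbh : measurable_fun setT (fun z => b n z * h z).
  by apply: measurable_funM; exact: tame_measurable.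
have iI : (leb R k).-integrable D (fun z => (Phi z * (b n z * h z))%:E).
  apply: le_integrable intPhi => //.
    by apply/measurable_EFinP/measurable_funM => //; exact: measurable_funTS.
  by move=> z Dz; rewrite lee_fin normrM ler_piMr.
(* Pointwise, [|Phi| - Phi b h] is at most [|Phi| |1 - b| + 2 |Phi| |\1_P - f|]; the error terms
   cost [e / 3] each, the last one being counted twice. *)
have key : (\int[leb R k]_(z in D) (`|Phi z|)%:E <=
   \int[leb R k]_(z in D) (Phi z * (b n z * h z))%:E + (dist (fun=> 1%R) (b n) + (dist \1_P f + dist \1_P f)))%E.
  have mp1 : measurable_fun D (fun z => (`|Phi z| * `|\1_P z - f z|)%:E).
    by apply: mdist; [exact: measurable_indic|exact: tame_measurable].
  have mp2 : measurable_fun D (fun z => (`|Phi z| * `|1 - b n z|)%:E).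
    by apply: mdist; [exact: measurable_cst|exact: tame_measurable].
  have i1 : (leb R k).-integrable D (fun z => (`|Phi z| * `|\1_P z - f z|)%:E).
    apply: le_integrable iabs => // z Dz; rewrite lee_fin normrM !normr_id ler_piMr//.
    have /andP[? ?] := f01 z; rewrite indicE ler_norml.
    by case: (_ \in _) => /=; apply/andP; split; lra.
  have i2 : (leb R k).-integrable D (fun z => (`|Phi z| * `|1 - b n z|)%:E).
    apply: le_integrable iabs => // z Dz; rewrite lee_fin normrM !normr_id ler_piMr//.
    by have /andP[? ?] := b01 n z; rewrite ler_norml; apply/andP; split; lra.
  have i3 := integrableD mD i1 i1; have i4 := integrableD mD i2 i3.
  rewrite /dist -integralD// -integralD// -integralD//.
  apply: le_integral => //; first exact: integrableD.
  move=> z /[!inE] Dz; rewrite -!EFinD lee_fin.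
  have : `|Phi z| = Phi z * (2 * \1_P z - 1).
    rewrite indicE; have [P0|P0] := leP 0 (Phi z).
      by rewrite mem_set// ger0_norm// mulr1n (_ : 2 * 1 - 1 = 1 :> R) ?mulr1//; ring.
    rewrite memNset; last by move=> [_ /=]; rewrite leNgt P0.
    by rewrite ltr0_norm// mulr0n mulr0 sub0r mulrN1.
  move=> E; rewrite [X in X <= _]E -subr_ge0.
  rewrite (_ : _ - _ = `|Phi z| * (`|1 - b n z| + 2 * `|\1_P z - f z|) -
     Phi z * ((2 * \1_P z - 1) - b n z * h z)); last by ring.
  rewrite subr_ge0 (le_trans (ler_norm _))// normrM ler_wpM2l//.
  rewrite (_ : _ - _ = (1 - b n z) * h z + 2 * (\1_P z - f z)); last by rewrite /h; ring.
  rewrite (le_trans (ler_normD _ _))// lerD//.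
    by rewrite normrM ler_piMr.
  by rewrite normrM ger0_norm.
apply: le_trans key _; apply: leeD.
  by apply: le_trans (bnd n th h1); exact: lee_abs.
rewrite (_ : e = e / 3 + (e / 3 + e / 3)); last by field.
by rewrite !EFinD; apply: leeD; [exact: ltW|apply: leeD; exact: ltW].
Qed.

End duality.

(** * Geometry of the cylinder *)

Section space_time.
Context {R : realType}.
Implicit Types k : nat.

Definition xvec k (v : car R k) : car R k.+1 := ((0 : R), v).

Lemma tame_fst k (f : car R 0 -> R) : tame f -> tame (fun z : car R k.+1 => f z.1).
Proof.
apply: tame_precomp => v.
have := @tame_dotv R k.+1 ((v : R), zerov R k); congr tame; apply/funext => z /=.
by rewrite dotv0r addr0.
Qed.

Lemma tame_snd k (f : car R k -> R) : tame f -> tame (fun z : car R k.+1 => f z.2).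
Proof.
apply: tame_precomp => v.
have := @tame_dotv R k.+1 ((0 : R), v); congr tame; apply/funext => z /=.
by rewrite mulr0 add0r.
Qed.

Definition xdil k (w : car R k) (s : R) (z : car R k.+1) : car R k.+1 :=
  ((z.1 : R), addv w (scalev s (subv z.2 w))).

Lemma tame_xdil k (w : car R k) s (f : car R k.+1 -> R) :
  tame f -> tame (fun z => f (xdil w s z)).
Proof.
apply: tame_precomp => v /=; apply: tameD.
  apply: tameM; last exact: tame_cst.
  have := tame_fst k (@tame_dotv R 0 (1 : R)); congr tame; apply/funext => z.
  by rewrite /= mulr1.
apply: (@tame_snd k (fun x => dotv (addv w (scalev s (subv x w))) v.2)).
under eq_fun do rewrite dotvDl dotvZl.
apply: tameD; first exact: tame_cst.
by apply: tameZ; exact: tame_dotvB.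
Qed.

Lemma eclosed_tame_ge0 k (A : car R k -> R) : tame A -> eclosed [set z | 0 <= A z].
Proof.
move=> /tame_econt cA z hz /=; rewrite leNgt; apply/negP => Az.
have [d d0 hd] := cA z (- A z) ltac:(by rewrite oppr_gt0).
have [w /= Aw wz] := hz d d0.
have := hd _ wz; rewrite ltr_norml => /andP[_]; lra.
Qed.

(** Superlevel sets of continuous functions are closed, and inside a bounded [D] their intersection
    is bounded: it serves as the compact support, with [A] meant for time and [B] for space. *)
Lemma Cc_tame k (D : set (car R k)) (f A B : car R k -> R) :
  tame f -> tame A -> tame B -> ebounded D ->
  (forall z, 0 <= A z -> 0 <= B z -> D z) ->
  (forall z, f z != 0 -> 0 <= A z /\ 0 <= B z) -> Cc_infty D f.
Proof.
move=> tf tA tB [M bD] AB fAB; split; first exact: tame_smooth.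
exists ([set z | 0 <= A z] `&` [set z | 0 <= B z]); split.
- move=> z hz; split; apply: (@eclosed_tame_ge0 _ _ _ z) => // e /hz[w [Aw Bw] wz]; by exists w.
- by exists M => z [Az Bz]; apply/bD/AB.
- by move=> z [Az Bz]; exact: AB.
- by move=> z nK; apply/eqP; apply: contra_notT nK => /fAB.
Qed.

Lemma ebounded_pcyl k (alpha r t0 : R) (x0 : car R k) : 0 < alpha -> 0 < r ->
  ebounded (pcyl alpha r t0 x0).
Proof.
move=> a0 r0; exists (`|t0| + alpha * r ^+ 2 + (r + enorm x0)) => -[t x]; rewrite pcylE => -[/=].
rewrite /eball/= enorm0E /subv/= mulN1r => ht hx.
have -> : ((t, x) : car R k.+1) = addv ((t, zerov R k) : car R k.+1) ((0 : R), x).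
  by apply: (@dotv_ext R k.+1) => v /=; rewrite mulrDl mul0r addr0 !dotvE add0r.
apply: le_trans (ler_enormD _ _) _; apply: lerD.
  rewrite /enorm/= dotv0l addr0 -expr2 sqrtr_sqr -(subrK t0 t).
  by rewrite (le_trans (ler_normD _ _))// addrC lerD2l ltW.
rewrite /enorm/= mul0r add0r -/(enorm x).
have -> : x = addv (subv x x0) x0.
  by apply: dotv_ext => v; rewrite !dotvE subrK.
by apply: le_trans (ler_enormD _ _) _; rewrite lerD2r ltW.
Qed.

(** [x] is the convex combination of [w] and its dilate with weights [1 - 1/s] and [1/s]. Hence
    composing a test function with a dilation about [w] only pulls its support towards [w]. *)
Lemma eball_convex k (x0 w x : car R k) (r s : R) : 1 <= s ->
  eball x0 r w -> eball x0 r (addv w (scalev s (subv x w))) -> eball x0 r x.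
Proof.
rewrite /eball/= => s1 hw hx; have s0 : 0 < s by rewrite (lt_le_trans _ s1).
have -> : subv x x0 = addv (scalev (1 - s^-1) (subv w x0))
    (scalev s^-1 (subv (addv w (scalev s (subv x w))) x0)).
  apply: dotv_ext => v; rewrite !dotvE; field.
  by rewrite gt_eqF.
have si : 0 < s^-1 by rewrite invr_gt0.
have si1 : s^-1 <= 1 by rewrite invf_le1.
apply: le_lt_trans (ler_enormD _ _) _.
rewrite !enormZ ger0_norm ?subr_ge0// ger0_norm ?(ltW si)//.
have h1 : (1 - s^-1) * enorm (subv w x0) <= (1 - s^-1) * r.
  by rewrite ler_wpM2l// ?subr_ge0// ltW.
have h2 : s^-1 * enorm (subv (addv w (scalev s (subv x w))) x0) < s^-1 * r.
  by rewrite ltr_pM2l.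
by have := ler_ltD h1 h2; rewrite -mulrDl subrK mul1r.
Qed.

Lemma eball_bcut_arg k (x0 x : car R k) (r : R) n : 0 < r ->
  0 <= n%:R * (r ^+ 2 - sqdist x0 x) - 1 -> eball x0 r x.
Proof.
move=> r0; rewrite eballE//= ltNge => h; apply/negP => h2.
have n0 : 0 <= n%:R :> R by rewrite ler0n.
by have := mulr_ge0 n0 (_ : 0 <= sqdist x0 x - r ^+ 2); rewrite subr_ge0 => /(_ h2); lra.
Qed.

Definition qcut k (alpha r t0 : R) (x0 : car R k) n (z : car R k.+1) : R :=
  bcut (t0 : car R 0) (alpha * r ^+ 2) n (z.1 : R) * bcut x0 r n z.2.

Lemma tame_qcut k (alpha r t0 : R) (x0 : car R k) n : tame (qcut alpha r t0 x0 n).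
Proof. by apply: tameM; [apply/tame_fst/tame_bcut|apply/tame_snd/tame_bcut]. Qed.

Lemma bcut_01 k (x0 x : car R k) (r : R) n : 0 <= bcut x0 r n x <= 1.
Proof. by rewrite bump_ge0 bump_le1. Qed.

Lemma qcut_01 k (alpha r t0 : R) (x0 : car R k) n z : 0 <= qcut alpha r t0 x0 n z <= 1.
Proof.
have /andP[? ?] := bcut_01 (t0 : car R 0) (z.1 : R) (alpha * r ^+ 2) n.
have /andP[? ?] := bcut_01 x0 z.2 r n.
by rewrite mulr_ge0//= -[leRHS]mulr1 ler_pM.
Qed.

Lemma bcut_cvg k (x0 x : car R k) (r : R) : 0 < r -> eball x0 r x ->
  bcut x0 r n x @[n --> \oo] --> (1 : R).
Proof. by move=> r0; rewrite eballE//= => h; apply: bump_cvg1; rewrite subr_gt0. Qed.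

Lemma qcut_cvg k (alpha r t0 : R) (x0 : car R k) z : 0 < alpha -> 0 < r ->
  pcyl alpha r t0 x0 z -> qcut alpha r t0 x0 n z @[n --> \oo] --> (1 : R).
Proof.
move=> a0 r0; rewrite pcylE => -[h1 h2]; rewrite -[X in _ --> X]mulr1.
by apply: cvgM; apply: bcut_cvg => //; rewrite mulr_gt0// exprn_gt0.
Qed.

Lemma measurable_pcyl k (alpha r t0 : R) (x0 : car R k) : 0 < alpha -> 0 < r ->
  measurable (pcyl alpha r t0 x0).
Proof.
move=> a0 r0; rewrite pcylE; apply: measurableX; last exact: measurable_eball.
by apply: (@measurable_eball R 0); rewrite mulr_gt0// exprn_gt0.
Qed.

(** The cutoff alone confines the support; the free factor [u] is there for the coordinates of
    [x - w], which multiply the test function in the divergence. *)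
Lemma Cc_qcut k (alpha r t0 : R) (x0 w : car R k) (s : R) n (h u : car R k.+1 -> R) :
  0 < alpha -> 0 < r -> 1 <= s -> eball x0 r w -> tame h -> tame u ->
  Cc_infty (pcyl alpha r t0 x0)
    (fun z => u z * (qcut alpha r t0 x0 n (xdil w s z) * h (xdil w s z))).
Proof.
move=> a0 r0 s1 hw th tu.
pose A (z : car R k.+1) := (n%:R * (alpha * r ^+ 2) ^+ 2 - 1) + (- n%:R) * sqdist (t0 : car R 0) (z.1 : R).
pose B (z : car R k.+1) := (n%:R * r ^+ 2 - 1) + (- n%:R) * sqdist x0 z.2.
have tA : tame A by exact: (tame_fst k (tame_affine_sqdist (t0 : car R 0) _ _)).
have tB : tame B by exact: (tame_snd (tame_affine_sqdist x0 _ _)).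
apply: (@Cc_tame _ _ _ (fun z => A (xdil w s z)) (fun z => B (xdil w s z))).
- apply: tameM => //; apply: tameM; last exact: tame_xdil.
  by apply: tame_xdil; exact: tame_qcut.
- exact: tame_xdil.
- exact: tame_xdil.
- exact: ebounded_pcyl.
- move=> z; rewrite /A/B => Az Bz; rewrite pcylE; split.
    apply: (@eball_bcut_arg 0 _ _ _ n); first by rewrite mulr_gt0// exprn_gt0.
    by move: Az => /=; lra.
  apply: (eball_convex s1 hw); apply: (@eball_bcut_arg _ _ _ _ n) => //.
  by move: Bz => /=; lra.
- move=> z; rewrite !mulf_eq0 !negb_or => /and3P[_ /andP[h1 h2] _]; split.
    rewrite leNgt; apply: contra h1 => hA; apply/eqP; apply: bump_eq0.
    by move: hA; rewrite /A /=; lra.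
  rewrite leNgt; apply: contra h2 => hB; apply/eqP; apply: bump_eq0.
  by move: hB; rewrite /B /=; lra.
Qed.

Lemma xdil1 k (w : car R k) z : xdil w 1 z = z.
Proof.
case: z => t x; rewrite /xdil/=; congr pair.
by apply: dotv_ext => v; rewrite !dotvE; ring.
Qed.

Lemma xdil_line k (w : car R k) (s : R) (z : car R k.+1) (v : car R k) (u : R) :
  xdil w s (addv z (scalev u (xvec v))) = addv (xdil w s z) (scalev u (xvec (scalev s v))).
Proof.
case: z => t x; rewrite /xdil/=; congr pair.
by apply: dotv_ext => y; rewrite !dotvE; ring.
Qed.

(** Increasing [s] moves the dilated point along [x - w], which yields the [s]-derivative from the
    gradient. *)
Lemma xdil_shift k (w : car R k) (s u : R) (z : car R k.+1) :
  xdil w (u + s) z = addv (xdil w s z) (scalev u (xvec (subv z.2 w))).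
Proof.
case: z => t x; rewrite /xdil/=; congr pair; first by rewrite mulr0 addr0.
by apply: dotv_ext => y; rewrite !dotvE; ring.
Qed.

End space_time.

(** * Dilations and the weak gradient *)

Section integrability.
Context {R : realType} d (T : measurableType d) (mu : {measure set T -> \bar R}).
Variables (D : set T) (mD : measurable D).

Lemma integrable_mulr_bounded (f h : T -> R) (C : R) :
  mu.-integrable D (EFin \o f) -> measurable_fun D h ->
  (forall z, D z -> `|h z| <= C) -> mu.-integrable D (EFin \o (fun z => f z * h z)).
Proof.
move=> intf mh hC.
have i1 : mu.-integrable D (fun z => (`|C|%:E * (f z)%:E)%E) by exact: integrableZl.
apply: le_integrable i1 => //.
  apply/measurable_EFinP/measurable_funM => //.
  by apply/measurable_EFinP; exact: (measurable_int _ intf).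
move=> z Dz; rewrite -EFinM lee_fin !normrM normr_id mulrC ler_wpM2r//.
by rewrite (le_trans (hC z Dz))// ler_norm.
Qed.

Lemma Rintegral_sum_ord n (f : 'I_n -> T -> R) :
  (forall i, mu.-integrable D (EFin \o f i)) ->
  \int[mu]_(z in D) (\sum_(i < n) f i z) = \sum_(i < n) \int[mu]_(z in D) f i z.
Proof.
move=> intf; rewrite /Rintegral.
under eq_integral do rewrite -sumEFin.
rewrite (integral_sum mD intf) -sum_fine//.
by move=> i _; exact: integrable_fin_num.
Qed.

Lemma Rintegral_norm_le (f : T -> R) (F : T -> R) :
  mu.-integrable D (EFin \o f) -> mu.-integrable D (EFin \o F) ->
  (forall z, D z -> `|f z| <= F z) -> `|\int[mu]_(z in D) f z| <= \int[mu]_(z in D) F z.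
Proof.
move=> intf intF fF; apply: le_trans (le_normr_Rintegral mD intf) _.
by apply: le_Rintegral => //; exact: integrable_abse intf.
Qed.

End integrability.

Section space_estimate.
Context {R : realType} (k : nat).
Variables (alpha r t0 : R) (x0 : car R k).
Hypotheses (alpha0 : 0 < alpha) (r0 : 0 < r).
Let Q := pcyl alpha r t0 x0.
Let mu := leb R k.+1.
Let mQ : measurable Q := measurable_pcyl t0 x0 alpha0 r0.

Lemma tame_bounded_pcyl (f : car R k.+1 -> R) : tame f ->
  exists C, forall z, Q z -> `|f z| <= C.
Proof.
move=> tf; have [M hM] := ebounded_pcyl t0 x0 alpha0 r0.
have [C _ hC] := tame_bounded M tf.
by exists C => z Qz; apply/hC/hM.
Qed.

Lemma integrable_mulr_tame (f h : car R k.+1 -> R) :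
  mu.-integrable Q (EFin \o f) -> tame h ->
  mu.-integrable Q (EFin \o (fun z => f z * h z)).
Proof.
move=> intf th; have [C hC] := tame_bounded_pcyl th.
apply: (integrable_mulr_bounded mQ intf _ hC).
by apply: measurable_funTS; exact: tame_measurable.
Qed.

Lemma dirder_val j (f : car R j -> R) z v l :
  is_derive (0 : R) (1 : R) (fun s => f (addv z (scalev s v))) l -> dirder f z v = l.
Proof. by move=> fl; rewrite /dirder derive1E; have [] := fl. Qed.

Lemma dotv_xvec (p : car R k.+1) (v : car R k) : dotv p (xvec v) = dotv p.2 v.
Proof. by rewrite /= mulr0 add0r. Qed.

Variables (a : car R k.+1 -> R) (g : car R k.+1 -> car R k).
Hypotheses (inta : mu.-integrable Q (EFin \o a)) (wg : weak_gradx Q a g).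

Lemma integrable_dotv_grad v : mu.-integrable Q (EFin \o (fun z => dotv (g z) v)).
Proof.
have [mg [ig _]] := wg.
have i1 : mu.-integrable Q (fun z => ((enorm v)%:E * (enorm (g z))%:E)%E) by exact: integrableZl.
apply: le_integrable i1 => //; first by apply/measurable_EFinP; exact: mg.
move=> z Qz; rewrite -EFinM lee_fin (le_trans (normr_dotv_le _ _))//.
by rewrite mulrC ger0_norm// mulr_ge0// enorm_ge0.
Qed.

Lemma Rintegral_weak_gradx (phi : car R k.+1 -> R) (v : car R k) : Cc_infty Q phi ->
  \int[mu]_(z in Q) (a z * dirder phi z (xvec v)) = - \int[mu]_(z in Q) (dotv (g z) v * phi z).
Proof.
by have [_ [_ hw]] := wg => /(hw _ v) h; rewrite /Rintegral [X in fine X = _]h fineN.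
Qed.

Section test_function.
Variables (w : car R k) (n : nat) (h : car R k.+1 -> R).
Hypotheses (hw : eball x0 r w) (th : tame h) (h1 : forall z, `|h z| <= 1).

Let hh z := qcut alpha r t0 x0 n z * h z.
Let thh : tame hh. Proof. by apply: tameM => //; exact: tame_qcut. Qed.

Let hh1 z : `|hh z| <= 1.
Proof.
have /andP[q0 q1] := qcut_01 alpha r t0 x0 n z.
by rewrite normrM -[leRHS]mulr1 ler_pM// ger0_norm.
Qed.

Variable q : car R k.+1 -> car R k.+1.
Hypotheses (tq : forall v, tame (fun z => dotv (q z) v)) (hq : is_gradient hh q).

(* [Psi] is the spatial divergence of the field [z |-> hh z * (z.2 - w)]. *)
Let Psi z := dotv (q z) (xvec (subv z.2 w)) + k.+1%:R * hh z.

Let tPsi : tame Psi.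
Proof.
apply: tameD; last exact: tameZ.
rewrite (_ : (fun z => _) = fun z : car R k.+1 => \sum_(i < k.+1)
    dotv (q z) (xvec (bv k i)) * dotv (subv z.2 w) (bv k i)).
  apply: tame_sum => i; apply: tameM => //.
  by apply: (@tame_snd R k (fun x => dotv (subv x w) (bv k i))); exact: tame_dotvB.
apply/funext => z; rewrite dotv_xvec -sum_dotv_bv.
by apply: eq_bigr => i _; rewrite dotv_xvec.
Qed.

(** These are the components of the field [(x - w) hh(t, w + s (x - w))]; differentiated in the
    directions [bv k i], they add up to its spatial divergence. *)
Let phi s i (z : car R k.+1) := dotv (subv z.2 w) (bv k i) * hh (xdil w s z).

Let tphi s i : tame (phi s i).
Proof.
apply: tameM; last exact: tame_xdil.
by apply: (@tame_snd R k (fun x => dotv (subv x w) (bv k i))); exact: tame_dotvB.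
Qed.

Let dirder_phi s (i : 'I_k.+1) z : dirder (phi s i) z (xvec (bv k i)) =
  dotv (subv z.2 w) (bv k i) * (s * dotv (q (xdil w s z)).2 (bv k i)) + hh (xdil w s z).
Proof.
apply: dirder_val.
have d1 : is_derive (0 : R) (1 : R)
    (fun u => dotv (subv (addv z (scalev u (xvec (bv k i)))).2 w) (bv k i)) 1.
  have := is_gradient_dotv (bv k i) (subv z.2 w) (bv k i).
  rewrite dotv_bv; congr is_derive; apply/funext => u /=; rewrite !dotvE; ring.
have d2 : is_derive (0 : R) (1 : R)
    (fun u => hh (xdil w s (addv z (scalev u (xvec (bv k i))))))
    (s * dotv (q (xdil w s z)).2 (bv k i)).
  have := hq (xdil w s z) (xvec (scalev s (bv k i))).
  rewrite dotv_xvec dotvZr; congr is_derive; apply/funext => u.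
  by rewrite xdil_line.
apply: (is_derive_eq (is_deriveM d1 d2)).
rewrite /GRing.scale/= !mulr0 !scalev0 !addr0 addv0 mulr1.
by rewrite (_ : (z.1 : R, z.2) = z)//; case: z {d1 d2}.
Qed.

(** Differentiating [(x - w)_i] produces one copy of [hh] for each of the [k.+1] directions, and the
    factor [s] of the chain rule turns [x - w] into the displacement of the dilated point. *)
Let sum_dirder_phi s z :
  \sum_(i < k.+1) dirder (phi s i) z (xvec (bv k i)) = Psi (xdil w s z).
Proof.
under eq_bigr do rewrite dirder_phi.
rewrite big_split/= sumr_const card_ord /Psi mulr_natl; congr (_ + _).
rewrite dotv_xvec (_ : subv (xdil w s z).2 w = scalev s (subv z.2 w)); last first.
  by apply: dotv_ext => v /=; rewrite !dotvE; ring.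
rewrite dotvZr -sum_dotv_bv mulr_sumr; apply: eq_bigr => i _; ring.
Qed.

Let weak_div s : 1 <= s ->
  \int[mu]_(z in Q) (a z * Psi (xdil w s z)) =
  - \int[mu]_(z in Q) (dotv (g z) (subv z.2 w) * hh (xdil w s z)).
Proof.
move=> s1.
have CC i : Cc_infty Q (phi s i).
  apply: Cc_qcut => //.
  by apply: (@tame_snd R k (fun x => dotv (subv x w) (bv k i))); exact: tame_dotvB.
transitivity (\int[mu]_(z in Q) (\sum_(i < k.+1) a z * dirder (phi s i) z (xvec (bv k i)))).
  by apply: eq_Rintegral => z _; rewrite -sum_dirder_phi mulr_sumr.
rewrite Rintegral_sum_ord//; last first.
  by move=> i; apply: integrable_mulr_tame => //; exact: tame_dirder.
under eq_bigr do rewrite Rintegral_weak_gradx//.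
rewrite sumrN; congr (- _).
rewrite -Rintegral_sum_ord//; last first.
  by move=> i; apply: integrable_mulr_tame => //; exact: integrable_dotv_grad.
apply: eq_Rintegral => z _; rewrite -[in RHS]sum_dotv_bv mulr_suml.
by apply: eq_bigr => i _; rewrite /phi mulrA.
Qed.

Let int_enorm_g : mu.-integrable Q (EFin \o (fun z => enorm (g z))).
Proof. by have [_ []] := wg. Qed.

(** Both [x] and [w] lie in the ball, so [|x - w| < 2 r], while [|hh| <= 1]. *)
Let weak_div_bound s : 1 <= s ->
  `|\int[mu]_(z in Q) (a z * Psi (xdil w s z))| <= 2 * r * \int[mu]_(z in Q) enorm (g z).
Proof.
move=> s1; rewrite weak_div// normrN -RintegralZl//.
apply: Rintegral_norm_le => //.
- rewrite (_ : EFin \o _ = EFin \o (fun z => \sum_(i < k.+1) dotv (g z) (bv k i) * phi s i z)).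
    rewrite (_ : EFin \o _ = fun z => (\sum_(i < k.+1) (dotv (g z) (bv k i) * phi s i z)%:E)%E).
      apply: integrable_sum => // i _.
      by apply: integrable_mulr_tame => //; exact: integrable_dotv_grad.
    by apply/funext => z /=; rewrite sumEFin.
  apply/funext => z /=; congr EFin; rewrite -[in LHS]sum_dotv_bv mulr_suml.
  by apply: eq_bigr => i _; rewrite /phi mulrA.
- have i1 : mu.-integrable Q (fun z => ((2 * r)%:E * (enorm (g z))%:E)%E) by exact: integrableZl.
  exact: i1.
- move=> z; rewrite /Q pcylE => -[_ hz]; rewrite normrM.
  apply: (@le_trans _ _ (`|dotv (g z) (subv z.2 w)| * 1)); first by rewrite ler_wpM2l.
  rewrite mulr1 (le_trans (normr_dotv_le _ _))// mulrC ler_wpM2r ?enorm_ge0//.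
  have -> : subv z.2 w = addv (subv z.2 x0) (scalev (-1) (subv w x0)).
    by apply: dotv_ext => v; rewrite !dotvE; ring.
  apply: le_trans (ler_enormD _ _) _; rewrite enormZ normrN1 mul1r.
  rewrite mulrDl mul1r; apply: lerD; exact: ltW.
Qed.

Let F (s : R) (z : car R k.+1) := a z * (s ^+ k.+1 * hh (xdil w s z)).

(** The power rule gives [(k+1) s^k hh], and in the chain rule term one factor [s] is absorbed by
    [s (x - w)]: with the exponent [k+1] the derivative is [s^k] times the divergence [Psi]. *)
Let is_derive_F (s : R) z : is_derive s (1 : R) (F^~ z) (a z * (s ^+ k * Psi (xdil w s z))).
Proof.
have d1 : is_derive s (1 : R) (fun s => hh (xdil w s z)) (dotv (q (xdil w s z)) (xvec (subv z.2 w))).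
  apply: is_derive_shift; have := hq (xdil w s z) (xvec (subv z.2 w)).
  by congr is_derive; apply/funext => u; rewrite [s + u]addrC xdil_shift.
have dX : is_derive s (1 : R) (fun u : R => u ^+ k.+1) (k.+1%:R * s ^+ k).
  have := is_derive_poly ('X^(k.+1) : {poly R}) s.
  rewrite derivXn hornerMn hornerXn -mulr_natl.
  by congr is_derive; apply/funext => u; rewrite hornerXn.
have d2 := is_deriveM dX d1.
apply: (is_derive_eq (is_deriveZ (a z) d2)).
rewrite /GRing.scale/= /Psi !dotv_xvec.
rewrite (_ : subv (addv w (scalev s (subv z.2 w))) w = scalev s (subv z.2 w)); last first.
  by apply: dotv_ext => v /=; rewrite !dotvE; ring.
by rewrite dotvZr exprS -mulr_natl; ring.
Qed.

Let integrable_F s : mu.-integrable Q (EFin \o F s).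
Proof. by apply: integrable_mulr_tame => //; apply: tameZ; exact: tame_xdil. Qed.

Let H s := \int[mu]_(z in Q) F s z.

Let is_derive_H (s : R) : 1 <= s <= 2 ->
  is_derive s (1 : R) H (s ^+ k * \int[mu]_(z in Q) (a z * Psi (xdil w s z))).
Proof.
move=> /andP[s1 s2].
have [M hM] := ebounded_pcyl t0 x0 alpha0 r0.
(* Differentiation under the integral needs an open interval around [[1, 2]]; []0, 3[] is taken, and
   a bound on [Psi] uniform in [|u| <= 3] supplies the dominating function. *)
have hb : exists C : R, forall u z, `|u| <= 3 -> Q z -> `|Psi (xdil w u z)| <= C.
  have [C _ hC] := tame_bounded (M + 3 * (M + enorm w) + enorm w) tPsi.
  exists C => u z u3 Qz; apply: hC.
  have -> : xdil w u z = addv (addv z (scalev (-1) (xvec z.2)))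
      (addv (scalev u (xvec (subv z.2 w))) (xvec w)).
    case: z Qz => t x Qz; apply: (@dotv_ext R k.+1) => v /=; rewrite !dotvE; ring.
  have zM := hM _ Qz.
  have xvE y : enorm (xvec y) = enorm y by rewrite /enorm /= mul0r add0r.
  apply: le_trans (ler_enormD _ _) _.
  rewrite -addrA; apply: lerD.
    apply: le_trans zM; case: z {Qz} => t x.
    rewrite /enorm; apply: ler_wsqrtr => /=; rewrite !dotvE mulr0 addr0.
    have := dotv_ge0 x; lra.
  apply: le_trans (ler_enormD _ _) _; rewrite enormZ !xvE lerD2r.
  rewrite ler_pM ?enorm_ge0// (le_trans (ler_enormD _ _))// enormZ normrN1 mul1r lerD2r.
  exact: le_trans (ler_enorm_proj2 _) zM.
have [C hC] := hb.
pose G z : R := (3 ^+ k * `|C|) * `|a z|.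
have Is : (`]0, 3[%classic : set R) s by rewrite /= in_itv/=; apply/andP; split; lra.
have d1F u z : partial1of2 F u z = a z * (u ^+ k * Psi (xdil w u z)).
  by rewrite partial1of2E; have [] := is_derive_F u z.
have intG : mu.-integrable Q (EFin \o G).
  have i1 : mu.-integrable Q (fun z => ((3 ^+ k * `|C|)%:E * (`|a z|)%:E)%E).
    by apply: integrableZl => //; exact: integrable_abse inta.
  exact: i1.
have G0 z : 0 <= G z by rewrite mulr_ge0// mulr_ge0// exprn_ge0.
have dF u z : (`]0, 3[%classic : set R) u -> Q z -> derivable (F^~ z) u 1.
  by move=> _ _; have [] := is_derive_F u z.
have GF u z : (`]0, 3[%classic : set R) u -> Q z -> `|partial1of2 F u z| <= G z.
  rewrite /= in_itv/= => /andP[u0 u3] Qz; rewrite d1F /G mulrC !normrM normrX ler_wpM2r//.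
  rewrite ler_pM ?exprn_ge0//.
    by rewrite lerXn2r// ?nnegrE// ger0_norm ltW.
  by rewrite (le_trans (hC u z _ Qz)) ?ler_norm// ger0_norm ltW.
have iF u : (`]0, 3[%classic : set R) u -> mu.-integrable Q (EFin \o F u) by move=> _; exact: integrable_F.
have dH := @derivable_under_integral R _ _ mu F Q mQ s 0 3 Is iF dF G G0 intG GF.
have eH := @differentiation_under_integral R _ _ mu F Q mQ s 0 3 Is iF dF G G0 intG GF.
apply: (DeriveDef dH); rewrite -derive1E [LHS]eH -RintegralZl//.
  by apply: eq_Rintegral => z _; rewrite d1F mulrCA.
by apply: integrable_mulr_tame => //; exact: tame_xdil.
Qed.

(** The two integrals are [H 1] and [H 2]. The mean value theorem leaves [c^k <= 2^k] times the
    bound [2 r] of the divergence term, whence [2^(k+1) r]. *)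
Lemma dilation_difference :
  `|\int[mu]_(z in Q) (a z * hh z) - \int[mu]_(z in Q) (a z * (2 ^+ k.+1 * hh (xdil w 2 z)))|
  <= 2 ^+ k.+1 * r * \int[mu]_(z in Q) enorm (g z).
Proof.
have -> : \int[mu]_(z in Q) (a z * hh z) = H 1.
  by apply: eq_Rintegral => z _; rewrite /F expr1n mul1r xdil1.
rewrite -[X in _ - X]/(H 2).
have [|||c] := @MVT R H (fun s => s ^+ k * \int[mu]_(z in Q) (a z * Psi (xdil w s z))) 1 2.
- by rewrite ltr1n.
- by move=> s; rewrite in_itv/= => /andP[? ?]; apply: is_derive_H; rewrite !ltW.
- apply: derivable_within_continuous => s; rewrite in_itv/= => s12.
  by have [] := is_derive_H s12.
rewrite in_itv/= => /andP[c1 c2]; rewrite distrC => ->.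
rewrite (_ : 2 - 1 = 1 :> R); last by ring.
rewrite mulr1 normrM normrX ger0_norm ?(le_trans _ (ltW c1))//.
rewrite exprSr -!mulrA; apply: ler_pM => //.
- by rewrite exprn_ge0// (le_trans _ (ltW c1)).
- by rewrite lerXn2r// ?nnegrE ?(le_trans _ (ltW c1))// ltW.
- by rewrite mulrA; apply: weak_div_bound; exact: ltW.
Qed.

End test_function.

End space_estimate.

(** * The midpoint estimate *)

Section midpoint.
Context {R : realType} (k : nat).

Lemma measurable_car d (T : measurableType d) j (f : T -> car R j) :
  (forall v, measurable_fun setT (fun t => dotv (f t) v)) -> measurable_fun setT f.
Proof.
elim: j f => [|j IH] f mf.
  have := mf (1 : R); congr measurable_fun; apply/funext => t.
  by rewrite /= mulr1.
apply/measurable_fun_pairP; split.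
  have := mf ((1 : R), zerov R j); congr measurable_fun; apply/funext => t.
  by rewrite /= mulr1 dotv0r addr0.
apply: IH => v; have := mf ((0 : R), v); congr measurable_fun; apply/funext => t.
by rewrite /= mulr0 add0r.
Qed.

Lemma measurable_xdil (w : car R k) s : measurable_fun setT (xdil w s).
Proof.
apply: (@measurable_car _ _ k.+1) => v; apply: tame_measurable.
by apply: (@tame_xdil R k w s (fun z => dotv z v)); exact: tame_dotv.
Qed.

Lemma xdil_half2 (w : car R k) z : xdil w 2^-1 (xdil w 2 z) = z.
Proof.
case: z => t x; rewrite /xdil/=; congr pair.
by apply: dotv_ext => v; rewrite !dotvE; field.
Qed.

(** The change of variables equates a finite integral with [2^-(k+1)] times the unknown one, which
    therefore cannot be infinite. *)
Lemma integrable_comp_xdil_half (w : car R k) (f : car R k.+1 -> R) :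
  (leb R k.+1).-integrable setT (EFin \o f) ->
  (leb R k.+1).-integrable setT (EFin \o (fun z => f (xdil w 2^-1 z))).
Proof.
move=> intf; have /integrableP[mf foo] := intf.
have mfs : measurable_fun setT (EFin \o (fun z => f (xdil w 2^-1 z))).
  exact: (measurableT_comp mf (measurable_xdil w 2^-1)).
apply/integrableP; split => //.
have := @ge0_integral_xdil2 R k w (fun z => `|(f (xdil w 2^-1 z))%:E|%E) _ _.
have -> : (fun z => `|(f (xdil w 2^-1 (xdil2 w z)))%:E|%E) = (fun z => `|(f z)%:E|%E).
  by apply/funext => z; rewrite (xdil_half2 w z).
move=> /(_ (measurableT_comp _ mfs))/(_ (fun=> abse_ge0 _)) E.
rewrite /comp ltey; apply/eqP => oo; move: foo.
rewrite /comp/= E//; rewrite [X in (_ * X)%E](_ : _ = +oo%E)//.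
by rewrite gt0_muley ?ltxx// lte_fin exprn_gt0// invr_gt0.
Qed.

Variables (alpha r t0 : R) (x0 : car R k).
Hypotheses (alpha0 : 0 < alpha) (r0 : 0 < r).
Let Q := pcyl alpha r t0 x0.
Let mu := leb R k.+1.
Let mQ : measurable Q := measurable_pcyl t0 x0 alpha0 r0.

Lemma qcut_out n z : ~ Q z -> qcut alpha r t0 x0 n z = 0.
Proof.
rewrite /Q pcylE => nQ; apply/eqP; apply: contra_notT nQ.
rewrite mulf_eq0 negb_or => /andP[h1 h2]; split.
  apply: (@eball_bcut_arg R 0 _ _ _ n); first by rewrite mulr_gt0// exprn_gt0.
  by rewrite leNgt; apply: contra h1 => /ltW h; apply/eqP; exact: bump_eq0.
apply: (@eball_bcut_arg R k _ _ _ n) => //.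
by rewrite leNgt; apply: contra h2 => /ltW h; apply/eqP; exact: bump_eq0.
Qed.

Variables (a : car R k.+1 -> R) (g : car R k.+1 -> car R k).
Hypotheses (inta : mu.-integrable Q (EFin \o a)) (wg : weak_gradx Q a g).
(** Extension by zero allows evaluation at dilated points and changes of variables on the whole
    space. *)
Let ab := a \_ Q.

Lemma integrable_ext0 : mu.-integrable setT (EFin \o ab).
Proof.
have := (integrable_restrict mu mQ measurableT (EFin \o a)).1.
by rewrite setTI restrict_EFin; apply.
Qed.

Lemma measurable_ext0 : measurable_fun setT ab.
Proof. by apply/measurable_EFinP; exact: (measurable_int _ integrable_ext0). Qed.

(** [xdil w 2^-1 z] is the midpoint [(t, (x + w) / 2)]. Changing variables in the term at [s = 2] of
    [dilation_difference] moves the dilation from the test function to [a], which gives the bound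
    that duality asks for. *)
Lemma midpoint_estimate (w : car R k) : eball x0 r w ->
  (\int[mu]_(z in Q) (`|a z - ab (xdil w 2^-1 z)|)%:E <=
   (2 ^+ k.+1 * r * \int[mu]_(z in Q) enorm (g z))%:E)%E.
Proof.
move=> hw; pose as_ z := ab (xdil w 2^-1 z).
have intas : mu.-integrable setT (EFin \o as_).
  exact: integrable_comp_xdil_half integrable_ext0.
have intasQ : mu.-integrable Q (EFin \o as_) by apply: integrableS intas.
have intPhi : mu.-integrable Q (EFin \o (fun z => a z - as_ z)).
  exact: (integrableB mQ inta intasQ).
apply: (@L1_duality R k.+1 Q mQ (fun z => a z - as_ z) intPhi (qcut alpha r t0 x0)).
- by move=> n; exact: tame_qcut.
- by move=> n z; exact: qcut_01.
- by move=> z Qz; exact: qcut_cvg.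
move=> n h th h1; pose hh z := qcut alpha r t0 x0 n z * h z.
have thh : tame hh by apply: tameM => //; exact: tame_qcut.
have hh1 z : `|hh z| <= 1.
  have /andP[q0 q1] := qcut_01 alpha r t0 x0 n z.
  by rewrite normrM -[leRHS]mulr1 ler_pM// ger0_norm.
have iah : mu.-integrable Q (EFin \o (fun z => a z * hh z)).
  exact: integrable_mulr_tame.
have iash : mu.-integrable Q (EFin \o (fun z => as_ z * hh z)).
  exact: integrable_mulr_tame.
have iP : mu.-integrable Q (EFin \o (fun z => (a z - as_ z) * hh z)).
  exact: integrable_mulr_tame.
have -> : (\int[mu]_(z in Q) ((a z - as_ z) * (qcut alpha r t0 x0 n z * h z))%:E)%E =
    (\int[mu]_(z in Q) (a z * hh z) - \int[mu]_(z in Q) (as_ z * hh z))%:E.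
  rewrite -RintegralB// [RHS](_ : _ = (\int[mu]_(z in Q) ((a z - as_ z) * hh z))%:E); last first.
    by congr EFin; apply: eq_Rintegral => z _; rewrite mulrBl.
  by rewrite /Rintegral fineK//; exact: (integrable_fin_num mQ iP).
have -> : \int[mu]_(z in Q) (as_ z * hh z) =
    \int[mu]_(z in Q) (a z * (2 ^+ k.+1 * hh (xdil w 2 z))).
  pose F y := as_ y * hh y.
  have intF : mu.-integrable setT (EFin \o F).
    apply: (integrable_mulr_bounded measurableT intas _ (fun z _ => hh1 z)).
    exact: tame_measurable.
  have E : \int[mu]_z F (xdil w 2 z) = 2^-1 ^+ k.+1 * \int[mu]_z F z.
    rewrite /Rintegral [X in fine X](integral_xdil2 w intF) fineM//.
    exact: (integrable_fin_num measurableT intF).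
  (* The cutoff confines [F] to [Q], so its integral may be taken over the whole space, where the
     dilation formula holds. *)
  have FQ0 z : ~ Q z -> F z = 0 by move=> nQ; rewrite /F /hh qcut_out// mul0r mulr0.
  transitivity (\int[mu]_z F z).
    rewrite Rintegral_mkcond; apply: eq_Rintegral => z _; rewrite /patch.
    by case: ifPn => //; rewrite notin_setE => /FQ0 ->.
  have -> : \int[mu]_z F z = 2 ^+ k.+1 * \int[mu]_z F (xdil w 2 z).
    by rewrite E mulrA -exprMn mulfV ?expr1n ?mul1r.
  have intF2 : mu.-integrable setT (EFin \o (fun z => F (xdil w 2 z))).
    rewrite (_ : (fun z => _) = fun z => ab z * hh (xdil w 2 z)); last first.
      by apply/funext => z; rewrite /F /as_ xdil_half2.
    apply: (integrable_mulr_bounded measurableT integrable_ext0 _ (fun z _ => hh1 (xdil w 2 z))).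
    by apply: tame_measurable; exact: tame_xdil.
  rewrite -RintegralZl// [RHS]Rintegral_mkcond; apply: eq_Rintegral => z _.
  rewrite /F /as_ xdil_half2 /ab /patch; case: ifPn => _; first by ring.
  by rewrite mul0r mulr0.
have [q tq hq] := tame_gradient thh.
by rewrite lee_fin; apply: (dilation_difference alpha0 r0 inta wg hw th h1 tq hq).
Qed.

End midpoint.

(** * Oscillation in space *)

Section tonelli_space.
Context {R : realType} (k : nat).
Variable psi : car R k.+1 * car R k -> \bar R.
Hypotheses (mpsi : measurable_fun setT psi) (psi0 : forall p, (0 <= psi p)%E).

Lemma tonelli_zw :
  (\int[leb R k.+1]_z \int[leb R k]_w psi (z, w) = \int[leb R k]_w \int[leb R k.+1]_z psi (z, w))%E.
Proof. exact: (@fubini_tonelli _ _ _ _ R (lebs R k.+1) (lebs R k) psi mpsi psi0). Qed.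

(** On triples [((t, x), w)] this is the symmetry that exchanges the two space points. *)
Definition xswap (p : car R k.+1 * car R k) : car R k.+1 * car R k :=
  (((p.1.1 : R), p.2) : car R k.+1, p.1.2).

Lemma measurable_xswap : measurable_fun setT xswap.
Proof.
apply/measurable_fun_pairP; split.
  apply/measurable_fun_pairP; split.
    exact: (measurableT_comp measurable_fst measurable_fst).
  exact: measurable_snd.
exact: (measurableT_comp measurable_snd measurable_fst).
Qed.

(** Both sides integrate the same nonnegative function of [t], [x] and [w], in different orders. *)
Lemma tonelli_xswap :
  (\int[leb R k.+1]_z \int[leb R k]_w psi (xswap (z, w)) =
   \int[leb R k.+1]_z \int[leb R k]_w psi (z, w))%E.
Proof.
have ms : measurable_fun setT (psi \o xswap) by exact: (measurableT_comp mpsi measurable_xswap).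
have mF : measurable_fun setT (fun z => (\int[leb R k]_w psi (xswap (z, w)))%E).
  exact: (@measurable_fun_fubini_tonelli_F _ _ _ _ R (lebs R k) _ ms (fun p => psi0 _)).
rewrite leb_tonelli2//; last by move=> z; apply: integral_ge0.
rewrite tonelli_zw; apply: eq_integral => x _.
rewrite [RHS]leb_tonelli1//.
exact: (measurableT_comp mpsi (measurable_pair2 _)).
Qed.

End tonelli_space.
Arguments xswap {R k} p.

Section oscillation.
Context {R : realType} (k : nat).
Variables (alpha r t0 : R) (x0 : car R k).
Hypotheses (alpha0 : 0 < alpha) (r0 : 0 < r).
Let Q := pcyl alpha r t0 x0.
Let mu := leb R k.+1.
Let mQ : measurable Q := measurable_pcyl t0 x0 alpha0 r0.
Let B := eball x0 r.
Let mB : measurable B := measurable_eball x0 r0.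
Variables (a : car R k.+1 -> R) (g : car R k.+1 -> car R k).
Hypotheses (inta : mu.-integrable Q (EFin \o a)) (wg : weak_gradx Q a g).
Let ab := a \_ Q.
Let mab : measurable_fun setT ab := measurable_ext0 alpha0 r0 inta.
Let M := 2 ^+ k.+1 * r * \int[mu]_(z in Q) enorm (g z).

Let rpsi (p : car R k.+1 * car R k) : R :=
  \1_Q p.1 * \1_B p.2 * `|ab p.1 - ab (xdil p.2 2^-1 p.1)|.

Let rosc (p : car R k.+1 * car R k) : R :=
  \1_Q p.1 * \1_B p.2 * `|ab p.1 - ab ((p.1.1 : R), p.2)|.

Let measurable_indics :
  measurable_fun setT (fun p : car R k.+1 * car R k => \1_Q p.1 * \1_B p.2 : R).
Proof.
apply: measurable_funM.
  exact: (measurableT_comp (measurable_indic mQ) measurable_fst).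
exact: (measurableT_comp (measurable_indic mB) measurable_snd).
Qed.

Let mrpsi : measurable_fun setT rpsi.
Proof.
apply: measurable_funM => //; apply: measurableT_comp => //; apply: measurable_funB.
  exact: (measurableT_comp mab measurable_fst).
apply: (measurableT_comp mab); apply: (@measurable_car _ _ _ k.+1) => v.
rewrite (_ : (fun p => _) = fun p : car R k.+1 * car R k =>
    dotv p.1 ((v.1 : R), scalev 2^-1 v.2) + dotv p.2 (scalev 2^-1 v.2)); last first.
  by apply/funext => p /=; rewrite !dotvE; field.
apply: measurable_funD.
  exact: (measurableT_comp (@measurable_dotv R k.+1 _) measurable_fst).
exact: (measurableT_comp (measurable_dotv _) measurable_snd).
Qed.

Let mrosc : measurable_fun setT rosc.
Proof.
apply: measurable_funM => //; apply: measurableT_comp => //; apply: measurable_funB.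
  exact: (measurableT_comp mab measurable_fst).
apply: (measurableT_comp mab); apply/measurable_fun_pairP; split.
  exact: (measurableT_comp measurable_fst measurable_fst).
exact: measurable_snd.
Qed.

Let rpsi_ge0 p : 0 <= rpsi p. Proof. by rewrite !mulr_ge0. Qed.
Let rosc_ge0 p : 0 <= rosc p. Proof. by rewrite !mulr_ge0. Qed.

Let indic_xswap p : \1_Q p.1 * \1_B p.2 = \1_Q (xswap p).1 * \1_B (xswap p).2 :> R.
Proof.
rewrite /Q pcylE; case: p => -[t x] w; rewrite /xswap/= !indicE !in_setX/=.
by rewrite -!natrM !mulnb; congr (_%:R); congr nat_of_bool; rewrite andbAC.
Qed.

(** Triangle inequality through the midpoint of [x] and [w], which the swap leaves unchanged. *)
Let rosc_le p : rosc p <= rpsi p + rpsi (xswap p).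
Proof.
rewrite /rosc /rpsi -indic_xswap -mulrDr ler_wpM2l ?mulr_ge0//.
case: p => -[t x] w; rewrite /xswap/=.
have -> : xdil x 2^-1 ((t, w) : car R k.+1) = xdil w 2^-1 ((t, x) : car R k.+1).
  by rewrite /xdil/=; congr pair; apply: dotv_ext => v; rewrite !dotvE; field.
set m := ab (xdil w _ _); rewrite -[X in `|X|](subrKA m) (le_trans (ler_normD _ _))//.
by rewrite lerD2l distrC.
Qed.

Let int_rpsi : (\int[mu]_z \int[leb R k]_w (rpsi (z, w))%:E <= leb R k B * M%:E)%E.
Proof.
rewrite (tonelli_zw (psi := EFin \o rpsi)); [|exact/measurable_EFinP|by move=> p; rewrite lee_fin].
have -> : (leb R k B * M%:E = \int[leb R k]_(w in B) M%:E)%E.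
  by rewrite integral_cst// muleC.
rewrite [leRHS]integral_mkcond; apply: ge0_le_integral => //.
- by move=> w _; apply: integral_ge0 => z _; rewrite lee_fin.
- apply: (@measurable_fun_fubini_tonelli_G _ _ _ _ R (lebs R k.+1) (EFin \o rpsi)).
    exact/measurable_EFinP.
  by move=> p; rewrite lee_fin.
- by apply/(measurable_restrictT _ mB); exact: measurable_cst.
- move=> w _; rewrite patchE; case: ifPn => wB; last first.
    rewrite integral0_eq// => z _ /=; rewrite /rpsi/= !indicE.
    by rewrite (negbTE wB) mulr0 mul0r.
  have wB' : eball x0 r w by rewrite inE in wB.
  apply: le_trans (midpoint_estimate alpha0 r0 inta wg wB').
  rewrite [leRHS]integral_mkcond le_eqVlt; apply/orP; left; apply/eqP.
  apply: eq_integral => z _; rewrite /rpsi/= patchE !indicE wB mulr1.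
  by rewrite /ab [a \_ Q]/patch; case: ifPn => zQ; rewrite ?mul1r// mul0r.
Qed.

(** Each of the two midpoint terms integrates to at most [|B| M], the second one by invariance under
    the swap. *)
Lemma oscillation_estimate :
  (\int[mu]_z \int[leb R k]_w (rosc (z, w))%:E <= leb R k B * (2 * M)%:E)%E.
Proof.
have mE : measurable_fun setT (EFin \o rpsi) by exact/measurable_EFinP.
have mE' : measurable_fun setT (EFin \o (rpsi \o xswap)).
  exact: (measurableT_comp mE (@measurable_xswap R k)).
have E0 p : (0 <= (EFin \o rpsi) p)%E by rewrite lee_fin.
have mF : measurable_fun setT (fun z => \int[leb R k]_w (rpsi (z, w))%:E)%E.
  exact: (@measurable_fun_fubini_tonelli_F _ _ _ _ R (lebs R k) _ mE E0).
have mF' : measurable_fun setT (fun z => \int[leb R k]_w (rpsi (xswap (z, w)))%:E)%E.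
  exact: (@measurable_fun_fubini_tonelli_F _ _ _ _ R (lebs R k) _ mE' (fun p => E0 (xswap p))).
rewrite mulrDl mul1r EFinD ge0_muleDr; last 2 first.
- by rewrite lee_fin mulr_ge0 ?Rintegral_ge0// ?mulr_ge0 ?exprn_ge0 ?ltW// => z _; exact: enorm_ge0.
- by rewrite lee_fin mulr_ge0 ?Rintegral_ge0// ?mulr_ge0 ?exprn_ge0 ?ltW// => z _; exact: enorm_ge0.
have h2 : (\int[mu]_z \int[leb R k]_w (rpsi (xswap (z, w)))%:E <= leb R k B * M%:E)%E.
  by have -> := tonelli_xswap mE E0.
apply: le_trans (leeD int_rpsi h2).
rewrite -ge0_integralD//; last 2 first.
- by move=> z _; apply: integral_ge0 => w _; rewrite lee_fin.
- by move=> z _; apply: integral_ge0 => w _; rewrite lee_fin.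
apply: ge0_le_integral => //.
- by move=> z _; apply: integral_ge0 => w _; rewrite lee_fin.
- apply: (@measurable_fun_fubini_tonelli_F _ _ _ _ R (lebs R k) (EFin \o rosc)).
    exact/measurable_EFinP.
  by move=> p; rewrite lee_fin.
- exact: emeasurable_funD.
move=> z _; rewrite -ge0_integralD//; last first.
- exact: (measurableT_comp mE' (measurable_pair1 _)).
- by move=> w _; rewrite lee_fin.
- exact: (measurableT_comp mE (measurable_pair1 _)).
- by move=> w _; rewrite lee_fin.
apply: ge0_le_integral => //.
- by move=> w _; rewrite lee_fin.
- have mr : measurable_fun setT (EFin \o rosc) by exact/measurable_EFinP.
  exact: (measurableT_comp mr (measurable_pair1 _)).
- apply: emeasurable_funD; first exact: (measurableT_comp mE (measurable_pair1 _)).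
  exact: (measurableT_comp mE' (measurable_pair1 _)).
- by move=> w _; rewrite -EFinD lee_fin.
Qed.

End oscillation.

(** * Weights *)

Section weight.
Context {R : realType} (k : nat) (x0 : car R k) (r : R).
Hypothesis r0 : 0 < r.
Let B := eball x0 r.
Let V := fine (leb R k B).
Hypothesis V0 : 0 < V.

Let mB : measurable B := measurable_eball x0 r0.

Lemma fine_eball : (V%:E = leb R k B)%E.
Proof. by rewrite fineK// ge0_fin_numE// eball_fin. Qed.

Lemma bball_01 x : 0 <= bball x0 r x <= 1.
Proof. by rewrite bump_ge0 bump_le1. Qed.

Lemma bball_out x : r ^+ 2 / 2 <= sqdist x0 x -> bball x0 r x = 0.
Proof.
move=> h; apply: bump_eq0; rewrite subr_le0 mulrAC ler_pdivlMr ?exprn_gt0//.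
lra.
Qed.

Lemma bball_out_eball x : ~ B x -> bball x0 r x = 0.
Proof.
rewrite /B eballE//= => /negP; rewrite -leNgt => h; apply: bball_out.
apply: le_trans h; have : 0 < r ^+ 2 by rewrite exprn_gt0.
lra.
Qed.

Lemma integrable_indic_eball (s : R) : 0 < s ->
  (leb R k).-integrable setT (EFin \o \1_(eball x0 s) : car R k -> \bar R).
Proof.
move=> s0; have mS := measurable_eball x0 s0.
apply/integrableP; split; first by apply/measurable_EFinP; exact: measurable_indic.
have -> : (fun x => `|(EFin \o \1_(eball x0 s)) x|%E) = EFin \o (\1_(eball x0 s) : car R k -> R).
  by apply/funext => x; rewrite /= ger0_norm.
by rewrite integral_indic// setIT eball_fin.
Qed.

Lemma integrable_bounded_eball (f : car R k -> R) C : measurable_fun setT f ->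
  (forall x, `|f x| <= C) -> (forall x, ~ B x -> f x = 0) ->
  (leb R k).-integrable setT (EFin \o f).
Proof.
move=> mf fC f0; have i1 : (leb R k).-integrable setT (EFin \o (fun x => C * \1_B x)).
  exact: (integrableZl measurableT C (integrable_indic_eball r0)).
apply: le_integrable i1 => //; first exact/measurable_EFinP.
move=> x _; rewrite lee_fin indicE; case: (boolP (x \in B)) => xB.
  by rewrite mulr1 (le_trans (fC x))// ler_norm.
by rewrite notin_setE in xB; rewrite f0// normr0 normr_ge0.
Qed.

Lemma integrable_bball : (leb R k).-integrable setT (EFin \o bball x0 r).
Proof.
apply: (@integrable_bounded_eball _ 1).
- exact/tame_measurable/tame_bball.
- by move=> x; have /andP[? ?] := bball_01 x; rewrite ger0_norm.
- exact: bball_out_eball.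
Qed.

Definition bnorm : R := \int[leb R k]_x bball x0 r x.

(** The bump is at least [exp(-2)] on the ball of radius [r / 2], whose volume is [2^-(k+1) V];
    hence [bnorm >= V / wconst]. *)
Definition wconst : R := expR 2 * 2 ^+ k.+1.

Lemma wconst_gt0 : 0 < wconst.
Proof. by rewrite mulr_gt0 ?expR_gt0// exprn_gt0. Qed.

Lemma bnorm_ge : V / wconst <= bnorm.
Proof.
have r2 : 0 < r / 2 by rewrite divr_gt0.
have mB2 := measurable_eball x0 r2.
rewrite -lee_fin /bnorm /Rintegral fineK; last exact: (integrable_fin_num measurableT integrable_bball).
apply: le_trans (_ : \int[leb R k]_x (expR (- 2) * \1_(eball x0 (r / 2)) x)%:E <= _)%E.
  under eq_integral do rewrite EFinM.
  rewrite integralZl//; last exact: integrable_indic_eball.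
  rewrite integral_indic// setIT eball_half// -fine_eball -!EFinM lee_fin.
  rewrite /wconst invfM expRN exprVn mulrC.
  by rewrite -mulrA lexx.
apply: ge0_le_integral => //.
- by apply/measurable_EFinP/measurable_funM => //; exact: measurable_indic.
- by apply/measurable_EFinP/tame_measurable/tame_bball.
move=> x _; rewrite lee_fin indicE; case: (boolP (x \in _)) => xB; last first.
  by rewrite mulr0; have /andP[] := bball_01 x.
rewrite mulr1; apply: bump_ge_half; move: xB; rewrite inE eballE//= => h.
have r20 : 0 < r ^+ 2 by rewrite exprn_gt0.
have : 2 / r ^+ 2 * sqdist x0 x <= 2^-1.
  rewrite mulrAC ler_pdivrMr//; move: h; rewrite expr_div_n; lra.
lra.
Qed.

Lemma bnorm_gt0 : 0 < bnorm.
Proof. by apply: lt_le_trans bnorm_ge; rewrite divr_gt0// wconst_gt0. Qed.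

(** Serves twice: in space as the weight [eta], and with [k = 0] as the time bump [theta]. *)
Definition wt (x : car R k) : R := bnorm^-1 * bball x0 r x.

Lemma tame_wt : tame wt.
Proof. by apply: tameZ; exact: tame_bball. Qed.

Lemma wt_ge0 x : 0 <= wt x.
Proof.
rewrite mulr_ge0//; first by rewrite invr_ge0 ltW// bnorm_gt0.
by have /andP[] := bball_01 x.
Qed.

Lemma bnorm_inv_le : bnorm^-1 <= wconst / V.
Proof.
rewrite -[leRHS]invrK lef_pV2 ?posrE ?bnorm_gt0//.
  by rewrite invfM invrK mulrC; exact: bnorm_ge.
by rewrite invr_gt0 divr_gt0// wconst_gt0.
Qed.

Lemma wt_le x : wt x <= wconst / V.
Proof.
apply: le_trans bnorm_inv_le; rewrite ler_piMr//.
  by rewrite invr_ge0 ltW// bnorm_gt0.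
by have /andP[] := bball_01 x.
Qed.

Lemma wt_out x : ~ B x -> wt x = 0.
Proof. by move=> /bball_out_eball h; rewrite /wt h mulr0. Qed.

Lemma integrable_wt : (leb R k).-integrable setT (EFin \o wt).
Proof.
apply: (@integrable_bounded_eball _ (wconst / V)).
- exact/tame_measurable/tame_wt.
- by move=> x; rewrite ger0_norm ?wt_ge0 ?wt_le.
- exact: wt_out.
Qed.

Lemma Rintegral_wt : \int[leb R k]_x wt x = 1.
Proof.
rewrite RintegralZl//; last exact: integrable_bball.
by rewrite mulVf// gt_eqF// bnorm_gt0.
Qed.

(** The chain rule gives [dbump] times [4 / r^2] times [|x - x0|]. Inside the ball the last two are
    at most [4 / r]; outside, the argument of the bump is at most [-1] and the derivative
    vanishes. *)
Lemma wt_gradient (Cf : R) : (forall y : R, y <= 1 -> `|dbump y| <= Cf) -> 0 <= Cf ->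
  exists2 p, is_gradient wt p & forall x, enorm (p x) <= wconst / V * (4 * Cf / r).
Proof.
move=> hC C0.
exists (fun x => scalev bnorm^-1 (scalev (dbump (1 - 2 / r ^+ 2 * sqdist x0 x) * - (4 / r ^+ 2)) (subv x x0))).
  move=> z v; have dB := is_gradient_bball x0 r z v.
  by apply: (is_derive_eq (is_deriveZ bnorm^-1 dB)); rewrite [in RHS]dotvZl.
move=> x; rewrite enormZ ger0_norm; last by rewrite invr_ge0 ltW// bnorm_gt0.
apply: ler_pM; rewrite ?enorm_ge0 ?bnorm_inv_le//; first by rewrite invr_ge0 ltW// bnorm_gt0.
rewrite enormZ normrM normrN.
have r20 : 0 < r ^+ 2 by rewrite exprn_gt0.
rewrite [`|4 / r ^+ 2|]ger0_norm ?divr_ge0 ?(ltW r20)//.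
have s1 : 1 - 2 / r ^+ 2 * sqdist x0 x <= 1.
  by rewrite gerBl mulr_ge0 ?sqdist_ge0// divr_ge0// ltW.
have [xB|nB] := boolP (enorm (subv x x0) < r); last first.
  have h : r ^+ 2 <= sqdist x0 x by rewrite leNgt -enorm_lt.
  have h2 : 2 <= 2 / r ^+ 2 * sqdist x0 x by rewrite mulrAC ler_pdivlMr// ler_pM2l.
  have -> : dbump (1 - 2 / r ^+ 2 * sqdist x0 x) = 0 by rewrite /dbump flat_exp_le0//; lra.
  by rewrite normr0 !mul0r divr_ge0 ?mulr_ge0// ltW.
apply: le_trans (_ : Cf * (4 / r ^+ 2) * r <= _).
  apply: ler_pM => //.
  - by rewrite mulr_ge0// divr_ge0// ltW.
  - exact: enorm_ge0.
  - by rewrite ler_wpM2r// ?hC// divr_ge0// ltW.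
  - exact: ltW.
rewrite le_eqVlt; apply/orP; left; apply/eqP; field.
by rewrite gt_eqF.
Qed.

End weight.

(** * Spatial means *)

Section spatial_mean.
Context {R : realType} (k : nat).
Variables (alpha r t0 : R) (x0 : car R k).
Hypotheses (alpha0 : 0 < alpha) (r0 : 0 < r).
Let Q := pcyl alpha r t0 x0.
Let mu := leb R k.+1.
Let mQ : measurable Q := measurable_pcyl t0 x0 alpha0 r0.
Let B := eball x0 r.
Let mB : measurable B := measurable_eball x0 r0.
Let V := fine (leb R k B).
Hypothesis V0 : 0 < V.
Let I := eball (t0 : car R 0) (alpha * r ^+ 2).
Variables (a : car R k.+1 -> R) (g : car R k.+1 -> car R k).
Hypothesis inta : mu.-integrable Q (EFin \o a).
Let ab := a \_ Q.
Let mab : measurable_fun setT ab := measurable_ext0 alpha0 r0 inta.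
Let eta : car R k -> R := wt x0 r.
Let meta : measurable_fun setT eta := tame_measurable (tame_wt x0 r).

Let F0 (z : car R k.+1) : R := ab z * eta z.2.

Let intF0 : (leb R k.+1).-integrable setT (EFin \o F0).
Proof.
apply: (@integrable_mulr_bounded R _ _ _ _ measurableT ab (fun z : car R k.+1 => eta z.2) (@wconst R k / V)).
- exact: integrable_ext0.
- exact: (measurableT_comp meta measurable_snd).
- by move=> z _; rewrite ger0_norm ?wt_ge0 ?wt_le.
Qed.

Definition smean (t : car R 0) : R := \int[leb R k]_w ((a \_ Q) ((t : R), w) * wt x0 r w).

Let smeanE t : smean t = fine (\int[leb R k]_w (F0 ((t : R), w))%:E)%E.
Proof. by []. Qed.

Lemma integrable_smean : (leb R 0).-integrable setT (EFin \o smean).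
Proof.
have intA := leb_fubini_integrable intF0.
have mA := measurable_int _ intA.
apply: le_integrable intA => //.
  by apply/measurable_EFinP; exact: (measurableT_comp _ mA).
(* [smean] takes the value 0 wherever the slice integral is infinite, so that integral dominates it
   at every time. *)
move=> t _; rewrite /= smeanE; by case: (integral _ _ _) => [s| |] //=; rewrite leey.
Qed.

Lemma measurable_smean : measurable_fun setT smean.
Proof. by apply/measurable_EFinP; exact: (measurable_int _ integrable_smean). Qed.

Lemma smean_out t : ~ I t -> smean t = 0.
Proof.
move=> nI; rewrite /smean /Rintegral integral0_eq// => w _.
rewrite patchE memNset ?mul0r//.
by rewrite /Q pcylE => -[/= /nI].
Qed.

(** Fubini, with [psi] constant on each time slice. Pulling [psi t] out of the inner integral uses
    an integrable slice, so the integrands are compared for almost every [t] only. *)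
Lemma smean_pairing (psi : car R 0 -> R) : tame psi ->
  \int[leb R 0]_(t in I) (smean t * psi t) = \int[mu]_(z in Q) (a z * (psi (z.1 : R) * eta z.2)).
Proof.
move=> tpsi.
have tp : tame (fun z : car R k.+1 => psi (z.1 : R) * eta z.2).
  by apply: tameM; [exact: (tame_fst k tpsi)|exact: (tame_snd (tame_wt x0 r))].
have ip := integrable_mulr_tame alpha0 r0 inta tp.
pose F z := ab z * (psi (z.1 : R) * eta z.2).
have FE : (fun z => a z * (psi (z.1 : R) * eta z.2)) \_ Q = F.
  by apply/funext => z; rewrite /F /ab !patchE; case: ifPn => // _; rewrite mul0r.
have iF : mu.-integrable setT (EFin \o F).
  have := (integrable_restrict mu mQ measurableT _).1; rewrite setTI => /(_ _ ip).
  by rewrite restrict_EFin FE.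
rewrite [RHS]Rintegral_mkcond FE.
transitivity (\int[leb R 0]_t (smean t * psi t)).
  rewrite Rintegral_mkcond; apply: eq_Rintegral => t _; rewrite patchE.
  by case: ifPn => //; rewrite notin_setE => /smean_out ->; rewrite mul0r.
rewrite /Rintegral [X in _ = fine X](leb_fubini iF); congr fine.
apply: ae_eq_integral => //.
- apply/measurable_EFinP; apply: measurable_funM; first exact: measurable_smean.
  exact: tame_measurable.
- exact: (measurable_int _ (leb_fubini_integrable iF)).
have := leb_fubini_ae intF0; apply: filterS => t it _.
have -> : (fun x => (EFin \o F) ((t : R), x)) = (fun x => ((psi t)%:E * (EFin \o F0) ((t : R), x))%E).
  by apply/funext => w; rewrite /F /F0/= -EFinM; congr EFin; ring.
rewrite integralZl// smeanE EFinM muleC fineK//.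
exact: (integrable_fin_num measurableT it).
Qed.

Hypothesis wg : weak_gradx Q a g.
Let M := 2 ^+ k.+1 * r * \int[mu]_(z in Q) enorm (g z).

Let rosc (z : car R k.+1) (w : car R k) : R :=
  \1_Q z * \1_B w * `|ab z - ab ((z.1 : R), w)|.

Let mrosc z : measurable_fun setT (fun w => (rosc z w)%:E).
Proof.
apply/measurable_EFinP/measurable_funM.
  by apply: measurable_funM; [exact: measurable_cst|exact: measurable_indic].
apply: measurableT_comp => //; apply: measurable_funB; first exact: measurable_cst.
exact: (measurableT_comp mab (measurable_pair1 (z.1 : R))).
Qed.

Let rosc_ge0 z w : 0 <= rosc z w.
Proof. by rewrite !mulr_ge0. Qed.

(** [eta] has integral one, so [a z - smean t] is the [eta]-average of [a z - a(t, w)], and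
    [eta <= wconst / V]. *)
Let smean_pointwise z : Q z ->
  ((`|a z - smean (z.1 : R)|)%:E <= (@wconst R k / V)%:E * \int[leb R k]_w (rosc z w)%:E)%E.
Proof.
move=> Qz; have cV : 0 <= @wconst R k / V by rewrite divr_ge0 ?ltW ?wconst_gt0.
pose f w := (a z - ab ((z.1 : R), w)) * eta w.
have mab2 : measurable_fun setT (fun w => ab ((z.1 : R), w)).
  exact: (measurableT_comp mab (measurable_pair1 (z.1 : R))).
have mf : measurable_fun setT f.
  by apply: measurable_funM => //; apply: measurable_funB => //; exact: measurable_cst.
have f_le : (\int[leb R k]_w (`|f w|)%:E <= (@wconst R k / V)%:E * \int[leb R k]_w (rosc z w)%:E)%E.
  rewrite -ge0_integralZl//; last by move=> w _; rewrite lee_fin.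
  apply: ge0_le_integral => //.
  - by apply/measurable_EFinP; exact: measurableT_comp.
  - by apply: measurable_funeM.
  move=> w _; rewrite -EFinM lee_fin /f /rosc normrM indicE mem_set// mul1r.
  rewrite {2}/ab patchE mem_set//.
  rewrite [`|eta w|]ger0_norm ?wt_ge0// indicE; case: (boolP (w \in B)) => wB.
    by rewrite mul1r mulrC ler_wpM2r// wt_le.
  by rewrite notin_setE in wB; rewrite /eta wt_out// mul0r !mulr0.
(* If this integral is infinite there is nothing to prove; that case covers the times at which
   [smean] is a default value. *)
apply: le_trans f_le; have [foo|foo] := ltP (\int[leb R k]_w (`|f w|)%:E)%E +oo%E; last first.
  by apply: le_trans foo; exact: leey.
have intf : (leb R k).-integrable setT (EFin \o f).
  by apply/integrableP; split => //; exact/measurable_EFinP.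
have inte := integrable_wt r0 V0.
have inty : (leb R k).-integrable setT (EFin \o (fun w => a z * eta w)).
  exact: (integrableZl measurableT (a z) inte).
have -> : a z - smean (z.1 : R) = \int[leb R k]_w f w.
  have -> : a z = \int[leb R k]_w (a z * eta w).
    by rewrite RintegralZl// Rintegral_wt// mulr1.
  have E : smean (z.1 : R) = \int[leb R k]_w (a z * eta w - f w).
    by apply: eq_Rintegral => w _; rewrite /f /ab /eta; ring.
  by rewrite E RintegralB//; ring.
rewrite EFin_normr_Rintegral//.
by apply: le_abse_integral => //; exact/measurable_EFinP.
Qed.

(** The [1 / V] of the pointwise bound cancels the volume of [B] in the oscillation estimate. *)
Lemma smean_close :
  (\int[mu]_(z in Q) (`|a z - smean (z.1 : R)|)%:E <= (2 * @wconst R k * M)%:E)%E.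
Proof.
have cV : 0 <= @wconst R k / V by rewrite divr_ge0 ?ltW ?wconst_gt0.
have mA1 : measurable_fun setT (fun z : car R k.+1 => smean (z.1 : R)).
  exact: (measurableT_comp measurable_smean measurable_fst).
have ma : measurable_fun Q a by apply/measurable_EFinP; exact: (measurable_int _ inta).
have mO : measurable_fun setT (fun z => \int[leb R k]_w (rosc z w)%:E)%E.
  have mr : measurable_fun setT (fun p : car R k.+1 * car R k => (rosc p.1 p.2)%:E).
    apply/measurable_EFinP; apply: measurable_funM.
      apply: measurable_funM.
        exact: (measurableT_comp (measurable_indic mQ) measurable_fst).
      exact: (measurableT_comp (measurable_indic mB) measurable_snd).
    apply: measurableT_comp => //; apply: measurable_funB.
      exact: (measurableT_comp mab measurable_fst).
    apply: (measurableT_comp mab); apply/measurable_fun_pairP; split.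
      exact: (measurableT_comp measurable_fst measurable_fst).
    exact: measurable_snd.
  exact: (@measurable_fun_fubini_tonelli_F _ _ _ _ R (lebs R k) _ mr (fun p => rosc_ge0 p.1 p.2)).
apply: le_trans (_ : (@wconst R k / V)%:E * \int[mu]_z \int[leb R k]_w (rosc z w)%:E <= _)%E; last first.
  apply: le_trans (lee_wpmul2l _ (oscillation_estimate alpha0 r0 inta wg)) _; first by rewrite lee_fin.
  rewrite -(fine_eball x0 r0) -!EFinM lee_fin -/V -/M le_eqVlt; apply/orP; left; apply/eqP.
  by field; rewrite gt_eqF.
rewrite -ge0_integralZl//; last by move=> z _; apply: integral_ge0 => w _; rewrite lee_fin.
rewrite integral_mkcond; apply: ge0_le_integral => //.
- by move=> z _; rewrite patchE; case: ifPn => // _; rewrite lee_fin.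
- apply/(measurable_restrictT _ mQ); apply/measurable_EFinP/measurableT_comp => //.
  by apply: measurable_funB => //; exact: measurable_funTS.
- exact: measurable_funeM.
move=> z _; rewrite patchE; case: ifPn => zQ.
  by rewrite inE in zQ; exact: smean_pointwise.
by rewrite mule_ge0// ?lee_fin// integral_ge0// => w _; rewrite lee_fin.
Qed.

End spatial_mean.

(** * Test functions of time *)

Section one_variable.
Context {R : realType}.

Lemma tame_is_derive (f : car R 0 -> R) (t : R) : tame f ->
  is_derive t (1 : R) (f : R -> R) (dirder f (t : car R 0) (1 : R)).
Proof.
move=> /tame_gradient[p _ hp]; apply: is_derive_shift.
rewrite (is_gradient_dirder hp).
have := hp t (1 : R); congr is_derive; apply/funext => s /=.
by rewrite mulr1.
Qed.

Lemma tame_deriv_seq (f : car R 0 -> R) : tame f ->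
  deriv_seq (fun n => iterD (nseq n ((1 : R) : car R 0)) f).
Proof.
move=> tf n x; apply: tame_is_derive.
by elim: n => [//|n IH] /=; exact: tame_dirder.
Qed.

Lemma eball0E (t0 s : R) : eball (t0 : car R 0) s = `](t0 - s), (t0 + s)[%classic.
Proof.
apply/seteqP; split => x; rewrite /eball/= enorm0E /subv/= mulN1r in_itv/= ltr_norml;
  by move=> /andP[? ?]; apply/andP; split; lra.
Qed.

Lemma fine_eball0 (t0 s : R) : 0 < s -> fine (leb R 0 (eball (t0 : car R 0) s)) = 2 * s.
Proof.
move=> s0; rewrite eball0E /= lebesgue_measure_itv/= lte_fin ifT; last by lra.
by rewrite -EFinB/=; ring.
Qed.

Definition primitive (f : R -> R) (t : R) : R := \int[lebesgue_measure]_(s in `]-oo, t]) f s.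

Lemma is_derive_primitive (f : R -> R) (t : R) : continuous f ->
  lebesgue_measure.-integrable setT (EFin \o f) -> is_derive t (1 : R) (primitive f) (f t).
Proof.
move=> cf intf.
have tt : t < t + 1 by rewrite ltrDl.
have i1 : lebesgue_measure.-integrable [set` Interval -oo%O (BRight (t + 1))] (EFin \o f).
  by apply: integrableS intf.
have [dF eF] := @continuous_FTC1 R f -oo%O t (t + 1) tt i1 (ltNyr _) (cf t).
by apply: (DeriveDef dF); rewrite -derive1E.
Qed.

Lemma primitive_norm_le (f F : R -> R) (t : R) :
  lebesgue_measure.-integrable setT (EFin \o f) ->
  lebesgue_measure.-integrable setT (EFin \o F) ->
  (forall s, `|f s| <= F s) -> `|primitive f t| <= \int[lebesgue_measure]_s F s.
Proof.
move=> intf intF fF.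
have i1 : lebesgue_measure.-integrable `]-oo, t] (EFin \o f) by apply: integrableS intf.
have i2 : lebesgue_measure.-integrable `]-oo, t] (EFin \o F) by apply: integrableS intF.
apply: le_trans (_ : \int[lebesgue_measure]_(s in `]-oo, t]) F s <= _).
  exact: Rintegral_norm_le.
rewrite Rintegral_mkcond; apply: le_Rintegral => //.
  have := (integrable_restrict lebesgue_measure (measurable_itv `]-oo, t]) measurableT (EFin \o F)).1.
  by rewrite setTI restrict_EFin; apply.
by move=> s _; rewrite patchE; case: ifPn => // _; exact: (le_trans (normr_ge0 (f s)) (fF s)).
Qed.

(** To the left of the support the primitive integrates zero; to the right it already contains the
    whole integral, which is zero. The squared distance treats both sides at once. *)
Lemma primitive_out (f : R -> R) (t0 m t : R) : (forall s, m < (s - t0) ^+ 2 -> f s = 0) ->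
  \int[lebesgue_measure]_s f s = 0 -> m < (t - t0) ^+ 2 -> primitive f t = 0.
Proof.
move=> f0 If mt; have [tt|tt] := leP t t0.
  rewrite /primitive /Rintegral integral0_eq// => s; rewrite /= in_itv/= => st.
  rewrite f0//; apply: lt_le_trans mt _; nra.
rewrite -[RHS]If /primitive Rintegral_mkcond; apply: eq_Rintegral => s _.
rewrite patchE; case: ifPn => //; rewrite notin_setE/= in_itv/= => /negP; rewrite -ltNge => ts.
rewrite f0//; apply: lt_le_trans mt _; nra.
Qed.

End one_variable.

Section time_test_function.
Context {R : realType}.
Variables (t0 rho : R) (rho0 : 0 < rho) (n : nat) (h : car R 0 -> R).
Hypotheses (th : tame h) (h1 : forall t, `|h t| <= 1).
Let I := eball (t0 : car R 0) rho.
Let V : R := fine (leb R 0 I).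

Let VE : V = 2 * rho. Proof. exact: fine_eball0. Qed.
Let V0 : 0 < V. Proof. by rewrite VE mulr_gt0. Qed.

Let hb (t : car R 0) := bcut (t0 : car R 0) rho n t * h t.
Let thb : tame hb. Proof. by apply: tameM => //; exact: tame_bcut. Qed.

Let hb1 t : `|hb t| <= 1.
Proof.
have /andP[? ?] := bcut_01 (t0 : car R 0) t rho n.
by rewrite normrM -[leRHS]mulr1 ler_pM// ger0_norm.
Qed.

(** A quantitative form of compact support. Using [n.+1] keeps the radius strictly below [rho] for
    [n = 0] too, at the price of a slightly larger set. *)
Let hb_out t : rho ^+ 2 - n.+1%:R^-1 < sqdist (t0 : car R 0) t -> hb t = 0.
Proof.
move=> ht; rewrite /hb /bcut bump_eq0 ?mul0r//.
have n1 : 0 < n.+1%:R :> R by rewrite ltr0n.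
have : n%:R * (rho ^+ 2 - sqdist (t0 : car R 0) t) <= 1; last by lra.
have [d0|d0] := leP (rho ^+ 2 - sqdist (t0 : car R 0) t) 0.
  by apply: le_trans (_ : 0 <= _) => //; rewrite mulr_ge0_le0.
have : n.+1%:R * (rho ^+ 2 - sqdist (t0 : car R 0) t) <= 1.
  by rewrite -ler_pdivlMl// mulr1 lerBlDr addrC -lerBlDr ltW.
by apply: le_trans; rewrite ler_wpM2r ?(ltW d0)// ler_nat.
Qed.

Let hb_outI t : ~ I t -> hb t = 0.
Proof.
rewrite /I eballE//= => /negP; rewrite -leNgt => ht; apply: hb_out.
by apply: lt_le_trans ht; rewrite ltrBlDr ltrDl invr_gt0 ltr0n.
Qed.

Let ihb : (leb R 0).-integrable setT (EFin \o hb).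
Proof. by apply: (@integrable_bounded_eball R 0 t0 rho rho0 hb 1) => //; exact: tame_measurable. Qed.

Let c := \int[leb R 0]_t hb t.

Let c_le : `|c| <= V.
Proof.
have i1 : (leb R 0).-integrable setT (EFin \o (\1_I : car R 0 -> R)).
  exact: integrable_indic_eball.
apply: le_trans (@Rintegral_norm_le R _ _ (leb R 0) setT measurableT hb (\1_I) ihb i1 _) _.
  move=> t _; rewrite indicE; case: (boolP (t \in I)) => tI; first exact: hb1.
  by rewrite notin_setE in tI; rewrite hb_outI// normr0.
by rewrite /Rintegral integral_indic ?setIT//; exact: measurable_eball.
Qed.

Definition tpsi (t : car R 0) : R :=
  bcut (t0 : car R 0) rho n t * h t + (- \int[leb R 0]_s (bcut (t0 : car R 0) rho n s * h s)) * wt (t0 : car R 0) rho t.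

Lemma tame_tpsi : tame tpsi.
Proof. by apply: tameD => //; apply: tameZ; exact: tame_wt. Qed.

(** The integral of the cut function is at most the length [V] of the interval, which cancels the
    [1 / V] in the bound for [wt]. *)
Lemma tpsi_le t : `|tpsi t| <= 1 + @wconst R 0.
Proof.
apply: le_trans (ler_normD _ _) _; apply: lerD; first exact: hb1.
rewrite normrM normrN [`|wt _ _ _|]ger0_norm; last exact: wt_ge0.
apply: le_trans (_ : V * (@wconst R 0 / V) <= _).
  by apply: ler_pM => //; [exact: wt_ge0|exact: wt_le].
by rewrite mulrCA mulfV ?mulr1// gt_eqF.
Qed.

Let supp : R := Num.max (rho ^+ 2 - n.+1%:R^-1) (rho ^+ 2 / 2).

Lemma tpsi_out (t : R) : supp < (t - t0) ^+ 2 -> tpsi t = 0.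
Proof.
have -> : (t - t0) ^+ 2 = sqdist (t0 : car R 0) (t : car R 0).
  by rewrite /sqdist /subv /= mulN1r expr2.
rewrite /supp gt_max => /andP[s1 s2]; rewrite /tpsi.
have -> : bcut (t0 : car R 0) rho n t * h t = 0 by exact: hb_out.
by rewrite /wt bball_out ?ltW// !mulr0 addr0.
Qed.

Let tpsi_outI (t : car R 0) : ~ I t -> tpsi t = 0.
Proof.
move=> nI; rewrite /tpsi.
have -> : bcut (t0 : car R 0) rho n t * h t = 0 by exact: hb_outI.
by rewrite wt_out// mulr0 addr0.
Qed.

Lemma integrable_tpsi : (leb R 0).-integrable setT (EFin \o tpsi).
Proof.
apply: (@integrable_bounded_eball R 0 t0 rho rho0 tpsi _ _ tpsi_le tpsi_outI).
exact/tame_measurable/tame_tpsi.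
Qed.

Lemma Rintegral_tpsi : \int[leb R 0]_t tpsi t = 0.
Proof.
rewrite RintegralD//; last first.
  exact: (integrableZl measurableT (- c) (integrable_wt rho0 V0)).
rewrite RintegralZl//; last exact: (integrable_wt rho0 V0).
by rewrite Rintegral_wt// mulr1 subrr.
Qed.

Definition tphi (t : car R 0) : R := primitive tpsi t.

Lemma is_derive_tphi (t : R) : is_derive t (1 : R) tphi (tpsi t).
Proof.
apply: is_derive_primitive; last exact: integrable_tpsi.
exact: (deriv_seq_continuous (n := 0%N) (tame_deriv_seq tame_tpsi)).
Qed.

(** Putting the primitive in front of the successive derivatives of [tpsi] gives a [deriv_seq], and
    [tame_comp] applies it to the coordinate. *)
Lemma tame_tphi : tame tphi.
Proof.
have dF : deriv_seq (fun m => if m is m'.+1 then iterD (nseq m' ((1 : R) : car R 0)) tpsi else tphi).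
  case=> [|m] x; first exact: is_derive_tphi.
  exact: (tame_deriv_seq tame_tpsi).
have := tame_comp dF (@tame_dotv R 0 (1 : R)); congr tame; apply/funext => t /=.
by rewrite mulr1.
Qed.

Lemma tphi_le t : `|tphi t| <= 2 * rho * (1 + @wconst R 0).
Proof.
have i1 : (leb R 0).-integrable setT (EFin \o (fun t => (1 + @wconst R 0) * \1_I t)).
  exact: (integrableZl measurableT (1 + @wconst R 0) (integrable_indic_eball (t0 : car R 0) rho0)).
have E : \int[leb R 0]_t ((1 + @wconst R 0) * \1_I t) = 2 * rho * (1 + @wconst R 0).
  rewrite RintegralZl//; last exact: integrable_indic_eball.
  have mI : measurable I := measurable_eball (t0 : car R 0) rho0.
  transitivity ((1 + @wconst R 0) * V); last by rewrite VE mulrC.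
  by congr (_ * _); rewrite /Rintegral integral_indic// setIT.
have h2 s : `|tpsi s| <= (1 + @wconst R 0) * \1_I s.
  rewrite indicE; case: (boolP (s \in I)) => sI; first by rewrite mulr1 tpsi_le.
  by rewrite notin_setE in sI; rewrite tpsi_outI// normr0 mulr0.
rewrite -E; exact: (primitive_norm_le t integrable_tpsi i1 h2).
Qed.

(** The strict inequality [m < rho ^+ 2] is the point: it leaves a closed set inside the open
    interval. *)
Lemma tphi_supp : exists2 m : R, m < rho ^+ 2 &
  forall t : car R 0, m < sqdist (t0 : car R 0) t -> tphi t = 0.
Proof.
exists supp.
  rewrite /supp gt_max; apply/andP; split.
    by rewrite ltrBlDr ltrDl invr_gt0 ltr0n.
  have : 0 < rho ^+ 2 by rewrite exprn_gt0.
  lra.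
move=> t; have -> : sqdist (t0 : car R 0) (t : car R 0) = (t - t0) ^+ 2 :> R.
  by rewrite /sqdist /subv /= mulN1r expr2.
by apply: primitive_out; [exact: tpsi_out|exact: Rintegral_tpsi].
Qed.

End time_test_function.

(** * The time derivative *)

Section gradients.
Context {R : realType} (k : nat).

Lemma is_gradient_fst (f : car R 0 -> R) (p : car R 0 -> car R 0) : is_gradient f p ->
  is_gradient (fun z : car R k.+1 => f (z.1 : R)) (fun z => ((p (z.1 : R) : R), zerov R k)).
Proof.
move=> fp z v; have := fp (z.1 : R) (v.1 : R).
by rewrite /= dotv0l addr0.
Qed.

Lemma is_gradient_snd (f : car R k -> R) p : is_gradient f p ->
  is_gradient (fun z : car R k.+1 => f z.2) (fun z => ((0 : R), p z.2)).
Proof. by move=> fp z v; have := fp z.2 v.2; rewrite /= mul0r add0r. Qed.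

Lemma is_gradientZ j c (f : car R j -> R) p : is_gradient f p ->
  is_gradient (fun z => c * f z) (fun z => scalev c (p z)).
Proof.
move=> fp z v; have df := fp z v.
by apply: (is_derive_eq (is_deriveZ c df)); rewrite dotvZl.
Qed.

Lemma gradx_gradient (f : car R k.+1 -> R) p z : is_gradient f p -> gradx f z = (p z).2.
Proof.
move=> fp; rewrite /gradx -[RHS]gradof_dotv; congr gradof; apply/funext => v.
by rewrite (is_gradient_dirder fp) /= mulr0 add0r.
Qed.

Lemma dt_gradient (f : car R k.+1 -> R) p z : is_gradient f p -> dt f z = (p z).1.
Proof. by move=> fp; rewrite /dt (is_gradient_dirder fp) /= mulr1 dotv0r addr0. Qed.

Lemma supn_le j (f : car R j -> R) C : (forall z, `|f z| <= C) -> (supn f <= C%:E)%E.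
Proof. by move=> fC; apply: ge_ereal_sup => _ [z _ <-]; rewrite lee_fin. Qed.

Lemma tame_gradient_uniq (f p : car R 0 -> R) : tame f ->
  (forall t : R, is_derive t (1 : R) (f : R -> R) (p t)) -> is_gradient f p.
Proof.
move=> tf dp; have [q _ hq] := tame_gradient tf.
have -> : p = q; last exact: hq.
apply/funext => t; have [_ <-] := dp t.
have [_ ->] := tame_is_derive t tf.
by rewrite (is_gradient_dirder hq) /= mulr1.
Qed.

End gradients.

Lemma NQ_dt_ge (R : realType) k (alpha r t0 : R) (x0 : car R k) (a xi : car R k.+1 -> R) :
  FQ alpha r t0 x0 xi ->
  ((r / volQ alpha r t0 x0)%:E *
    `| - (\int[leb R k.+1]_(z in pcyl alpha r t0 x0) (a z * dt xi z)%:E) |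
   <= NQ_dt alpha r t0 x0 a)%E.
Proof. by move=> xiF; apply: ereal_sup_ubound; exists xi. Qed.

Section time_estimate.
Context {R : realType} (k : nat).
Variables (alpha r t0 : R) (x0 : car R k).
Hypotheses (alpha0 : 0 < alpha) (r0 : 0 < r).
Let Q := pcyl alpha r t0 x0.
Let mu := leb R k.+1.
Let rho := alpha * r ^+ 2.
Let rho0 : 0 < rho. Proof. by rewrite mulr_gt0// exprn_gt0. Qed.
Let B := eball x0 r.
Let V := fine (leb R k B).
Hypothesis V0 : 0 < V.
Let I := eball (t0 : car R 0) rho.
Let mI : measurable I := measurable_eball (t0 : car R 0) rho0.
Let VI0 : 0 < fine (leb R 0 I).
Proof. by rewrite fine_eball0// mulr_gt0. Qed.
Variable Cf : R.
Hypotheses (Cf0 : 0 <= Cf) (hCf : forall y : R, y <= 1 -> `|dbump y| <= Cf).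

(** The last factor is [2 + 8 Cf + 1], one summand for each term of the norm in [FQ]. With
    [L = 1 + wconst] in dimension one: [|phi| <= 2 rho L] for the size, a further [4 Cf / r] for the
    spatial gradient, [|psi| <= L] for the time derivative. *)
Definition tconst : R := (1 + @wconst R 0) * @wconst R k * (3 + 8 * Cf).

Lemma tconst_gt0 : 0 < tconst.
Proof.
by rewrite !mulr_gt0 ?wconst_gt0//; [rewrite addr_gt0 ?wconst_gt0|rewrite ltr_wpDr// mulr_ge0].
Qed.

(** The normalisation for which the bounds on the three terms of the norm add up to exactly 1. *)
Let kappa := rho * tconst / V.

Let kappa0 : 0 < kappa.
Proof. by rewrite divr_gt0// mulr_gt0// tconst_gt0. Qed.

Section with_h.
Variables (n : nat) (h : car R 0 -> R).
Hypotheses (th : tame h) (h1 : forall t, `|h t| <= 1).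
Let phi := tphi t0 rho n h.
Let psi := tpsi t0 rho n h.
Let eta := wt x0 r.

Let xi (z : car R k.+1) : R := kappa^-1 * (phi (z.1 : R) * eta z.2).

Let tphi' : tame phi. Proof. exact: tame_tphi. Qed.

Let grad_phi : is_gradient phi psi.
Proof. by apply: tame_gradient_uniq => // t; exact: is_derive_tphi. Qed.

Let tame_xi : tame xi.
Proof.
apply: tameZ; apply: tameM; first exact: (tame_fst k tphi').
exact: (tame_snd (tame_wt x0 r)).
Qed.

Let Cc_xi : Cc_infty Q xi.
Proof.
have [m m_lt hm] := tphi_supp t0 rho0 n th h1.
have r20 : 0 < r ^+ 2 by rewrite exprn_gt0.
pose A (z : car R k.+1) := m + (-1) * sqdist (t0 : car R 0) (z.1 : R).
pose D (z : car R k.+1) := r ^+ 2 / 2 + (-1) * sqdist x0 z.2.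
apply: (@Cc_tame R k.+1 Q xi A D tame_xi).
- exact: (tame_fst k (tame_affine_sqdist (t0 : car R 0) _ _)).
- exact: (tame_snd (tame_affine_sqdist x0 _ _)).
- exact: ebounded_pcyl.
- move=> z; rewrite /A /D => Az Dz; rewrite /Q pcylE; split.
    rewrite eballE//=; apply: le_lt_trans m_lt; move: Az; rewrite mulN1r subr_ge0; exact.
  rewrite eballE//=; apply: (@le_lt_trans _ _ (r ^+ 2 / 2)); last by lra.
  by move: Dz; rewrite mulN1r subr_ge0.
move=> z; rewrite !mulf_eq0 !negb_or => /and3P[_ p0 e0]; split.
  rewrite /A mulN1r subr_ge0 leNgt; apply: contra p0 => /hm h0.
  by apply/eqP; exact: h0.
have /andP[_ e1] := e0; rewrite /D mulN1r subr_ge0 leNgt; apply: contra e1 => /ltW e1.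
by apply/eqP; exact: bball_out.
Qed.

Let eta_le x : `|eta x| <= @wconst R k / V.
Proof. by rewrite ger0_norm ?wt_ge0 ?wt_le. Qed.

Let L := 1 + @wconst R 0.
Let L0 : 0 < L. Proof. by rewrite addr_gt0// wconst_gt0. Qed.

Lemma time_test_FQ : FQ alpha r t0 x0 xi /\
  forall z, dt xi z = kappa^-1 * (psi (z.1 : R) * eta z.2).
Proof.
have [p gp hp] := wt_gradient r0 V0 hCf Cf0.
have gxi := is_gradientZ kappa^-1 (is_gradientM (@is_gradient_fst R k _ _ grad_phi) (is_gradient_snd gp)).
have dtE z : dt xi z = kappa^-1 * (psi (z.1 : R) * eta z.2).
  by rewrite (dt_gradient z gxi) /= mulr0 add0r [psi _ * _]mulrC.
have ki : 0 <= kappa^-1 by rewrite invr_ge0 ltW.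
have w0 : 0 <= @wconst R k / V by rewrite divr_ge0 ?ltW ?wconst_gt0.
have phi_le t : `|phi t| <= 2 * rho * L by exact: tphi_le.
split=> //; split; first exact: Cc_xi.
have s1 : (supn xi <= (kappa^-1 * (2 * rho * L * (@wconst R k / V)))%:E)%E.
  apply: supn_le => z; rewrite normrM [`|kappa^-1|]ger0_norm// ler_wpM2l// normrM.
  by rewrite ler_pM// eta_le.
have s2 : (supn (fun z => enorm (gradx xi z)) <=
    (kappa^-1 * (2 * rho * L * (@wconst R k / V * (4 * Cf / r))))%:E)%E.
  apply: supn_le => z; rewrite ger0_norm ?enorm_ge0// (gradx_gradient z gxi) /=.
  rewrite enormZ [`|kappa^-1|]ger0_norm// ler_wpM2l// scalev_zero addv0 enormZ.
  by rewrite ler_pM// ?enorm_ge0.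
have s3 : (supn (dt xi) <= (kappa^-1 * (L * (@wconst R k / V)))%:E)%E.
  apply: supn_le => z; rewrite dtE normrM [`|kappa^-1|]ger0_norm// ler_wpM2l// normrM.
  by rewrite ler_pM// ?eta_le//; exact: tpsi_le.
apply: le_trans (leeD (leeD s1 (lee_wpmul2l _ s2)) (lee_wpmul2l _ s3)) _.
- by rewrite lee_fin ltW.
- by rewrite lee_fin; exact: ltW.
rewrite -!EFinM -!EFinD lee_fin -/rho le_eqVlt; apply/orP; left; apply/eqP.
have t1 : tconst != 0 by rewrite gt_eqF// tconst_gt0.
have -> : kappa^-1 * (2 * rho * L * (@wconst R k / V)) +
    r * (kappa^-1 * (2 * rho * L * (@wconst R k / V * (4 * Cf / r)))) +
    rho * (kappa^-1 * (L * (@wconst R k / V))) = kappa^-1 * (rho * (L * @wconst R k * (3 + 8 * Cf)) / V).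
  by field; rewrite !gt_eqF.
by rewrite -/tconst mulVf// gt_eqF.
Qed.

End with_h.

Variable a : car R k.+1 -> R.
Hypothesis inta : mu.-integrable Q (EFin \o a).
Variable N : R.
Hypothesis NE : NQ_dt alpha r t0 x0 a = N%:E.
Let vol := volQ alpha r t0 x0.
Hypothesis vol0 : 0 < vol.
Let A := smean alpha r t0 x0 a.
Let theta := wt (t0 : car R 0) rho.
Let C := \int[leb R 0]_(t in I) (A t * theta t).

Let integrable_A_tame (f : car R 0 -> R) (K : R) : tame f -> (forall t, `|f t| <= K) ->
  (leb R 0).-integrable I (EFin \o (fun t => A t * f t)).
Proof.
move=> tf fK; apply: (integrable_mulr_bounded mI _ _ (fun t _ => fK t)).
  by apply: integrableS (integrable_smean alpha0 r0 V0 inta).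
by apply: measurable_funTS; exact: tame_measurable.
Qed.

Lemma time_estimate :
  (\int[leb R 0]_(t in I) (`|A t - C|)%:E <= (kappa * vol / r * N)%:E)%E.
Proof.
have iA : (leb R 0).-integrable I (EFin \o A).
  by apply: integrableS (integrable_smean alpha0 r0 V0 inta).
have iC : (leb R 0).-integrable I (EFin \o (fun=> C) : car R 0 -> \bar R).
  have := integrableZl measurableT C (integrable_indic_eball (t0 : car R 0) rho0).
  move=> /(integrableS measurableT mI (@subsetT _ I)).
  apply: eq_integrable => // t /[!inE] It; by rewrite /= indicE mem_set// -EFinM mulr1.
have iP : (leb R 0).-integrable I (EFin \o (fun t => A t - C)) by exact: (integrableB mI iA iC).
apply: (@L1_duality R 0 I mI (fun t => A t - C) iP (bcut (t0 : car R 0) rho)).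
- by move=> n; exact: tame_bcut.
- by move=> n z; exact: bcut_01.
- by move=> z Iz; exact: bcut_cvg.
move=> n h th h1; pose psi := tpsi t0 rho n h.
pose hb (t : car R 0) := bcut (t0 : car R 0) rho n t * h t.
have thb : tame hb by apply: tameM => //; exact: tame_bcut.
have hb1 t : `|hb t| <= 1.
  have /andP[? ?] := bcut_01 (t0 : car R 0) t rho n.
  by rewrite normrM -[leRHS]mulr1 ler_pM// ger0_norm.
have hbI t : ~ I t -> hb t = 0.
  rewrite /I eballE//= => /negP; rewrite -leNgt => ht; rewrite /hb /bcut bump_eq0 ?mul0r//.
  have : 0 <= n%:R * (sqdist (t0 : car R 0) t - rho ^+ 2) by rewrite mulr_ge0 ?subr_ge0.
  by lra.
have ihb : (leb R 0).-integrable setT (EFin \o hb).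
  apply: (@integrable_bounded_eball R 0 t0 rho rho0 hb 1) => //; exact: tame_measurable.
have ihbI : (leb R 0).-integrable I (EFin \o hb) by apply: integrableS ihb.
pose c := \int[leb R 0]_s hb s.
have cI : c = \int[leb R 0]_(s in I) hb s.
  rewrite [RHS]Rintegral_mkcond; apply: eq_Rintegral => s _; rewrite patchE.
  by case: ifPn => //; rewrite notin_setE => /hbI.
have iAh := integrable_A_tame thb hb1.
have theta_le t : `|theta t| <= @wconst R 0 / fine (leb R 0 I).
  by rewrite ger0_norm ?wt_ge0 ?wt_le.
have iAt := integrable_A_tame (tame_wt (t0 : car R 0) rho) theta_le.
have iCh : (leb R 0).-integrable I (EFin \o (fun t => C * hb t)).
  exact: (integrableZl mI C ihbI).
(* [tpsi] subtracts [c theta] from [hb], and [C] is the integral of [A theta]: both sides differ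
   from the integral of [A hb] by the same [c * C]. *)
have key : \int[leb R 0]_(t in I) ((A t - C) * hb t) = \int[leb R 0]_(t in I) (A t * psi t).
  transitivity (\int[leb R 0]_(t in I) (A t * hb t) - c * C).
    rewrite (_ : c * C = \int[leb R 0]_(t in I) (C * hb t)); last first.
      by rewrite RintegralZl// -cI mulrC.
    rewrite -RintegralB//; apply: eq_Rintegral => t _; ring.
  rewrite /C -RintegralZl// -RintegralB//; last first.
    exact: (integrableZl mI c iAt).
  by apply: eq_Rintegral => t _; rewrite /psi /tpsi -/(hb t) /theta -/c; ring.
have iPh : (leb R 0).-integrable I (EFin \o (fun t => (A t - C) * hb t)).
  apply: (integrable_mulr_bounded mI iP _ (fun t _ => hb1 t)).
  by apply: measurable_funTS; exact: tame_measurable.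
rewrite -[X in `|X|%E]fineK; last exact: (integrable_fin_num mI iPh).
rewrite -[fine _]/(\int[leb R 0]_(t in I) ((A t - C) * hb t)) key abse_EFin lee_fin.
have tpsi' : tame psi by exact: tame_tpsi.
rewrite (smean_pairing alpha0 r0 V0 inta tpsi').
have [FQxi dtxi] := time_test_FQ n th h1.
have ub := NQ_dt_ge a FQxi; rewrite NE in ub.
have tpe : tame (fun z : car R k.+1 => psi (z.1 : R) * wt x0 r z.2).
  by apply: tameM; [exact: (tame_fst k tpsi')|exact: (tame_snd (tame_wt x0 r))].
have ipe := integrable_mulr_tame alpha0 r0 inta tpe.
move: ub.
under eq_integral => z _ do rewrite dtxi mulrCA EFinM.
rewrite integralZl; [|exact: measurable_pcyl|exact: ipe].
have E : (\int[leb R k.+1]_(z in pcyl alpha r t0 x0)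
      (a z * (tpsi t0 rho n h (z.1 : R) * wt x0 r z.2))%:E)%E =
    (\int[mu]_(z in Q) (a z * (psi (z.1 : R) * wt x0 r z.2)))%:E.
  by rewrite /Rintegral fineK//; exact: (integrable_fin_num (measurable_pcyl t0 x0 alpha0 r0) ipe).
rewrite E; set J := \int[mu]_(z in Q) _.
rewrite (_ : (- ((kappa^-1)%:E * J%:E))%E = (- (kappa^-1 * J))%:E)// abse_EFin.
rewrite -EFinM lee_fin normrN normrM [`|kappa^-1|]ger0_norm; last by rewrite invr_ge0 ltW.
move=> ub.
(* It remains to solve [(r / vol) kappa^-1 |J| <= N] for [|J|]. *)
rewrite [leRHS]mulrC -ler_pdivrMr; last by rewrite divr_gt0// mulr_gt0.
apply: le_trans ub; rewrite -/vol le_eqVlt; apply/orP; left; apply/eqP.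
by field; rewrite !gt_eqF.
Qed.

End time_estimate.

(** * Weighted means *)

Section weighted_mean.
Context {R : realType} d (T : measurableType d) (mu : {measure set T -> \bar R}).
Variables (D : set T) (mD : measurable D) (vol c0 : R).
Hypotheses (vol0 : 0 < vol) (volE : mu D = vol%:E).
Variables (a rho : T -> R).
Hypotheses (inta : mu.-integrable D (EFin \o a)) (irho : mu.-integrable D (EFin \o rho))
  (rho0 : forall z, D z -> 0 <= rho z).
Let P : R := \int[mu]_(z in D) rho z.
Hypothesis P0 : 0 < P.
Hypothesis rho_le : {ae mu, forall z, D z -> rho z <= c0 / vol * P}.
(** The absolute value keeps the constant nonnegative whatever the sign of [c0]. *)
Let K : R := `|c0| / vol * P.

Let K0 : 0 <= K.
Proof. by apply: mulr_ge0; [rewrite divr_ge0// ltW|rewrite ltW]. Qed.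

Let mrho : measurable_fun D rho.
Proof. by apply/measurable_EFinP; exact: (measurable_int _ irho). Qed.

Let weighted_le (f : T -> R) : mu.-integrable D (EFin \o f) ->
  (\int[mu]_(z in D) (`|f z * rho z|)%:E <= \int[mu]_(z in D) (K * `|f z|)%:E)%E.
Proof.
move=> intf; have mf : measurable_fun D f by apply/measurable_EFinP; exact: (measurable_int _ intf).
apply: ae_ge0_le_integral => //.
- by apply/measurable_EFinP/measurableT_comp => //; exact: measurable_funM.
- by move=> z _; rewrite lee_fin mulr_ge0.
- by apply/measurable_EFinP/measurable_funM => //; exact: measurableT_comp.
move: rho_le; apply: filterS => z hz Dz; rewrite lee_fin normrM mulrC ler_wpM2r//.
rewrite ger0_norm ?rho0//; apply: (le_trans (hz Dz)); rewrite /K.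
apply: ler_wpM2r; first exact: ltW.
by apply: ler_wpM2r; [rewrite invr_ge0 ltW|exact: ler_norm].
Qed.

Let intK (f : T -> R) : mu.-integrable D (EFin \o f) ->
  mu.-integrable D (EFin \o (fun z => K * `|f z|)).
Proof. by move=> intf; exact: (integrableZl mD K (integrable_abse intf)). Qed.

Let weighted_integrable (f : T -> R) : mu.-integrable D (EFin \o f) ->
  mu.-integrable D (EFin \o (fun z => f z * rho z)).
Proof.
move=> intf; have mf : measurable_fun D f by apply/measurable_EFinP; exact: (measurable_int _ intf).
apply/integrableP; split; first by apply/measurable_EFinP; exact: measurable_funM.
apply: le_lt_trans (weighted_le intf) _.
have /integrableP[_] := intK intf; apply: le_lt_trans.
apply: ge0_le_integral => //.
- by move=> z _; rewrite lee_fin mulr_ge0.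
- by apply/measurable_EFinP/measurable_funM => //; exact: measurableT_comp.
- by apply/measurableT_comp => //; apply/measurable_EFinP/measurable_funM => //; exact: measurableT_comp.
- by move=> z _; exact: lee_abs.
Qed.

Let int_cst (C : R) : mu.-integrable D (EFin \o (fun=> C)).
Proof.
apply/integrableP; split; first exact/measurable_EFinP.
rewrite [X in (X < _)%E](_ : _ = (\int[mu]_(z in D) (cst `|C|%:E) z)%E)//.
by rewrite integral_cst// volE -EFinM ltry.
Qed.

(** [W - C] is the weighted mean of [a - C], so the bound on [rho] gives
    [|W - C| <= |c0| / vol * J]; integrating this constant over [D] multiplies it by [vol]. *)
Lemma weighted_mean_le (C : R) :
  \int[mu]_(z in D) `|a z - (\int[mu]_(z in D) (a z * rho z)) / P| <=
  (1 + `|c0|) * \int[mu]_(z in D) `|a z - C|.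
Proof.
set W := _ / P; set J := \int[mu]_(z in D) `|a z - C|.
have iaC : mu.-integrable D (EFin \o (fun z => a z - C)) by exact: (integrableB mD inta (int_cst C)).
have iaW : mu.-integrable D (EFin \o (fun z => a z - W)) by exact: (integrableB mD inta (int_cst W)).
have iaCn : mu.-integrable D (EFin \o (fun z => `|a z - C|)) by exact: integrable_abse iaC.
have WC : `|W - C| <= `|c0| / vol * J.
  have -> : W - C = (\int[mu]_(z in D) ((a z - C) * rho z)) / P.
    rewrite (_ : \int[mu]_(z in D) ((a z - C) * rho z) =
        \int[mu]_(z in D) (a z * rho z) - C * P).
      by rewrite mulrBl mulfK// gt_eqF.
    rewrite -RintegralZl// -RintegralB//; last exact: (integrableZl mD C irho).
      by apply: eq_Rintegral => z _; rewrite mulrBl.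
    exact: weighted_integrable.
  rewrite normrM normfV [`|P|]gtr0_norm// ler_pdivrMr//.
  apply: le_trans (le_normr_Rintegral mD (weighted_integrable iaC)) _.
  rewrite [leRHS](_ : _ = K * J); last by rewrite /K mulrAC.
  rewrite /J -RintegralZl//; rewrite /Rintegral fine_le//.
  - by apply: (integrable_fin_num mD); exact: (integrable_abse (weighted_integrable iaC)).
  - by apply: (integrable_fin_num mD); exact: (intK iaC).
  - exact: weighted_le.
apply: le_trans (_ : \int[mu]_(z in D) (`|a z - C| + `|W - C|) <= _).
  apply: le_Rintegral => //; first exact: integrable_abse iaW.
    exact: (integrableD mD iaCn (int_cst _)).
  move=> z _; rewrite (_ : a z - W = (a z - C) - (W - C)); last by ring.
  exact: ler_normB.
rewrite (RintegralD mD iaCn (int_cst _)).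
rewrite (Rintegral_cst mu mD) volE /= -/J mulrDl mul1r lerD2l.
apply: le_trans (ler_wpM2r (ltW vol0) WC) _.
rewrite le_eqVlt; apply/orP; left; apply/eqP; field.
by rewrite gt_eqF.
Qed.

End weighted_mean.

Section cylinder.
Context {R : realType} (k : nat).
Variables (alpha r t0 : R) (x0 : car R k).
Hypotheses (alpha0 : 0 < alpha) (r0 : 0 < r).
Let Q := pcyl alpha r t0 x0.
Let rho := alpha * r ^+ 2.
Let rho0 : 0 < rho. Proof. by rewrite mulr_gt0// exprn_gt0. Qed.
Let B := eball x0 r.
Let I := eball (t0 : car R 0) rho.
Let mB : measurable B := measurable_eball x0 r0.
Let mI : measurable I := measurable_eball (t0 : car R 0) rho0.
Let mQ : measurable Q := measurable_pcyl t0 x0 alpha0 r0.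

Lemma leb_pcyl : leb R k.+1 Q = (2 * rho * fine (leb R k B))%:E.
Proof.
rewrite /Q pcylE leb_setX//.
by rewrite EFinM -(fine_eball x0 r0) -(fine_eball (t0 : car R 0) rho0) fine_eball0.
Qed.

Lemma volQE : volQ alpha r t0 x0 = 2 * rho * fine (leb R k B).
Proof. by rewrite /volQ leb_pcyl. Qed.

Lemma integral_pcyl_time (f : car R 0 -> R) : measurable_fun setT f -> (forall t, 0 <= f t) ->
  (\int[leb R k.+1]_(z in Q) (f (z.1 : R))%:E =
   (fine (leb R k B))%:E * \int[leb R 0]_(t in I) (f t)%:E)%E.
Proof.
move=> mf f0.
have mf1 : measurable_fun setT (fun z : car R k.+1 => (f (z.1 : R))%:E).
  by apply/measurable_EFinP; exact: (measurableT_comp mf measurable_fst).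
rewrite integral_mkcond leb_tonelli1; last 2 first.
- by apply/(measurable_restrictT _ mQ); exact: measurable_funTS.
- by move=> z; rewrite patchE; case: ifPn => // _; rewrite lee_fin.
rewrite -ge0_integralZl//; last first.
- by move=> t _; rewrite lee_fin.
- by apply: measurable_funTS; exact/measurable_EFinP.
rewrite [RHS]integral_mkcond; apply: eq_integral => t _.
rewrite [RHS]patchE; case: ifPn => tI.
  rewrite (_ : (fun x => _) = ((fun=> (f t)%:E) \_ B)); last first.
    apply/funext => x; rewrite !patchE /Q pcylE in_setX/=.
    by rewrite tI /= -/B; case: ifPn.
  by rewrite -integral_mkcond integral_cst// (fine_eball x0 r0) muleC.
rewrite integral0_eq// => x _; rewrite patchE /Q pcylE in_setX/=.
by rewrite (negbTE tI).
Qed.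

End cylinder.

(** * Conclusion *)

(** Triangle inequality through the spatial mean: [|a - A(t)|] is paid for by the gradient and
    [|A(t) - C|] by [N]. *)
Lemma mean_oscillation_le (R : realType) (k : nat) (alpha r t0 Cf N : R) (x0 : car R k)
    (a : car R k.+1 -> R) (g : car R k.+1 -> car R k) :
  0 < alpha -> 0 < r -> 0 < fine (leb R k (eball x0 r)) ->
  0 <= Cf -> (forall y : R, y <= 1 -> `|dbump y| <= Cf) ->
  let Q := pcyl alpha r t0 x0 in
  (leb R k.+1).-integrable Q (EFin \o a) -> weak_gradx Q a g ->
  NQ_dt alpha r t0 x0 a = N%:E ->
  exists C : R, \int[leb R k.+1]_(z in Q) `|a z - C| <=
    2 * @wconst R k * (2 ^+ k.+1 * r * \int[leb R k.+1]_(z in Q) enorm (g z)) +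
    alpha * r * volQ alpha r t0 x0 * tconst k Cf * N.
Proof.
move=> alpha0 r0 V0 Cf0 hCf Q inta wg NE.
have rho0 : 0 < alpha * r ^+ 2 by rewrite mulr_gt0// exprn_gt0.
have vol0 : 0 < volQ alpha r t0 x0 by rewrite volQE// !mulr_gt0.
have mQ : measurable Q := measurable_pcyl t0 x0 alpha0 r0.
have Tle := time_estimate alpha0 r0 V0 Cf0 hCf inta NE vol0.
set C := (X in (\int[_]_(t in _) (`|_ - X|)%:E <= _)%E) in Tle.
have Sle := smean_close alpha0 r0 V0 inta wg.
pose A := smean alpha r t0 x0 a.
have mA : measurable_fun setT A by exact: measurable_smean.
have mA1 : measurable_fun setT (fun z : car R k.+1 => A (z.1 : R)).
  exact: (measurableT_comp mA measurable_fst).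
have ma : measurable_fun Q a by apply/measurable_EFinP; exact: (measurable_int _ inta).
exists C; rewrite -lee_fin.
have m1 : measurable_fun Q (fun z : car R k.+1 => (`|a z - A (z.1 : R)|)%:E).
  apply/measurable_EFinP/measurableT_comp => //.
  by apply: measurable_funB => //; exact: measurable_funTS.
have m2 : measurable_fun Q (fun z : car R k.+1 => (`|A (z.1 : R) - C|)%:E).
  apply/measurable_EFinP/measurableT_comp => //.
  by apply: measurable_funB => //; exact: measurable_funTS.
have Tri : (\int[leb R k.+1]_(z in Q) (`|a z - C|)%:E <=
    \int[leb R k.+1]_(z in Q) (`|a z - A (z.1 : R)|)%:E +
    \int[leb R k.+1]_(z in Q) (`|A (z.1 : R) - C|)%:E)%E.
  rewrite -ge0_integralD//; apply: ge0_le_integral => //.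
  - by apply/measurable_EFinP/measurableT_comp => //; exact: measurable_funB.
  - exact: emeasurable_funD.
  - by move=> z _; rewrite -EFinD lee_fin -[X in `|X|](subrKA (A (z.1 : R))) ler_normD.
have Qle : (\int[leb R k.+1]_(z in Q) (`|A (z.1 : R) - C|)%:E <=
    (alpha * r * volQ alpha r t0 x0 * tconst k Cf * N)%:E)%E.
  rewrite (integral_pcyl_time t0 x0 alpha0 r0 (f := fun t => `|A t - C|))//; last first.
    by apply: measurableT_comp => //; exact: measurable_funB.
  apply: le_trans (lee_wpmul2l _ Tle) _; first by rewrite lee_fin ltW.
  (* Since [kappa = alpha * r ^+ 2 * tconst / V], the product [V * kappa * vol / r] is
     [alpha * r * vol * tconst]. *)
  rewrite -EFinM lee_fin le_eqVlt; apply/orP; left; apply/eqP.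
  by field; rewrite !gt_eqF.
have bound := le_trans Tri (leeD Sle Qle).
rewrite /Rintegral fineK -?EFinD//.
by rewrite ge0_fin_numE ?(le_lt_trans bound) -?EFinD ?ltry// integral_ge0// => z _; rewrite lee_fin.
Qed.

(* spatial dimension m = k.+1 *)
Theorem theorem2p8 (R : realType) (k : nat) (c0 : R) :
  exists c : R, 0 < c /\
  forall (alpha r t0 : R) (x0 : car R k)
         (rho a : car R k.+1 -> R) (g : car R k.+1 -> car R k),
    0 < alpha -> 0 < r ->
    let Q := pcyl alpha r t0 x0 in
    let mu := leb R k.+1 in
    (* rho in L^1(Q), rho >= 0, rho not a.e. zero *)
    measurable_fun Q rho ->
    mu.-integrable Q (fun z => (rho z)%:E) ->
    (forall z, Q z -> 0 <= rho z) ->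
    (0 < \int[mu]_(z in Q) (rho z)%:E)%E ->
    (* ||rho||_oo <= c0 |Q|^-1 ||rho||_1 *)
    {ae mu, forall z, Q z ->
       rho z <= c0 / volQ alpha r t0 x0 * fine (\int[mu]_(z in Q) (rho z)%:E)} ->
    (* a in L^1(I; W^{1,1}(B)): a in L^1(Q) with spatial weak gradient g in L^1(Q) *)
    measurable_fun Q a ->
    mu.-integrable Q (fun z => (a z)%:E) ->
    weak_gradx Q a g ->
    ((volQ alpha r t0 x0)^-1%:E *
       \int[mu]_(z in Q) (`|(a z - wmean Q rho a) / r|)%:E
     <= (c / volQ alpha r t0 x0)%:E * \int[mu]_(z in Q) (enorm (g z))%:E
        + (c * alpha)%:E * NQ_dt alpha r t0 x0 a)%E.
Proof.
have [Cf Cf0 hCf] := @dbump_bounded R.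
pose c1 := @wconst R k; pose c2 : R := tconst k Cf.
have c10 : 0 < c1 by exact: wconst_gt0.
have c20 : 0 < c2 by exact: tconst_gt0.
(* The first summand comes from space, [c2] from time, and [1 + |c0|] is the price of the weighted
   mean. [Cf] belongs to the fixed bump profile, so [c] is chosen before [alpha], [r] and the
   functions. *)
pose c := (1 + `|c0|) * (2 * c1 * 2 ^+ k.+1 + c2).
have cc0 : 0 < 1 + `|c0| by rewrite ltr_wpDr.
exists c; split; first by rewrite mulr_gt0// addr_gt0// !mulr_gt0// exprn_gt0.
have c_gt0 : 0 < c by rewrite mulr_gt0// addr_gt0// !mulr_gt0// exprn_gt0.
move=> alpha r t0 x0 rho a g alpha0 r0 Q mu mrho irho rho0 Prho aerho ma inta wg.
have mQ : measurable Q := measurable_pcyl t0 x0 alpha0 r0.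
pose vol := volQ alpha r t0 x0.
have volE : mu Q = vol%:E by rewrite /mu /Q leb_pcyl// /vol volQE.
(* A null cylinder would make the integral of [rho] vanish. *)
have vol0 : 0 < vol.
  rewrite lt_neqAle -lee_fin -volE measure_ge0 andbT eq_sym; apply/eqP => v0.
  have Q0 : mu Q = 0%E by rewrite volE v0.
  by move: Prho; rewrite (null_set_integral mQ (measurable_int _ irho) Q0) ltxx.
have V0 : 0 < fine (leb R k (eball x0 r)).
  by move: vol0; rewrite /vol volQE// pmulr_rgt0// mulr_gt0// mulr_gt0// exprn_gt0.
have [_ [ig _]] := wg.
pose G := \int[mu]_(z in Q) enorm (g z).
have GE : (\int[mu]_(z in Q) (enorm (g z))%:E = G%:E)%E.
  by rewrite /G /Rintegral fineK//; exact: (integrable_fin_num mQ ig).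
have G0 : 0 <= G by apply: Rintegral_ge0 => z _; exact: enorm_ge0.
rewrite GE.
(* The test function built from [h = 0] lies in [FQ], so the supremum runs over a nonempty set of
   nonnegative values and cannot be [-oo]. *)
have N0 : (0 <= NQ_dt alpha r t0 x0 a)%E.
  have n0 (t : car R 0) : `|0 : R| <= 1 by rewrite normr0.
  have [xiF _] := time_test_FQ t0 alpha0 r0 V0 Cf0 hCf 0 (tame_cst _ _) n0.
  by apply: le_trans (NQ_dt_ge a xiF); rewrite mule_ge0// lee_fin divr_ge0// ltW.
(* If the supremum is [+oo], so is the right-hand side; afterwards it is a real number [N]. *)
case NE : (NQ_dt alpha r t0 x0 a) N0 => [N| |]// N0; last first.
  have -> : ((c * alpha)%:E * +oo = +oo)%E by rewrite gt0_muley// lte_fin mulr_gt0.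
  by rewrite addey ?leey.
have [C hC] := mean_oscillation_le alpha0 r0 V0 Cf0 hCf inta wg NE.
pose P := \int[mu]_(z in Q) rho z.
have P0 : 0 < P.
  by rewrite -lte_fin /P /Rintegral fineK//; exact: (integrable_fin_num mQ irho).
have hW := weighted_mean_le mQ vol0 volE inta irho rho0 P0 aerho C.
set W := wmean Q rho a.
have iaW : mu.-integrable Q (EFin \o (fun z => a z - W)).
  have iW : mu.-integrable Q (EFin \o (fun=> W) : car R k.+1 -> \bar R).
    apply/integrableP; split; first exact/measurable_EFinP.
    rewrite [X in (X < _)%E](_ : _ = (\int[mu]_(z in Q) (cst `|W|%:E) z)%E)//.
    by rewrite integral_cst// volE -EFinM ltry.
  exact: (integrableB mQ inta iW).
have LE : (\int[mu]_(z in Q) (`|(a z - W) / r|)%:E = (r^-1 * \int[mu]_(z in Q) `|a z - W|)%:E)%E.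
  have iaWn : mu.-integrable Q (EFin \o (fun z => `|a z - W|)) by exact: integrable_abse iaW.
  under eq_integral => z _ do rewrite normrM [`|r^-1|]gtr0_norm ?invr_gt0// mulrC EFinM.
  rewrite integralZl// EFinM /Rintegral fineK//.
  exact: (integrable_fin_num mQ iaWn).
rewrite LE -!EFinM -EFinD lee_fin.
have hD : \int[mu]_(z in Q) `|a z - W| <=
    (1 + `|c0|) * (2 * c1 * (2 ^+ k.+1 * r * G) + alpha * r * vol * c2 * N).
  by apply: le_trans hW _; rewrite ler_wpM2l// ltW.
have rv0 : 0 < vol^-1 * r^-1 by rewrite mulr_gt0// invr_gt0.
rewrite mulrA; apply: le_trans (ler_wpM2l (ltW rv0) hD) _.
(* Dividing by [vol * r] removes [r] from the gradient term, leaving [1 / vol], and removes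
   [r * vol] from the time term, leaving [alpha]. *)
have -> : vol^-1 * r^-1 * ((1 + `|c0|) * (2 * c1 * (2 ^+ k.+1 * r * G) + alpha * r * vol * c2 * N)) =
    (1 + `|c0|) * (2 * c1 * 2 ^+ k.+1) / vol * G + (1 + `|c0|) * c2 * alpha * N.
  by field; rewrite !gt_eqF.
rewrite lee_fin in N0.
apply: lerD.
  apply: ler_wpM2r => //; apply: ler_wpM2r; first by rewrite invr_ge0 ltW.
  by rewrite /c ler_pM2l// lerDl ltW.
apply: ler_wpM2r => //; apply: ler_wpM2r; first exact: ltW.
by rewrite /c ler_pM2l// lerDr ltW// !mulr_gt0// exprn_gt0.
Qed.
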